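(* Let $\mathcal{O}=\{t_1,\dots,t_\mu\}$ be an order ideal in $\mathbb{T}^n$ with border $\partial\mathcal{O}=\{b_1,\dots,b_\nu\}$, and let $I$ be a 0-dimensional radical ideal in $P$ which has an $\mathcal{O}$-border basis. Suppose that there exist a linear form $\ell=\ell_1x_1+\cdots+\ell_nx_n$ with $\ell_i\in K$ such that $\ell_n\ne0$ and polynomials $\chi(\ell),f_i(\ell)\in K[\ell]$ such that $$I=\bigl(\chi(\ell),\ x_1-f_1(\ell),\ \dots,\ x_{n-1}-f_{n-1}(\ell)\bigr)$$ and such that $\chi(\ell)=\ell^\mu-\lambda_\mu\ell^{\mu-1}-\cdots-\lambda_2\ell-\lambda_1$ with $\lambda_i\in K$ and $\deg(f_i(\ell))<\mu$. For every tuple $d=(d_{ij})\in K^{n\mu}$ ($i=1,\dots,n$, $j=1,\dots,\mu$), define $\tilde\chi(\ell)=\ell^\mu-\sum_{i=1}^\mu(\lambda_i+d_{ni})\ell^{i-1}$ and $\tilde f_i(\ell)=f_i(\ell)+\sum_{j=1}^\mu d_{ij}\ell^{j-1}$ for $i\in\{1,\dots,n-1\}$, and let $$I_d=\bigl(\tilde\chi(\ell),\ x_1-\tilde f_1(\ell),\ \dots,\ x_{n-1}-\tilde f_{n-1}(\ell)\bigr).$$ Let $\mathcal{P}=\{1,\ell,\dots,\ell^{\mu-1}\}$. Then there is a non-empty Zariski open neighborhood $U$ of $(0,\dots,0)$ in $K^{n\mu}$ (regarded as the affine space $\mathbb{A}^{n\mu}_K$) such that the following hold. (a) For all tuples $d$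 in $U$, the ideal $I_d$ has an $\mathcal{O}$-border basis which can be computed by viewing $H_d=\{\tilde\chi(\ell),x_1-\tilde f_1(\ell),\dots,x_{n-1}-\tilde f_{n-1}(\ell)\}$ as a pseudo $\mathcal{P}$-border basis of $I_d$ and performing a base change: if $M_d\in\mathrm{Mat}_\mu(K)$ and $N_d\in\mathrm{Mat}_{\mu,\nu}(K)$ are the matrices such that $\mathcal{O}=\mathcal{P}\cdot M_d$ and $\partial\mathcal{O}=\mathcal{P}\cdot N_d$ hold in $P/I_d$, then $M_d$ is invertible and the coefficient matrix of the $\mathcal{O}$-border basis of $I_d$ is $C_{I_d}=M_d^{-1}\cdot N_d$. (b) The morphism $\Gamma:U\to\mathbb{C}_{\mathcal{O}}$ given by $d\mapsto I_d$ yields an isomorphism between the open set $U$ in $K^{n\mu}$ and the open set $\mathbb{B}_{\mathcal{O},\mathcal{P}}\cap\mathbb{C}_{\mathcal{O}}$ in $\mathbb{C}_{\mathcal{O}}$. In particular, the variety $\mathbb{C}_{\mathcal{O}}$ is rational, and it is smooth of dimension $n\mu$ at its radical points.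
   Context: $K$ is a field with algebraic closure $\overline{K}$, $P=K[x_1,\dots,x_n]$, $\overline{P}=\overline{K}[x_1,\dots,x_n]$, and $\mathbb{T}^n$ is the monoid of terms. An order ideal is a finite nonempty set $\mathcal{O}\subset\mathbb{T}^n$ closed under forming divisors, with border $\partial\mathcal{O}=(x_1\mathcal{O}\cup\cdots\cup x_n\mathcal{O})\setminus\mathcal{O}$. A finite set $\mathcal{S}\subset P$ is a basis modulo an ideal $J\subset P$ if the residue classes of its elements form a $K$-basis of $P/J$. $J$ has an $\mathcal{O}$-border basis if $\mathcal{O}$ is a basis modulo $J$; the border basis is then $\{b_j-\sum_i\gamma_{ij}t_i\}_j\subset J$ with a unique coefficient matrix $C_J=(\gamma_{ij})\in\mathrm{Mat}_{\mu,\nu}(K)$, i.e. $\partial\mathcal{O}\equiv\mathcal{O}\cdot C_J\pmod J$ (sets are treated as row vectors). The same terminology is used over $\overline{K}$. The set $\mathcal{P}=\{1,\ell,\dots,\ell^{\mu-1}\}$ is the image of $\{1,x_n,\dots,x_n^{\mu-1}\}$ under the linear change of coordinates $x_i\mapsto x_i$ ($i<n$), $x_n\mapsto\ell$; its pseudo border is $b\mathcal{P}=\{x_1,\dots,x_{n-1},\ell^\mu\}$ (the image of the set of minimal monomial generators $\{x_1,\dots,x_{n-1},x_n^\mu\}$ of $\mathbb{T}^n\setminus\{1,x_n,\dots,x_n^{\mu-1}\}$). A pseudo $\mathcal{P}$-border basis of an ideal $J$ is a set of generators of $J$ of the form $\{b-p_b\mid b\in b\mathcal{P}\}$, with each $p_b$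 a $K$-linear combination of elements of $\mathcal{P}$, such that $\mathcal{P}$ is a basis modulo $J$. Border basis scheme: let $c_{ij}$ ($1\le i\le\mu$, $1\le j\le\nu$) be indeterminates. For $1\le k\le n$ let $\mathcal{A}_k$ be the $\mu\times\mu$ matrix whose $m$-th column is the $i$-th standard basis vector if $x_kt_m=t_i$, and $(c_{1j},\dots,c_{\mu j})^{\rm tr}$ if $x_kt_m=b_j$. Let $I(\mathbb{B}_{\mathcal{O}})\subset K[c_{ij}]$ be generated by the entries of all $\mathcal{A}_k\mathcal{A}_\ell-\mathcal{A}_\ell\mathcal{A}_k$, and $\mathbb{B}_{\mathcal{O}}=\mathrm{Spec}(K[c_{ij}]/I(\mathbb{B}_{\mathcal{O}}))$. Its $K$-rational points correspond to the ideals $J\subset P$ having an $\mathcal{O}$-border basis, via $J\mapsto C_J$; similarly for $\overline{K}$-rational points and ideals of $\overline{P}$. $\mathbb{B}_{\mathcal{O},\mathcal{P}}$ is the open subset of $\mathbb{B}_{\mathcal{O}}$ parametrizing those ideals modulo which also $\mathcal{P}$ is a basis (i.e. the points over which the residue classes of $\mathcal{P}$ form a basis of the fiber of the universal family $K[x_1,\dots,x_n,c_{ij}]/(I(\mathbb{B}_{\mathcal{O}})+(b_j-\sum_ic_{ij}t_i)_j)$). Principal component: $\mathbb{C}_{\mathcal{O}}$ is the closed subscheme of $\mathbb{B}_{\mathcal{O}}$ such that $\mathbb{C}_{\mathcal{O}}\times_{\mathrm{Spec}(K)}\mathrm{Spec}(\overline{K})$ is the closure (with its reduced structure) of the set of all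 points corresponding to vanishing ideals $I_{\mathbb{X}}\subset\overline{P}$ having an $\mathcal{O}$-border basis, where $\mathbb{X}\subseteq\mathbb{A}^n(\overline{K})$ is a reduced scheme of length $\mu$. A radical point of $\mathbb{C}_{\mathcal{O}}$ is a point corresponding to a radical ideal having an $\mathcal{O}$-border basis. In (b), ''$d\mapsto I_d$'' means that $d$ is sent to the point of $\mathbb{B}_{\mathcal{O}}$ corresponding to $I_d$. *)

(* Defs.v *)
From HB Require Import structures.
From mathcomp Require Import all_boot all_order all_algebra.
From mathcomp Require Export mpoly.

Set Implicit Arguments.
Unset Strict Implicit.
Unset Printing Implicit Defensive.

Import GRing.Theory.
Local Open Scope ring_scope.

Section Ideals.
Variable R : comNzRingType.

Definition is_ideal (J : R -> Prop) : Prop :=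
  [/\ J 0, (forall a b, J a -> J b -> J (a + b)) & (forall a b, J b -> J (a * b))].

Definition ideal_gen (S : R -> Prop) (x : R) : Prop :=
  exists (m : nat) (a s : 'I_m -> R),
    (forall i, S (s i)) /\ x = \sum_i a i * s i.

Definition family_ideal (I : Type) (h : I -> R) : R -> Prop :=
  ideal_gen (fun x => exists i, x = h i).

Definition radical (J : R -> Prop) : Prop := forall a k, J (a ^+ k) -> J a.

Definition prime_ideal (J : R -> Prop) : Prop :=
  [/\ is_ideal J, ~ J 1 & forall a b, J (a * b) -> J a \/ J b].

End Ideals.

Section Quotients.
Variables (F : fieldType) (n : nat).
Local Notation P := {mpoly F[n]}.
Implicit Types J : P -> Prop.

Definition spans_mod (m : nat) (v : 'I_m -> P) J : Prop :=
  forall g, exists a : 'I_m -> F, J (g - \sum_i a i *: v i).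

(* The residue classes of the family v form an F-basis of P / J. *)
Definition basis_mod (m : nat) (v : 'I_m -> P) J : Prop :=
  (forall a : 'I_m -> F, J (\sum_i a i *: v i) -> forall i, a i = 0)
  /\ spans_mod v J.

(* w = v *m A in P / J, where the families v and w are read as row vectors. *)
Definition congr_mod (m p : nat) (v : 'I_m -> P) (w : 'I_p -> P)
    (A : 'M[F]_(m, p)) J : Prop :=
  forall j, J (w j - \sum_i A i j *: v i).

Definition zero_dimensional J : Prop :=
  ~ J 1 /\ exists (m : nat) (v : 'I_m -> P), spans_mod v J.

End Quotients.

Section OrderIdeals.
Variables (n mu nu : nat).

Definition is_order_ideal (t : mu.-tuple 'X_{1..n}) : Prop :=
  [/\ (0 < mu)%N, uniq t
    & forall m m' : 'X_{1..n}, (m' <= m)%MM -> m \in t -> m' \in t].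

Definition is_border (t : mu.-tuple 'X_{1..n}) (b : nu.-tuple 'X_{1..n}) : Prop :=
  uniq b /\
  forall m : 'X_{1..n},
    m \in b <-> (exists (k : 'I_n) (i : 'I_mu), m = (U_(k) + tnth t i)%MM)
                /\ m \notin t.

Definition terms (F : fieldType) (m : nat) (s : m.-tuple 'X_{1..n})
    (i : 'I_m) : {mpoly F[n]} := 'X_[tnth s i].

Definition has_border_basis (F : fieldType) (t : mu.-tuple 'X_{1..n})
    (J : {mpoly F[n]} -> Prop) : Prop :=
  basis_mod (terms F t) J.

(* C is the coefficient matrix of the border basis of J; the coordinates on
   the affine space containing the border basis scheme are ordered by mxvec. *)
Definition corresponds (F : fieldType) (t : mu.-tuple 'X_{1..n})
    (b : nu.-tuple 'X_{1..n}) (J : {mpoly F[n]} -> Prop)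
    (x : 'rV[F]_(mu * nu)) : Prop :=
  has_border_basis t J /\ congr_mod (terms F t) (terms F b) (vec_mx x) J.

End OrderIdeals.

(* Ideals given by a linear form l with nonzero last coefficient: the
   indeterminates are indexed by 'I_n.+1, the last one being ord_max and the
   others lift ord_max k for k : 'I_n. *)
Section ShapePosition.
Variables (F : fieldType) (n mu : nat) (ell : 'I_n.+1 -> F).
Local Notation P := {mpoly F[n.+1]}.

Definition linear_form : P := \sum_i ell i *: 'X_i.

Definition powers (j : 'I_mu) : P := linear_form ^+ j.

Definition pseudo_border (i : 'I_n.+1) : P :=
  if unlift ord_max i is Some k then 'X_(lift ord_max k) else linear_form ^+ mu.

Definition is_pseudo_border_basis (H : 'I_n.+1 -> P) (J : P -> Prop) : Prop :=
  [/\ forall g, J g <-> family_ideal H g,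
      forall i, exists a : 'I_mu -> F,
        H i = pseudo_border i - \sum_j a j *: powers j
    & basis_mod powers J].

Definition char_poly_of (lam : 'I_mu -> F) : {poly F} :=
  'X^mu - \sum_(j < mu) lam j *: 'X^j.

Definition shape_gens (lam : 'I_mu -> F) (f : 'I_n -> {poly F})
    (i : 'I_n.+1) : P :=
  if unlift ord_max i is Some k
  then 'X_(lift ord_max k) - horner_alg linear_form (f k)
  else horner_alg linear_form (char_poly_of lam).

Definition perturb_lam (lam : 'I_mu -> F) (d : 'M[F]_(n.+1, mu)) (j : 'I_mu) : F :=
  lam j + d ord_max j.

Definition perturb_f (f : 'I_n -> {poly F}) (d : 'M[F]_(n.+1, mu))
    (k : 'I_n) : {poly F} :=
  f k + \sum_(j < mu) d (lift ord_max k) j *: 'X^j.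

Definition perturbed_gens (lam : 'I_mu -> F) (f : 'I_n -> {poly F})
    (d : 'M[F]_(n.+1, mu)) : 'I_n.+1 -> P :=
  shape_gens (perturb_lam lam d) (perturb_f f d).

End ShapePosition.

(* K-varieties, by their points over an extension iota : K -> L.  Subsets of
   affine space are sets of L-points cut out by polynomials over K; for L an
   algebraic closure of K they determine geometrically reduced K-schemes, and
   the regular maps below are the morphisms of K-schemes between those. *)
Section Varieties.
Variables (K L : fieldType) (iota : {rmorphism K -> L}).

Definition ev (N : nat) (p : {mpoly K[N]}) (x : 'rV[L]_N) : L :=
  (map_mpoly iota p).@[fun k => x 0 k].

Definition zero_locus (N : nat) (J : {mpoly K[N]} -> Prop) (x : 'rV[L]_N) : Prop :=
  forall p, J p -> ev p x = 0.

Definition extended_ideal (N : nat) (J : {mpoly K[N]} -> Prop) :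
    {mpoly L[N]} -> Prop :=
  ideal_gen (fun q => exists2 p, J p & q = map_mpoly iota p).

Definition open_in (N : nat) (X W : 'rV[L]_N -> Prop) : Prop :=
  exists E : {mpoly K[N]} -> Prop,
    forall x, W x <-> X x /\ exists2 g, E g & ev g x != 0.

Definition regular_on (N : nat) (W : 'rV[L]_N -> Prop) (h : 'rV[L]_N -> L) : Prop :=
  forall x0, W x0 ->
    exists p q : {mpoly K[N]}, ev q x0 != 0 /\
      forall x, W x -> ev q x != 0 -> h x = ev p x / ev q x.

Definition is_morphism (N M : nat) (W : 'rV[L]_N -> Prop) (W' : 'rV[L]_M -> Prop)
    (G : 'rV[L]_N -> 'rV[L]_M) : Prop :=
  (forall x, W x -> W' (G x)) /\ (forall k, regular_on W (fun x => G x 0 k)).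

Definition is_isomorphism (N M : nat) (W : 'rV[L]_N -> Prop)
    (W' : 'rV[L]_M -> Prop) (G : 'rV[L]_N -> 'rV[L]_M) : Prop :=
  is_morphism W W' G /\
  exists G' : 'rV[L]_M -> 'rV[L]_N,
    [/\ is_morphism W' W G', forall x, W x -> G' (G x) = x
      & forall y, W' y -> G (G' y) = y].

(* Integral, and birational over K to some affine space. *)
Definition is_rational (N : nat) (J : {mpoly K[N]} -> Prop) : Prop :=
  prime_ideal J /\
  exists (m : nat) (V : 'rV[L]_m -> Prop) (W : 'rV[L]_N -> Prop)
         (G : 'rV[L]_m -> 'rV[L]_N),
    [/\ open_in (fun _ => True) V, exists x, V x,
        open_in (zero_locus J) W, exists y, W y & is_isomorphism V W G].

Definition algebraically_independent_mod (N m : nat) (J : {mpoly K[N]} -> Prop)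
    (z : 'I_m -> {mpoly K[N]}) : Prop :=
  forall Q : {mpoly K[m]}, J (Q \mPo [tuple z i | i < m]) -> Q = 0.

(* The dimension of the integral variety with ideal J: the transcendence
   degree over K of its coordinate ring (equivalently, of its function field). *)
Definition variety_dim (N : nat) (J : {mpoly K[N]} -> Prop) (D : nat) : Prop :=
  (exists z : 'I_D -> {mpoly K[N]}, algebraically_independent_mod J z) /\
  (forall z : 'I_D.+1 -> {mpoly K[N]}, ~ algebraically_independent_mod J z).

(* The Zariski tangent space at the L-point x has L-dimension D. *)
Definition tangent_dim (N : nat) (J : {mpoly K[N]} -> Prop) (x : 'rV[L]_N)
    (D : nat) : Prop :=
  exists T : 'M[L]_(D, N), row_free T /\
    forall v : 'rV[L]_N, (v <= T)%MS <->
      forall p, J p -> \sum_k v 0 k * ev (mderiv k p) x = 0.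

(* An integral variety has the same dimension at all of its points. *)
Definition smooth_of_dim_at (N : nat) (J : {mpoly K[N]} -> Prop) (D : nat)
    (x : 'rV[L]_N) : Prop :=
  [/\ zero_locus J x, variety_dim J D & tangent_dim J x D].

End Varieties.

Section BorderBasisScheme.
Variables (n mu nu : nat).
Variables (t : mu.-tuple 'X_{1..n}) (b : nu.-tuple 'X_{1..n}).

Definition mult_matrix (R : comNzRingType) (c : 'M[R]_(mu, nu)) (k : 'I_n) :
    'M[R]_mu :=
  \matrix_(i, m)
    if [pick j | tnth b j == (U_(k) + tnth t m)%MM] is Some j then c i j
    else (tnth t i == (U_(k) + tnth t m)%MM)%:R.

Definition generic_matrix (K : fieldType) : 'M[{mpoly K[mu * nu]}]_(mu, nu) :=
  \matrix_(i, j) 'X_(mxvec_index i j).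

Definition scheme_ideal (K : fieldType) : {mpoly K[mu * nu]} -> Prop :=
  ideal_gen (fun p => exists (k l : 'I_n) (i j : 'I_mu),
    p = (mult_matrix (generic_matrix K) k *m mult_matrix (generic_matrix K) l
       - mult_matrix (generic_matrix K) l *m mult_matrix (generic_matrix K) k) i j).

(* The ideal of the fiber of the universal family at the point x. *)
Definition fiber_ideal (F : fieldType) (x : 'rV[F]_(mu * nu)) :
    {mpoly F[n]} -> Prop :=
  family_ideal (fun j : 'I_nu =>
    terms F b j - \sum_i vec_mx x i j *: terms F t i).

Definition vanishing_ideal (F : fieldType) (m : nat) (X : 'I_m -> 'rV[F]_n) :
    {mpoly F[n]} -> Prop :=
  fun g => forall i, g.@[fun k => X i 0 k] = 0.

Definition reduced_point (F : fieldType) (x : 'rV[F]_(mu * nu)) : Prop :=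
  exists X : 'I_mu -> 'rV[F]_n,
    injective X /\ corresponds t b (vanishing_ideal X) x.

(* IC is the ideal in K[c_ij] of the principal component: a closed subscheme
   of the border basis scheme whose base change to Kbar is the reduced closure
   of the set of reduced points. *)
Definition is_principal_component (K Kbar : fieldType)
    (iota : {rmorphism K -> Kbar}) (IC : {mpoly K[mu * nu]} -> Prop) : Prop :=
  [/\ is_ideal IC, forall p, scheme_ideal p -> IC p
    & forall q : {mpoly Kbar[mu * nu]},
        extended_ideal iota IC q <->
        forall x : 'rV[Kbar]_(mu * nu), reduced_point x ->
          q.@[fun k => x 0 k] = 0].

End BorderBasisScheme.

(* The Kbar-points of the open subset of the border basis scheme over which
   the powers 1, l, ..., l^(mu - 1) form a basis of the fiber. *)
Definition basis_locus (K Kbar : fieldType) (iota : {rmorphism K -> Kbar})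
    (n mu nu : nat) (t : mu.-tuple 'X_{1..n.+1}) (b : nu.-tuple 'X_{1..n.+1})
    (ell : 'I_n.+1 -> K) (x : 'rV[Kbar]_(mu * nu)) : Prop :=
  zero_locus iota (@scheme_ideal _ _ _ t b K) x /\
  basis_mod (powers (mu := mu) (fun i => iota (ell i))) (fiber_ideal t b x).

(* Main.v *)
Require Import Defs.
From HB Require Import structures.
From mathcomp Require Import all_boot all_order all_algebra.
From mathcomp Require Import ring.
From Stdlib Require Import Classical.

Set Implicit Arguments.
Unset Strict Implicit.
Unset Printing Implicit Defensive.

Import GRing.Theory.
Local Open Scope ring_scope.

(** Write [mu] for the size of the order ideal and [D] for [(n + 1) * mu].  All
    ideals modulo which the powers of the linear form are a basis are given by
    their shape generators, whose coefficients are an arbitrary matrix [c] of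
    size [(n + 1) x mu].  In the basis of powers the indeterminates act by
    matrices that are polynomials in one companion matrix, so the coordinates of
    the terms of the order ideal and of its border form matrices [M] and [N] with
    entries polynomial in [c].  Where [M] is invertible, the order ideal is a
    basis as well and the coefficient matrix of the border basis is [M^-1 N]:
    this is the chart.  Conversely, at a point of the border basis scheme the
    coordinates of the powers of the linear form, with respect to the order
    ideal, form a matrix [Q]; where [Q] is invertible, the coordinates of the
    leading terms of the shape generators give [c] back.  Both directions are
    rational with denominators [\det M] and [\det Q], hence
    [chart_isomorphism].  The device behind these computations is a linear map
    with a known kernel, [basis_modP] and [congr_modP]: evaluation at commuting
    matrices followed by application to a cyclic vector ([cyc_ker]).

    The principal component is studied through its reduced points.  Linear
    relations descend from the algebraic closure, so [IC] consists of the
    polynomials over [K] that vanish at the reduced points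
    ([principal_vanish]).  These are parametrized by the configurations [X] of
    [mu] points for which the matrix of values of the order ideal is invertible
    ([reduced_pointP]).  Restricting to lines between two configurations reduces
    primality to the fact that a nonzero polynomial in one variable has a
    nonroot ([principal_mul]).  Moving the roots of the polynomial in the linear
    form apart, in the same way, shows that the chart lands in the component
    ([principal_chart]); as [IC] is prime, the chart is dense in it
    ([principal_dense]).

    The dimension is [D]: the numerators of the inverse of the chart are
    algebraically independent ([gen_num_independent]), and [D + 1] functions are
    dependent because there are too few monomials ([principal_dependent]).

    For smoothness the tangent space at a radical ideal [J] has to have dimension
    [D].  It is not smaller, since the rank of a matrix of gradients can only
    drop under specialisation and on the chart the tangent space contains [D]
    independent vectors ([gradients_bound]).  It is not larger: a tangent vector
    of the border basis scheme is a homomorphism from [J] to the quotient by [J],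
    and such a homomorphism is determined by its values on [n + 1] elements,
    because [J] is generated by [n + 1] elements modulo its square
    ([tangent_bound], [radical_generators]).  That last step works over every
    field, perfect or not: the quotient by [J] is a product of fields, and the
    quotient by a maximal ideal is a tower of [n + 1] simple extensions. *)

(** * Ideals, and bases modulo an ideal *)

Section IdealBasics.
Variable R : comNzRingType.
Implicit Types (J S : R -> Prop).

Lemma idealN J a : is_ideal J -> J a -> J (- a).
Proof. by case=> _ _ hM ha; rewrite -mulN1r; apply: hM. Qed.

Lemma idealB J a b : is_ideal J -> J a -> J b -> J (a - b).
Proof. by move=> hJ ha hb; have [_ hD _] := hJ; apply: hD => //; apply: idealN. Qed.

Lemma ideal_mulr J a b : is_ideal J -> J a -> J (a * b).
Proof. by case=> _ _ hM ha; rewrite mulrC; apply: hM. Qed.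

Lemma ideal_sum J (I : Type) (r : seq I) (P : pred I) (F : I -> R) :
  is_ideal J -> (forall i, P i -> J (F i)) -> J (\sum_(i <- r | P i) F i).
Proof. by case=> h0 hD _ hF; elim/big_ind: _. Qed.

Lemma ideal_gen_ideal S : is_ideal (ideal_gen S).
Proof.
split.
- exists 0, (fun=> 0), (fun=> 0); split; first by case.
  by rewrite big_ord0.
- move=> _ _ [m [a [s [hs ->]]]] [m' [a' [s' [hs' ->]]]].
  pose w (T : Type) (f : 'I_m -> T) (g : 'I_m' -> T) (i : 'I_(m + m')) :=
    match split i with inl j => f j | inr j => g j end.
  exists (m + m'), (w _ a a'), (w _ s s'); split.
    by move=> i; rewrite /w; case: (split i).
  rewrite big_split_ord /=; congr (_ + _); apply: eq_bigr => i _; rewrite /w.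
    by rewrite (unsplitK (inl i)).
  by rewrite (unsplitK (inr i)).
- move=> c _ [m [a [s [hs ->]]]]; exists m, (fun i => c * a i), s; split=> //.
  by rewrite mulr_sumr; apply: eq_bigr => i _; rewrite mulrA.
Qed.

Lemma ideal_gen_mem S a : S a -> ideal_gen S a.
Proof.
move=> ha; exists 1, (fun=> 1), (fun=> a); split=> //.
by rewrite big_ord1 mul1r.
Qed.

Lemma ideal_gen_sub S J : is_ideal J -> (forall a, S a -> J a) ->
  forall a, ideal_gen S a -> J a.
Proof.
move=> hJ hS _ [m [a [s [hs ->]]]]; apply: ideal_sum => // i _.
by have [_ _ hM] := hJ; apply: hM; apply: hS.
Qed.

Lemma family_ideal_mem (I : Type) (h : I -> R) i : family_ideal h (h i).
Proof. by apply: ideal_gen_mem; exists i. Qed.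

Lemma family_ideal_sub (I : Type) (h : I -> R) J : is_ideal J ->
  (forall i, J (h i)) -> forall a, family_ideal h a -> J a.
Proof. by move=> hJ hh; apply: ideal_gen_sub => // _ [i ->]. Qed.

Lemma family_ideal_lincomb (I : finType) (h : I -> R) g :
  family_ideal h g -> exists a : I -> R, g = \sum_i a i * h i.
Proof.
apply: (@ideal_gen_sub _ (fun g => exists a : I -> R, g = \sum_i a i * h i)).
  split.
  - by exists (fun=> 0); rewrite big1 // => i _; rewrite mul0r.
  - move=> _ _ [a ->] [b ->]; exists (fun i => a i + b i).
    by rewrite -big_split; apply: eq_bigr => i _; rewrite mulrDl.
  - move=> c _ [a ->]; exists (fun i => c * a i).
    by rewrite mulr_sumr; apply: eq_bigr => i _; rewrite mulrA.
move=> _ [i ->]; exists (fun j => (j == i)%:R).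
rewrite (bigD1 i) //= eqxx mul1r big1 ?addr0 // => j /negbTE->.
by rewrite mul0r.
Qed.

Lemma family_ideal_eq (I : Type) (h h' : I -> R) : h =1 h' ->
  forall g, family_ideal h g -> family_ideal h' g.
Proof.
move=> e; apply: family_ideal_sub; first exact: ideal_gen_ideal.
by move=> i; rewrite e; apply: family_ideal_mem.
Qed.

End IdealBasics.

Section BasesModulo.
Variables (F : fieldType) (n : nat).
Local Notation P := {mpoly F[n]}.
Implicit Types J : P -> Prop.

Lemma idealZ J c g : is_ideal J -> J g -> J (c *: g).
Proof. by case=> _ _ hM hg; rewrite -mul_mpolyC; apply: hM. Qed.

Lemma ideal_eq_of_basis m (v : 'I_m -> P) J J' : is_ideal J' ->
    (forall g, J g -> J' g) -> is_ideal J -> spans_mod v J ->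
    (forall a : 'I_m -> F, J' (\sum_i a i *: v i) -> forall i, a i = 0) ->
  forall g, J' g -> J g.
Proof.
move=> hJ' sub hJ sp ind g hg; have [a ha] := sp g.
have /ind a0 : J' (\sum_i a i *: v i).
  by rewrite -[X in J' X](subKr g); apply: idealB => //; apply: sub.
by move: ha; rewrite big1 ?subr0 // => i _; rewrite a0 scale0r.
Qed.

Lemma basis_mod_ext m (v v' : 'I_m -> P) J J' : v =1 v' ->
  (forall g, J g <-> J' g) -> basis_mod v J -> basis_mod v' J'.
Proof.
move=> ev eJ [ind sp]; split.
  move=> a ha; apply: ind; apply/eJ.
  by under eq_bigr do rewrite ev.
move=> g; have [a ha] := sp g; exists a; apply/eJ.
by under eq_bigr do rewrite -ev.
Qed.

Lemma congr_mod_ext m p (v v' : 'I_m -> P) (w : 'I_p -> P) A J J' : v =1 v' ->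
  (forall g, J g <-> J' g) -> congr_mod v w A J -> congr_mod v' w A J'.
Proof.
move=> ev eJ h j; apply/eJ; under eq_bigr do rewrite -ev; exact: h.
Qed.

Definition coords (T : nat) (rho : P -> 'cV[F]_T) m (v : 'I_m -> P) : 'M[F]_(T, m) :=
  \matrix_(i, j) rho (v j) i 0.

Lemma coords_comb (T : nat) (rho : {linear P -> 'cV[F]_T}) m (v : 'I_m -> P) (a : 'I_m -> F) :
  rho (\sum_i a i *: v i) = coords rho v *m \col_i a i.
Proof.
rewrite linear_sum; apply/matrixP => i j; rewrite summxE mxE ord1.
by apply: eq_bigr => k _; rewrite linearZ !mxE mulrC.
Qed.

Section Kernel.
Variables (T : nat) (rho : {linear P -> 'cV[F]_T}) (J : P -> Prop).
Hypothesis kerJ : forall g, J g <-> rho g = 0.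

(** Independence modulo the kernel is independence of the images, and [T]
    independent columns of height [T] also span.  This turns questions modulo an
    ideal into matrix identities. *)
Lemma basis_modP (v : 'I_T -> P) : basis_mod v J <-> coords rho v \in unitmx.
Proof.
split=> [[ind _]|hU].
  rewrite -unitmx_tr -row_free_unit; apply: inj_row_free => u hu.
  have h0 : coords rho v *m u^T = 0 by apply: trmx_inj; rewrite trmx_mul trmxK trmx0.
  apply/rowP => i; rewrite mxE; apply: (ind (fun i => u 0 i)); apply/kerJ.
  rewrite coords_comb -[RHS]h0; congr (_ *m _).
  by apply/matrixP => x y; rewrite !mxE ord1.
split=> [a /kerJ|g].
  rewrite coords_comb => h0 i.
  have := congr1 (mulmx (invmx (coords rho v))) h0.
  by rewrite mulKmx // mulmx0 => /matrixP/(_ i 0); rewrite !mxE.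
exists (fun i => (invmx (coords rho v) *m rho g) i 0); apply/kerJ.
rewrite linearB /= coords_comb.
suff -> : \col_i (invmx (coords rho v) *m rho g) i 0 = invmx (coords rho v) *m rho g.
  by rewrite mulKVmx // subrr.
by apply/matrixP => i j; rewrite mxE ord1.
Qed.

Lemma congr_modP m p (v : 'I_m -> P) (w : 'I_p -> P) A :
  congr_mod v w A J <-> coords rho v *m A = coords rho w.
Proof.
have col_eq j : (rho (w j - \sum_i A i j *: v i) = 0) <->
    (forall i, (coords rho v *m A) i j = coords rho w i j).
  rewrite linearB /= coords_comb; split=> [/eqP|h].
    rewrite subr_eq0 => /eqP h i; rewrite [RHS]mxE h !mxE.
    by apply: eq_bigr => k _; rewrite !mxE.
  apply/eqP; rewrite subr_eq0; apply/eqP/matrixP => i z; rewrite ord1.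
  have := h i; rewrite [X in _ = X -> _]mxE => <-; rewrite !mxE.
  by apply: eq_bigr => k _; rewrite !mxE.
split=> [h|h].
  by apply/matrixP => i j; have /kerJ/col_eq -> := h j.
by move=> j; apply/kerJ/col_eq => i; rewrite h.
Qed.

End Kernel.
End BasesModulo.

(** * Evaluation of polynomials *)

Section Evaluation.
Variables (K : nzRingType) (N : nat).

Lemma mmap_morph (R S : nzRingType) (tau : K -> R) (sg : {rmorphism R -> S})
    (y : 'I_N -> R) (p : {mpoly K[N]}) :
  sg (mmap tau y p) = mmap (fun z => sg (tau z)) (fun i => sg (y i)) p.
Proof.
rewrite /mmap rmorph_sum; apply: eq_bigr => m _; rewrite rmorphM /mmap1 rmorph_prod.
by congr (_ * _); apply: eq_bigr => i _; rewrite rmorphXn.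
Qed.

Lemma eq_mmap (R : nzRingType) (tau tau' : K -> R) (y y' : 'I_N -> R)
    (p : {mpoly K[N]}) : tau =1 tau' -> y =1 y' -> mmap tau y p = mmap tau' y' p.
Proof.
move=> et ey; apply: eq_bigr => m _; rewrite et; congr (_ * _).
by apply: eq_bigr => i _; rewrite ey.
Qed.

(** This is [delta ^ k * p (Y / delta)], written without the division: for [k]
    at least the degree of [p] the formula makes sense in every ring. *)
Definition homogenize (R : nzRingType) (k : nat) (tau : K -> R) (delta : R)
    (Y : 'I_N -> R) (p : {mpoly K[N]}) : R :=
  \sum_(m <- msupp p) tau p@_m * delta ^+ (k - mdeg m) * mmap1 Y m.

Lemma homogenize_morph (R S : nzRingType) k (tau : K -> R) (sg : {rmorphism R -> S})
    delta (Y : 'I_N -> R) (p : {mpoly K[N]}) :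
  sg (homogenize k tau delta Y p) =
  homogenize k (fun z => sg (tau z)) (sg delta) (fun i => sg (Y i)) p.
Proof.
rewrite rmorph_sum; apply: eq_bigr => m _; rewrite !rmorphM rmorphXn rmorph_prod.
by congr (_ * _); apply: eq_bigr => i _; rewrite rmorphXn.
Qed.

Lemma eq_homogenize (R : nzRingType) k (tau tau' : K -> R) delta delta' (y y' : 'I_N -> R)
    (p : {mpoly K[N]}) : tau =1 tau' -> delta = delta' -> y =1 y' ->
  homogenize k tau delta y p = homogenize k tau' delta' y' p.
Proof.
move=> et <- ey; apply: eq_bigr => m _; rewrite et; congr (_ * _).
by apply: eq_bigr => i _; rewrite ey.
Qed.

Lemma homogenizeE (R : comNzRingType) k (tau : K -> R) delta (Y y : 'I_N -> R)
    (p : {mpoly K[N]}) : (msize p <= k.+1)%N -> (forall i, Y i = delta * y i) ->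
  homogenize k tau delta Y p = delta ^+ k * mmap tau y p.
Proof.
move=> hk hY; rewrite /homogenize /mmap mulr_sumr !big_seq; apply: eq_bigr => m hm.
have hd : (mdeg m <= k)%N by rewrite -ltnS (leq_trans _ hk) ?msize_mdeg_lt.
rewrite /mmap1; under eq_bigr do rewrite hY exprMn.
rewrite big_split /= prodrXr.
have -> : (\sum_(i < N) m i)%N = mdeg m by rewrite mdegE.
by rewrite -[X in delta ^+ X * _](subnK hd) exprD; ring.
Qed.

End Evaluation.

Section EvPoint.
Variables (K L : fieldType) (iota : {rmorphism K -> L}) (N : nat).
Implicit Types (x : 'rV[L]_N) (p q : {mpoly K[N]}).

Lemma evE p x : ev iota p x = mmap iota (fun k => x 0 k) p.
Proof.
rewrite /ev; elim/mpolyind: p => [|c m p _ _ IH].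
  by rewrite !raddf0.
rewrite !raddfD /= IH; congr (_ + _).
by rewrite map_mpolyZ map_mpolyX mevalZ mevalX mmapZ mmapX.
Qed.

(** The evaluation [ev], in a form that is recognised as a ring morphism. *)
Definition evm x (p : {mpoly K[N]}) : L := mmap iota (fun k => x 0 k) p.
HB.instance Definition _ x := GRing.RMorphism.copy (evm x) (mmap iota (fun k => x 0 k)).

Lemma evmE p x : ev iota p x = evm x p. Proof. exact: evE. Qed.

End EvPoint.

(** * Polynomials that vanish at many points *)

Section ClosedFieldPoints.
Variable L : closedFieldType.

Lemma poly_eq0_generic (p q : {poly L}) : q != 0 ->
  (forall s, q.[s] != 0 -> p.[s] = 0) -> p = 0.
Proof.
move=> q0 h; apply/eqP; apply: contraT => p0.
have /closed_nonrootP[s] : p * q != 0 by rewrite mulf_neq0.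
rewrite rootE hornerM mulf_eq0 negb_or => /andP[/eqP hp /h].
by move=> /hp.
Qed.

Lemma distinct_elements k : exists r : 'I_k -> L, injective r.
Proof.
suff [s us ss] : exists2 s : seq L, uniq s & size s = k.
  exists (fun i => s`_i) => i j /eqP.
  by rewrite nth_uniq ?ss // => /eqP/val_inj.
elim: k => [|k [s us ss]]; first by exists [::].
have /closed_nonrootP[z] : \prod_(a <- s) ('X - a%:P) != 0 :> {poly L}.
  by rewrite monic_neq0 // monic_prod_XsubC.
by rewrite root_prod_XsubC => hz; exists (z :: s); rewrite /= ?hz ?us ?ss.
Qed.

End ClosedFieldPoints.

Lemma kronecker_inj (B n : nat) (m m' : 'I_n -> nat) :
    (forall i, (m i < B)%N) -> (forall i, (m' i < B)%N) ->
  (\sum_(i < n) m i * B ^ i)%N = (\sum_(i < n) m' i * B ^ i)%N -> m =1 m'.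
Proof.
elim: n m m' => [|n IH] m m' hm hm'; first by move=> _ [].
have B0 : (0 < B)%N by apply: leq_ltn_trans (hm ord0).
rewrite !big_ord_recl !expn0 !muln1.
have E (f : 'I_n.+1 -> nat) : (\sum_(i < n) f (lift ord0 i) * B ^ lift ord0 i)%N =
    ((\sum_(i < n) f (lift ord0 i) * B ^ i) * B)%N.
  by rewrite big_distrl; apply: eq_bigr => i _; rewrite lift0 expnS mulnCA mulnC.
rewrite !E => e.
have e0 : m ord0 = m' ord0.
  by have := congr1 (modn^~ B) e; rewrite /= addnC modnMDl addnC modnMDl !modn_small.
move: e; rewrite e0 => /addnI/eqP; rewrite eqn_pmul2r // => /eqP e1 i.
case: (unliftP ord0 i) => [j|] -> //.
exact: (IH (fun j => m (lift ord0 j)) (fun j => m' (lift ord0 j))).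
Qed.

(** Substituting [X ^ (B ^ i)] for the i-th indeterminate keeps distinct
    monomials distinct, so one nonroot in one indeterminate is enough. *)
Lemma mpoly_eq0_of_ev (K : fieldType) (L : closedFieldType)
    (iota : {rmorphism K -> L}) n (p : {mpoly K[n]}) :
  (forall x : 'rV[L]_n, evm iota x p = 0) -> p = 0.
Proof.
move=> h; pose B := msize p.
pose y (i : 'I_n) : {poly L} := 'X^(B ^ i).
pose kr (m : 'X_{1..n}) := (\sum_(i < n) m i * B ^ i)%N.
pose P := mmap (fun z => (iota z)%:P) y p.
have P0 : P = 0.
  apply: (@poly_eq0_generic _ _ 1); first exact: oner_neq0.
  move=> s _; have <- := h (\row_i s ^+ (B ^ i)).
  rewrite -[LHS]/(horner_eval s P) mmap_morph.
  by apply: eq_mmap => z; rewrite /= horner_evalE ?hornerC // hornerXn mxE.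
apply/mpolyP => m; rewrite mcoeff0; apply/eqP; apply: contraT => hm.
have := congr1 (fun q : {poly L} => q`_(kr m)) P0; rewrite coef0 coef_sum.
have hX m' : mmap1 y m' = 'X^(kr m').
  rewrite /mmap1 /kr -prodrXr; apply: eq_bigr => i _.
  by rewrite /y -exprM mulnC.
rewrite (bigD1_seq m) ?msupp_uniq ?mcoeff_msupp //= hX coefCM coefXn eqxx mulr1.
rewrite big_seq_cond big1 ?addr0 => [/eqP|m' /andP[hm' ne]].
  by rewrite fmorph_eq0 (negPf hm).
rewrite hX coefCM coefXn; case: eqP; rewrite ?mulr0 // => /kronecker_inj e.
case/eqP: ne; apply/mnmP => i; rewrite e // => j.
  by rewrite (leq_ltn_trans _ (msize_mdeg_lt (_ : m \in _))) ?mcoeff_msupp //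
     mdegE (bigD1 j) // leq_addr.
by rewrite (leq_ltn_trans _ (msize_mdeg_lt hm')) // mdegE (bigD1 j) // leq_addr.
Qed.

(** * Dual numbers *)

Lemma mpoly_ring_ind (K : nzRingType) n (P : {mpoly K[n]} -> Prop) :
    (forall c, P c%:MP) -> (forall i, P 'X_i) ->
    (forall p q, P p -> P q -> P (p + q)) ->
    (forall p q, P p -> P q -> P (p * q)) ->
  forall p, P p.
Proof.
move=> hC hX hD hM; have h0 : P 0 by rewrite -(mpolyC0 n); apply: hC.
have h1 : P 1 by apply: hC.
apply: mpolyind => // c m p _ _ IH; apply: hD => //.
rewrite -mul_mpolyC; apply: (hM) => //; rewrite mpolyXE_id.
apply: (big_ind P); [exact: h1|exact: hM|move=> i _].
elim: (m i) => [|k IHk]; first by rewrite expr0.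
by rewrite exprS; apply: hM.
Qed.

Section Dual.
Variable R : comNzRingType.

(** The pair [(a, b)] stands for [a + b epsilon] with [epsilon ^ 2 = 0]. *)
Definition dual : Type := (R * R)%type.
HB.instance Definition _ := GRing.Zmodule.copy dual (R * R)%type.

Implicit Types a b c : dual.
Definition dual_one : dual := (1, 0).
Definition dual_mul a b : dual := (a.1 * b.1, a.1 * b.2 + a.2 * b.1).

Fact dual_mulA : associative dual_mul.
Proof. by move=> a b c; rewrite /dual_mul /=; congr (_, _); ring. Qed.
Fact dual_mulC : commutative dual_mul.
Proof. by move=> a b; rewrite /dual_mul /=; congr (_, _); ring. Qed.
Fact dual_mul1 : left_id dual_one dual_mul.
Proof. by case=> a b; rewrite /dual_mul /=; congr (_, _); ring. Qed.
Fact dual_mulDl : left_distributive dual_mul +%R.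
Proof. by move=> a b c; rewrite /dual_mul /=; congr (_, _) => /=; ring. Qed.
Fact dual_oner_neq0 : dual_one != 0.
Proof. by apply/eqP => -[/eqP]; rewrite oner_eq0. Qed.

HB.instance Definition _ := GRing.Zmodule_isComNzRing.Build dual
  dual_mulA dual_mulC dual_mul1 dual_mulDl dual_oner_neq0.

Definition dfst (a : dual) : R := a.1.
Definition dsnd (a : dual) : R := a.2.
Definition dinj (a : R) : dual := (a, 0).
Definition deps : dual := (0, 1).

Fact dfst_is_additive : zmod_morphism dfst. Proof. by []. Qed.
Fact dfst_is_mult : monoid_morphism dfst. Proof. by []. Qed.
HB.instance Definition _ := GRing.isZmodMorphism.Build dual R dfst dfst_is_additive.
HB.instance Definition _ := GRing.isMonoidMorphism.Build dual R dfst dfst_is_mult.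
Fact dsnd_is_additive : zmod_morphism dsnd. Proof. by []. Qed.
HB.instance Definition _ := GRing.isZmodMorphism.Build dual R dsnd dsnd_is_additive.
Fact dinj_is_additive : zmod_morphism dinj.
Proof. by move=> a b; rewrite -[RHS]/((a - b, 0 - 0) : dual) subr0. Qed.
Fact dinj_is_mult : monoid_morphism dinj.
Proof.
by split=> // a b; rewrite -[RHS]/((a * b, a * 0 + 0 * b) : dual) mulr0 mul0r addr0.
Qed.
HB.instance Definition _ := GRing.isZmodMorphism.Build R dual dinj dinj_is_additive.
HB.instance Definition _ := GRing.isMonoidMorphism.Build R dual dinj dinj_is_mult.

Lemma dfst_dinj (a : R) : dfst (dinj a) = a. Proof. by []. Qed.
Lemma dsnd_dinj (a : R) : dsnd (dinj a) = 0. Proof. by []. Qed.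

Lemma dsndM (a b : dual) : dsnd (a * b) = dfst a * dsnd b + dsnd a * dfst b.
Proof. by []. Qed.

Lemma dual_eqP (a b : dual) : dfst a = dfst b -> dsnd a = dsnd b -> a = b.
Proof. by case: a b => a1 a2 [b1 b2] /= -> ->. Qed.

End Dual.
Arguments dfst : simpl never.
Arguments dsnd : simpl never.
Arguments dinj : simpl never.

Section Taylor.
Variables (K : comNzRingType) (L : comNzRingType) (iota : {rmorphism K -> L}) (N : nat).

(** Taylor expansion to first order: both sides are derivations of the
    polynomial ring, and they agree on the indeterminates. *)
Lemma dual_taylor (p : {mpoly K[N]}) (y : 'I_N -> dual L) :
  dsnd (mmap (fun z => dinj (iota z)) y p) =
  \sum_k dsnd (y k) * mmap iota (fun i => dfst (y i)) (mderiv k p).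
Proof.
pose tau : {rmorphism K -> dual L} := (@dinj L) \o iota.
rewrite -[mmap _]/(mmap tau).
have hfst q : dfst (mmap tau y q) = mmap iota (fun i => dfst (y i)) q.
  by rewrite mmap_morph.
elim/mpoly_ring_ind: p => [c|i|p q IHp IHq|p q IHp IHq].
- by rewrite mmapC big1 // => k _; rewrite mderivC mmap0 mulr0.
- rewrite mmapX mmap1U (bigD1 i) //= big1 ?addr0 => [|k ki].
    have -> : 'X_i^`M(i) = 1 :> {mpoly K[N]}.
      rewrite mderivX mnm1E eqxx scale1r -[X in (X - _)%MM]add0m addmK.
      exact: mpolyX0.
    by rewrite rmorph1 mulr1.
  by rewrite mderivX mnmE eq_sym (negPf ki) scale0r mmap0 mulr0.
- rewrite !raddfD /= IHp IHq -big_split /=; apply: eq_bigr => k _.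
  by rewrite mderivD raddfD /= mulrDr.
- rewrite rmorphM dsndM IHp IHq !hfst mulr_sumr mulr_suml -big_split /=.
  apply: eq_bigr => k _; rewrite mderivM raddfD /= !rmorphM /=; ring.
Qed.

End Taylor.

(** * Evaluation at commuting matrices *)

Section MatrixEvaluation.
Variables (K R : comNzRingType) (tau : {rmorphism K -> R}) (N m0 : nat).
Local Notation mu := m0.+1.
Variable A : 'I_N -> 'M[R]_mu.
Hypothesis commA : forall k l, A k *m A l = A l *m A k.

Lemma mmap1_commD (m m' : 'X_{1..N}) : mmap1 A (m + m') = mmap1 A m * mmap1 A m'.
Proof.
rewrite /mmap1; elim: (index_enum _) => [|i r IH]; first by rewrite !big_nil mulr1.
rewrite !big_cons IH mnmDE exprD -!mulrA; congr (_ * _); rewrite !mulrA; congr (_ * _).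
apply: commr_prod => j _; apply: commrX; apply: commr_sym; apply: commrX.
exact: commA.
Qed.

Definition mxev (p : {mpoly K[N]}) : 'M[R]_mu := mmap (fun z => (tau z)%:M) A p.

Lemma mxevD p q : mxev (p + q) = mxev p + mxev q.
Proof. exact: (raddfD (mmap ((@scalar_mx R mu) \o tau) A)). Qed.

Lemma mxevX m : mxev 'X_[m] = mmap1 A m.
Proof. exact: (mmapX A ((@scalar_mx R mu) \o tau)). Qed.

Lemma mxevZ c p : mxev (c *: p) = tau c *: mxev p.
Proof.
by rewrite /mxev (mmapZ A ((@scalar_mx R mu) \o tau)) -[RHS]mul_scalar_mx.
Qed.

Lemma mxevXU k : mxev 'X_k = A k.
Proof. by rewrite mxevX mmap1U. Qed.

Lemma mxevXM k p : mxev ('X_k * p) = A k *m mxev p.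
Proof.
elim/mpolyind: p => [|c m p _ _ IH].
  by rewrite mulr0 /mxev !(raddf0 (mmap ((@scalar_mx R mu) \o tau) A)) mulmx0.
rewrite mulrDr !mxevD IH mulmxDr -scalerAr !mxevZ -mpolyXD !mxevX mmap1_commD mmap1U.
by rewrite -scalemxAr.
Qed.

Lemma mxevM p q : mxev (p * q) = mxev p *m mxev q.
Proof.
elim/mpoly_ring_ind: p q => [c|i|p p' IH IH'|p p' IH IH'] q.
- rewrite mul_mpolyC mxevZ -mul_scalar_mx; congr (_ *m _).
  by rewrite /mxev (mmapC A ((@scalar_mx R mu) \o tau)).
- by rewrite mxevXM mxevXU.
- by rewrite mulrDl !mxevD IH IH' mulmxDl.
- by rewrite -mulrA !IH IH' mulmxA.
Qed.

Lemma mxev1 : mxev 1 = 1%:M.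
Proof. by rewrite -mpolyX0 mxevX mmap11. Qed.

Lemma mxevXn p j : mxev (p ^+ j) = mxev p ^+ j.
Proof. by elim: j => [|j IH]; rewrite ?expr0 ?mxev1 // !exprS mxevM IH. Qed.

Lemma mxev_sum (I : Type) (r : seq I) (P : pred I) (F : I -> {mpoly K[N]}) :
  mxev (\sum_(i <- r | P i) F i) = \sum_(i <- r | P i) mxev (F i).
Proof. exact: (raddf_sum (mmap ((@scalar_mx R mu) \o tau) A)). Qed.

End MatrixEvaluation.

Section Cyclic.
Variables (F : fieldType) (N m0 : nat).
Local Notation mu := m0.+1.
Local Notation P := {mpoly F[N]}.
Variables (A : 'I_N -> 'M[F]_mu) (e : 'cV[F]_mu).

Definition cyc (p : P) : 'cV[F]_mu := mxev (idfun : {rmorphism F -> F}) A p *m e.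

Fact cyc_is_linear : linear cyc.
Proof. by move=> c p q; rewrite /cyc mxevD mxevZ mulmxDl scalemxAl. Qed.
HB.instance Definition _ := GRing.isLinear.Build F P 'cV[F]_mu *:%R cyc cyc_is_linear.

Hypothesis commA : forall k l, A k *m A l = A l *m A k.

Lemma cycM p q : cyc (p * q) = mxev (idfun : {rmorphism F -> F}) A p *m cyc q.
Proof. by rewrite /cyc mxevM // mulmxA. Qed.

Lemma cyc_ker_ideal : is_ideal (fun p => cyc p = 0).
Proof.
split; first exact: raddf0.
- by move=> p q hp hq; rewrite raddfD /= hp hq addr0.
- by move=> p q hq; rewrite cycM hq mulmx0.
Qed.

(** The annihilator of the cyclic vector contains the ideal, and it cannot be
    larger: a family that spans modulo the ideal has independent images. *)
Lemma cyc_ker (I : Type) (h : I -> P) (v : 'I_mu -> P) :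
    (forall i, cyc (h i) = 0) -> spans_mod v (family_ideal h) ->
    coords cyc v \in unitmx ->
  forall g, family_ideal h g <-> cyc g = 0.
Proof.
move=> hh sp /(@basis_modP _ _ _ _ (fun g => cyc g = 0) _)[//|ind _] g.
have sub := family_ideal_sub cyc_ker_ideal hh; split; first exact: sub.
apply: (ideal_eq_of_basis (J' := fun g => cyc g = 0)) sp ind _ => //.
- exact: cyc_ker_ideal.
- exact: ideal_gen_ideal.
Qed.

End Cyclic.

(** * Families spanning a quotient *)

Section Spanning.
Variables (F : fieldType) (N m : nat).
Local Notation P := {mpoly F[N]}.
Variables (v : 'I_m -> P) (J : P -> Prop).
Hypothesis idJ : is_ideal J.

Definition in_span (g : P) : Prop := exists a : 'I_m -> F, J (g - \sum_i a i *: v i).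
Definition span_stable (g : P) : Prop := forall s, in_span s -> in_span (g * s).

Lemma in_span_mem i : in_span (v i).
Proof.
exists (fun j => (j == i)%:R); rewrite (bigD1 i) //= eqxx scale1r big1 ?addr0.
  by rewrite subrr; case: idJ.
by move=> j /negbTE->; rewrite scale0r.
Qed.

Lemma in_spanD g h : in_span g -> in_span h -> in_span (g + h).
Proof.
move=> [a ha] [b hb]; exists (fun i => a i + b i).
under eq_bigr do rewrite scalerDl.
by rewrite big_split opprD addrACA; have [_ hD _] := idJ; apply: hD.
Qed.

Lemma in_spanZ c g : in_span g -> in_span (c *: g).
Proof.
move=> [a ha]; exists (fun i => c * a i).
under eq_bigr do rewrite -scalerA.
by rewrite -scaler_sumr -scalerBr; apply: idealZ.
Qed.

Lemma in_span_eq g h : J (g - h) -> in_span h -> in_span g.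
Proof.
move=> hgh [a ha]; exists a; rewrite -(subrK h g) -addrA.
by have [_ hD _] := idJ; apply: hD.
Qed.

Lemma in_span_sum (I : Type) (r : seq I) (Q : pred I) (G : I -> P) :
  (forall i, Q i -> in_span (G i)) -> in_span (\sum_(i <- r | Q i) G i).
Proof.
move=> h; elim/big_ind: _ => //; last exact: in_spanD.
exists (fun=> 0); rewrite big1 ?subr0 //; first by case: idJ.
by move=> i _; rewrite scale0r.
Qed.

Lemma span_stable_gen g : (forall i, in_span (g * v i)) -> span_stable g.
Proof.
move=> h s [a ha].
apply: (@in_span_eq _ (g * \sum_i a i *: v i)).
  by rewrite -mulrBr; have [_ _ hM] := idJ; apply: hM.
rewrite mulr_sumr; apply: in_span_sum => i _; rewrite -scalerAr.
exact: in_spanZ.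
Qed.

Lemma span_stableC c : span_stable c%:MP.
Proof. by move=> s hs; rewrite mul_mpolyC; apply: in_spanZ. Qed.

Lemma span_stableD g h : span_stable g -> span_stable h -> span_stable (g + h).
Proof. by move=> hg hh s hs; rewrite mulrDl; apply: in_spanD; [apply: hg|apply: hh]. Qed.

Lemma span_stableM g h : span_stable g -> span_stable h -> span_stable (g * h).
Proof. by move=> hg hh s hs; rewrite -mulrA; apply/hg/hh. Qed.

Lemma span_stableZ c g : span_stable g -> span_stable (c *: g).
Proof. by move=> hg; rewrite -mul_mpolyC; apply: span_stableM => //; apply: span_stableC. Qed.

Lemma span_stable_sum (I : Type) (r : seq I) (Q : pred I) (G : I -> P) :
  (forall i, Q i -> span_stable (G i)) -> span_stable (\sum_(i <- r | Q i) G i).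
Proof.
move=> h; elim/big_ind: _ => //; last exact: span_stableD.
by rewrite -(mpolyC0 N); apply: span_stableC.
Qed.

Lemma span_stableX g j : span_stable g -> span_stable (g ^+ j).
Proof.
move=> hg; elim: j => [|j IH]; first exact: span_stableC.
by rewrite exprS; apply: span_stableM.
Qed.

Lemma span_stable_eq g h : J (g - h) -> span_stable h -> span_stable g.
Proof.
move=> hgh hh s hs; apply: (@in_span_eq _ (h * s)); last exact: hh.
by rewrite -mulrBl; apply: ideal_mulr.
Qed.

(** The polynomials that stabilise a subspace form a subalgebra, so it is enough
    to test the indeterminates. *)
Lemma spans_of_stable :
  in_span 1 -> (forall k, span_stable 'X_k) -> spans_mod v J.
Proof.
move=> h1 hX g; rewrite -[g]mulr1.
suff : span_stable g by apply.
elim/mpoly_ring_ind: g; [exact: span_stableC|exact: hX|exact: span_stableD|].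
exact: span_stableM.
Qed.

End Spanning.

(** * Generators of radical ideals modulo the square *)

Lemma ex_least (Q : nat -> Prop) : (exists d, Q d) ->
  exists d, Q d /\ forall d', Q d' -> (d <= d')%N.
Proof.
move=> [d hd]; have [k] := ubnP d; elim: k d hd => // k IH d hd hk.
have [[d' [hd' lt]]|h] := classic (exists d', Q d' /\ (d' < d)%N).
  by apply: (IH d') => //; apply: leq_trans lt _.
exists d; split=> // d' hd'; rewrite leqNgt; apply/negP => lt.
by apply: h; exists d'.
Qed.

Section RadicalGenerators.
Variables (F : fieldType) (N : nat).
Local Notation P := {mpoly F[N]}.
Implicit Types J : P -> Prop.

Definition prod_ideal J : P -> Prop :=
  ideal_gen (fun x => exists a b, [/\ J a, J b & x = a * b]).

Lemma linear_relation J m (v : 'I_m -> P) : is_ideal J -> spans_mod v J ->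
  forall w : 'I_m.+1 -> P, exists u : 'rV[F]_m.+1, u != 0 /\ J (\sum_i u 0 i *: w i).
Proof.
move=> idJ sp w; have /fin_all_exists[a ha] i := sp (w i).
pose A := \matrix_(i, j) a i j.
have /rowV0Pn[u hu u0] : kermx A != 0.
  by rewrite -mxrank_eq0 mxrank_ker -lt0n subn_gt0 ltnS rank_leq_col.
exists u; split=> //; have uA : u *m A = 0 by apply/sub_kermxP.
rewrite -[X in J X](subrK (\sum_i u 0 i *: \sum_j a i j *: v j)) -sumrB.
under eq_bigr do rewrite -scalerBr.
have -> : \sum_i u 0 i *: (\sum_j a i j *: v j) = 0.
  under eq_bigr do rewrite scaler_sumr.
  rewrite exchange_big /= big1 // => j _; under eq_bigr do rewrite scalerA.
  rewrite -scaler_suml (_ : \sum_i _ = (u *m A) 0 j); first by rewrite uA mxE scale0r.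
  by rewrite mxE; apply: eq_bigr => i _; rewrite mxE.
by rewrite addr0; apply: ideal_sum => // i _; apply: idealZ.
Qed.

Lemma algebraic_mod J m (v : 'I_m -> P) : is_ideal J -> spans_mod v J ->
  forall a : P, exists q : {poly F}, q != 0 /\ J (horner_alg a q).
Proof.
move=> idJ sp a; have [u [u0 hu]] := linear_relation idJ sp (fun i => a ^+ i).
exists (rVpoly u); split; first by rewrite raddf_eq0 //; apply: can_inj rVpolyK.
suff -> : horner_alg a (rVpoly u) = \sum_i u 0 i *: a ^+ i by [].
rewrite [rVpoly u]poly_def rmorph_sum; apply: eq_bigr => i _; rewrite /= linearZ /=.
rewrite rmorphXn /= horner_algX; case: insubP => [j _ e|]; last by rewrite ltn_ord.
by rewrite -scalerAl mul1r; congr (u 0 _ *: _); apply: val_inj.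
Qed.

(** Modulo a radical ideal of finite codimension every element divides its own
    square: descending powers of an element must stop. *)
Lemma regular_mod J m (v : 'I_m -> P) : is_ideal J -> radical J -> spans_mod v J ->
  forall a : P, exists q : {poly F}, J (a * (1 - a * horner_alg a q)).
Proof.
move=> idJ rJ sp a; have [q0 [nz hq0]] := algebraic_mod idJ sp a.
have [k [q1 nr e]] := multiplicity_XsubC q0 0; move: nr e; rewrite nz /= subr0 => nr e.
have q10 : q1`_0 != 0 by move: nr; rewrite rootE horner_coef0.
pose q2 := drop_poly 1 q1.
have eq1 : q1 = q2 * 'X + (q1`_0)%:P.
  rewrite -{1}[q1](poly_take_drop 1) addrC /q2 expr1; congr (_ + _).
  by apply/polyP => i; rewrite coef_take_poly coefC; case: i.
exists (- (q1`_0)^-1 *: q2).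
have E : 1 - a * horner_alg a (- (q1`_0)^-1 *: q2) = (q1`_0)^-1 *: horner_alg a q1.
  have -> : horner_alg a q1 = horner_alg a q2 * a + (q1`_0)%:A.
    by rewrite [in LHS]eq1 raddfD /= rmorphM /= horner_algX horner_algC.
  by rewrite linearZ /= -scalerAl mul1r scalerDr scalerA mulVf // scale1r scaleNr mulrN opprK
    addrC -scalerAr [a * _]mulrC.
rewrite E; apply: (rJ _ k.+1); rewrite exprMn exprS [_ ^+ k.+1]exprS.
have hk : J (a ^+ k * horner_alg a q1).
  by move: hq0; rewrite e rmorphM rmorphXn /= horner_algX mulrC.
have [_ _ hM] := idJ.
have -> : a * a ^+ k * ((q1`_0)^-1 *: horner_alg a q1 * ((q1`_0)^-1 *: horner_alg a q1) ^+ k) =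
   (a * (q1`_0)^-1%:MP * ((q1`_0)^-1 *: horner_alg a q1) ^+ k) * (a ^+ k * horner_alg a q1).
  rewrite -!mul_mpolyC; ring.
exact: hM.
Qed.

(** The subalgebra generated by some indeterminates, presented as a tower so that
    its elements are polynomials in the first of them over the rest. *)
Fixpoint adjoin (s : seq 'I_N) : P -> Prop :=
  if s is i :: s' then fun g => exists v : {poly P}, (forall j, adjoin s' v`_j) /\ g = v.['X_i]
  else fun g => exists c, g = c%:MP.

Lemma adjoin_facts s :
  [/\ forall c, adjoin s c%:MP, forall g h, adjoin s g -> adjoin s h -> adjoin s (g + h)
    & forall g h, adjoin s g -> adjoin s h -> adjoin s (g * h)].
Proof.
elim: s => [|i s [hC hD hM]] /=.
  split; first by move=> c; exists c.
    by move=> _ _ [c ->] [c' ->]; exists (c + c'); rewrite mpolyCD.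
  by move=> _ _ [c ->] [c' ->]; exists (c * c'); rewrite mpolyCM.
have h0 : adjoin s 0 by rewrite -(mpolyC0 N).
split.
- move=> c; exists (c%:MP)%:P; rewrite hornerC; split=> // j; rewrite coefC.
  by case: eqP.
- move=> _ _ [u [hu ->]] [v [hv ->]]; exists (u + v); rewrite hornerD; split=> // j.
  by rewrite coefD; apply: hD.
- move=> _ _ [u [hu ->]] [v [hv ->]]; exists (u * v); rewrite hornerM; split=> // j.
  by rewrite coefM; elim/big_ind: _ => // k _; apply: hM.
Qed.

Lemma adjoinC s c : adjoin s c%:MP. Proof. by case: (adjoin_facts s). Qed.
Lemma adjoinD s g h : adjoin s g -> adjoin s h -> adjoin s (g + h).
Proof. by case: (adjoin_facts s) => _ hD _; apply: hD. Qed.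
Lemma adjoinM s g h : adjoin s g -> adjoin s h -> adjoin s (g * h).
Proof. by case: (adjoin_facts s) => _ _; apply. Qed.
Lemma adjoin0 s : adjoin s 0. Proof. by rewrite -(mpolyC0 N); apply: adjoinC. Qed.
Lemma adjoin1 s : adjoin s 1. Proof. exact: adjoinC. Qed.
Lemma adjoinN s g : adjoin s g -> adjoin s (- g).
Proof. by move=> hg; rewrite -mulN1r -mpolyC1 -mpolyCN; apply: adjoinM => //; apply: adjoinC. Qed.

Lemma adjoin_horner_alg s a q : adjoin s a -> adjoin s (horner_alg a q).
Proof.
move=> ha; elim/poly_ind: q => [|q c IH]; first by rewrite raddf0; apply: adjoin0.
rewrite rmorphD rmorphM /= horner_algX horner_algC; apply: adjoinD; first exact: adjoinM.
by rewrite -mul_mpolyC mulr1; apply: adjoinC.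
Qed.

Lemma adjoin_var (s : seq 'I_N) i : i \in s -> adjoin s 'X_i.
Proof.
elim: s => //= j s IH; rewrite inE => /predU1P[->|/IH hi].
  exists 'X; rewrite hornerX; split=> // k; rewrite coefX.
  by case: (k == 1); [apply: adjoin1|apply: adjoin0].
exists ('X_i)%:P; rewrite hornerC; split=> // k; rewrite coefC.
by case: (k == 0) => //; apply: adjoin0.
Qed.

Lemma adjoin_all g : adjoin (enum 'I_N) g.
Proof.
elim/mpoly_ring_ind: g; [exact: adjoinC| |exact: adjoinD|exact: adjoinM].
by move=> i; apply: adjoin_var; rewrite mem_enum.
Qed.

Lemma size_le_top (u : {poly P}) k : (size u <= k.+1)%N -> u`_k = 0 -> (size u <= k)%N.
Proof.
move=> hs h0; apply/leq_sizeP => j; rewrite leq_eqVlt => /predU1P[<- //|lt].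
by rewrite nth_default // (leq_trans hs).
Qed.

(** The quotient by a prime ideal of finite codimension is a field, built by
    adjoining the indeterminates one after the other; lifts of the successive
    minimal polynomials generate the ideal. *)
Lemma prime_generators J m (v : 'I_m -> P) : is_ideal J -> radical J -> spans_mod v J ->
    ~ J 1 -> (forall a b, J (a * b) -> J a \/ J b) ->
  forall s : seq 'I_N, exists h : seq P, [/\ size h = size s, forall g, g \in h -> J g
    & forall g, adjoin s g -> J g -> ideal_gen (fun x => x \in h) g].
Proof.
move=> idJ rJ sp J1 prJ; have [J0 JD JM] := idJ.
elim=> [|i s [hs [szh hsJ hsgen]]].
  exists [::]; split=> // _ [c ->] hc; case: (eqVneq c 0) => [->|c0].
    by rewrite mpolyC0; case: (ideal_gen_ideal (fun x : P => x \in [::])).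
  case: J1; rewrite -[1](_ : (c^-1)%:MP * c%:MP = 1); first exact: JM.
  by rewrite -mpolyCM mulVf.
pose Q d := exists u : {poly P}, [/\ size u = d, forall j, adjoin s u`_j,
   J u.['X_i] & ~ J (lead_coef u)].
have exQ : exists d, Q d.
  have [q [q0 hq]] := algebraic_mod idJ sp 'X_i.
  exists (size (map_poly (@mpolyC N F) q)), (map_poly (@mpolyC N F) q); split=> //.
  - by move=> j; rewrite coef_map; apply: adjoinC.
  - suff -> : (map_poly (@mpolyC N F) q).['X_i] = horner_alg 'X_i q by [].
    rewrite /horner_alg /horner_morph; congr (_.[_]).
    by apply: eq_map_poly => c; rewrite [RHS]/= /GRing.in_alg -mul_mpolyC mulr1.
  - rewrite lead_coef_map_inj ?mpolyC0 //; last by move=> c c'; apply: (can_inj (@mpolyCK _ _)).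
    move=> hc; apply: J1; rewrite -[1](_ : ((lead_coef q)^-1)%:MP * (lead_coef q)%:MP = 1).
      exact: JM.
    by rewrite -mpolyCM mulVf // lead_coef_eq0.
have [d [[u [su cu hu lu]] mind]] := ex_least exQ.
set a := lead_coef u in lu.
(* u' below takes the place of u divided by its leading coefficient: the latter
   is invertible modulo J only, so the coefficient in degree d - 1 is corrected
   to be exactly 1 *)
have d0 : (0 < d)%N.
  rewrite -su lt0n size_poly_eq0; apply/eqP => u0; apply: lu.
  by rewrite /a u0 lead_coef0.
have aE : u`_d.-1 = a by rewrite /a lead_coefE su.
have [q hq] := regular_mod idJ rJ sp a.
set c := horner_alg a q in hq.
have hc : J (1 - a * c) by case: (prJ _ _ hq).
have ca : adjoin s a by rewrite -aE.
have cc : adjoin s c by apply: adjoin_horner_alg.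
pose u' : {poly P} := c%:P * u + (1 - a * c)%:P * 'X^(d.-1).
have cu' j : adjoin s u'`_j.
  rewrite coefD !coefCM coefXn; apply: adjoinD; first exact: adjoinM.
  apply: adjoinM; first by apply: adjoinD; [exact: adjoin1|by apply: adjoinN; apply: adjoinM].
  by case: (j == _); [apply: adjoin1|apply: adjoin0].
have u'top : u'`_d.-1 = 1.
  by rewrite coefD !coefCM coefXn eqxx aE mulr1 mulrC addrC subrK.
have su' : (size u' <= d)%N.
  apply: leq_trans (size_polyD _ _) _; rewrite geq_max; apply/andP; split.
    by rewrite mul_polyC (leq_trans (size_scale_leq _ _)) ?su.
  rewrite mul_polyC (leq_trans (size_scale_leq _ _)) // size_polyXn.
  by rewrite prednK.
have hu' : J u'.['X_i].
  rewrite hornerD !hornerM !hornerC; apply: JD; first exact: JM.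
  exact: ideal_mulr.
pose h := u'.['X_i] :: hs.
have idI := ideal_gen_ideal (fun x : P => x \in h).
have [I0 ID IM] := idI.
have subI g : ideal_gen (fun x => x \in hs) g -> ideal_gen (fun x => x \in h) g.
  apply: ideal_gen_sub => // x hx; apply: ideal_gen_mem.
  by rewrite inE hx orbT.
have Ih : ideal_gen (fun x => x \in h) u'.['X_i] by apply: ideal_gen_mem; rewrite inE eqxx.
exists h; split; first by rewrite /= szh.
  by move=> g; rewrite inE => /predU1P[->|/hsJ].
move=> _ [w [cw' ->]]; have {cw'} cw j : adjoin s w`_j by apply: cw'.
have [k] := ubnP (size w); elim: k w cw => // k IH w cw; rewrite ltnS => sw hw.
(* a leading coefficient in J is removed with the generators found for s, any
   other one by subtracting a multiple of u' *)
have [J_l|nJ_l] := classic (J w`_k.-1).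
  case: k IH sw J_l => [|k] IH sw J_l.
    by move: sw; rewrite leqn0 size_poly_eq0 => /eqP->; rewrite horner0.
  have IHl : ideal_gen (fun x => x \in h) w`_k by apply: subI; apply: hsgen; [exact: cw|exact: J_l].
  rewrite -(subrK ((w`_k)%:P * 'X^k).['X_i] w.['X_i]) -hornerN -hornerD.
  apply: ID; last by rewrite hornerM hornerC; apply: ideal_mulr.
  apply: IH.
  - move=> j; rewrite coefB coefCM coefXn; apply: adjoinD => //; apply: adjoinN; apply: adjoinM => //.
    by case: (j == _); [apply: adjoin1|apply: adjoin0].
  - rewrite ltnS; apply: size_le_top; last by rewrite coefB coefCM coefXn eqxx mulr1 subrr.
    rewrite (leq_trans (size_polyD _ _)) // geq_max sw size_polyN mul_polyC.
    by rewrite (leq_trans (size_scale_leq _ _)) // size_polyXn.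
  - rewrite hornerD hornerN; apply: idealB => //.
    by rewrite hornerM hornerC; apply: ideal_mulr.
have k0 : (0 < k)%N.
  case: k nJ_l sw {IH} => // nJ; rewrite leqn0 size_poly_eq0 => /eqP w0.
  by case: nJ; rewrite w0 coef0.
have swk : size w = k.
  apply/eqP; rewrite eqn_leq sw /=; rewrite leqNgt; apply/negP => lt; apply: nJ_l.
  by rewrite nth_default // -ltnS prednK.
have dk : (d <= k)%N.
  by apply: mind; exists w; split=> //; rewrite lead_coefE swk.
have e1 : (k.-1 = k - d + d.-1)%N.
  by rewrite -!subn1 addnBA // subnK.
rewrite -(subrK ((w`_k.-1)%:P * 'X^(k - d) * u').['X_i] w.['X_i]) -hornerN -hornerD.
apply: ID; last by rewrite hornerM; apply: IM.
have coefW j : (w - (w`_k.-1)%:P * 'X^(k - d) * u')`_j =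
    w`_j - w`_k.-1 * (if (j < k - d)%N then 0 else u'`_(j - (k - d))).
  by rewrite coefB -mulrA coefCM [_ * u']mulrC coefMXn.
apply: IH.
- move=> j; rewrite coefW; apply: adjoinD => //; apply: adjoinN; apply: adjoinM => //.
  by case: ifP => _ //; apply: adjoin0.
- rewrite -[X in (_ < X)%N](prednK k0) ltnS; apply: size_le_top.
    rewrite prednK //; apply/leq_sizeP => j hj; rewrite coefW nth_default ?swk //.
    case: ifP => _; first by rewrite mulr0 subrr.
    rewrite [u'`__]nth_default ?mulr0 ?subrr // (leq_trans su') //.
    by rewrite leq_subRL // ?subnK // (leq_trans (leq_subr _ _)).
  by rewrite coefW e1 ltnNge leq_addr /= addKn u'top mulr1 subrr.
- rewrite hornerD hornerN; apply: idealB => //.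
  by rewrite hornerM; apply: JM.
Qed.

Lemma spans_mod_drop J J' m (v : 'I_m.+1 -> P) g : is_ideal J -> is_ideal J' ->
    (forall h, J h -> J' h) -> J' g -> ~ J g -> spans_mod v J ->
  exists v' : 'I_m -> P, spans_mod v' J'.
Proof.
move=> idJ idJ' sub hg ng sp; have [a ha] := sp g.
have [i ai] : exists i, a i != 0.
  apply/existsP; apply: contraT => /existsPn h; case: ng; move: ha.
  by rewrite big1 ?subr0 // => i _; have := h i; rewrite negbK => /eqP->; rewrite scale0r.
exists (fun j => v (lift i j)) => g'; have [a' ha'] := sp g'.
suff hv j : in_span (fun j => v (lift i j)) J' (v j).
  apply: (in_span_eq idJ' (sub _ ha')); apply: in_span_sum => // j _.
  exact: in_spanZ.
case: (unliftP i j) => [k|] ->; first by apply: (in_span_mem (fun j => v (lift i j)) idJ').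
apply: (in_span_eq idJ' (h := - (a i)^-1 *: \sum_k a (lift i k) *: v (lift i k))).
  rewrite scaleNr opprK.
  have -> : v i + (a i)^-1 *: (\sum_k a (lift i k) *: v (lift i k)) =
      (a i)^-1 *: (g - (g - \sum_i a i *: v i)).
    rewrite subKr (bigD1_ord i) //= scalerDr scalerA mulVf // scale1r.
    by [].
  by apply: idealZ => //; apply: idealB => //; apply: sub.
apply: in_spanZ => //; apply: in_span_sum => // k _; apply: in_spanZ => //.
exact: (in_span_mem (fun j => v (lift i j)) idJ').
Qed.

Lemma colon_ideal J a : is_ideal J -> is_ideal (fun g => J (a * g)).
Proof.
move=> [J0 JD JM]; split; first by rewrite mulr0.
- by move=> g h hg hh; rewrite mulrDr; apply: JD.
- by move=> g h hh; rewrite mulrCA; apply: JM.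
Qed.

Lemma colon_radical J a : is_ideal J -> radical J -> radical (fun g => J (a * g)).
Proof.
move=> [_ _ JM] rJ g k h; apply: (rJ _ k.+1).
rewrite exprMn exprS [g ^+ k.+1]exprS.
have -> : a * a ^+ k * (g * g ^+ k) = a ^+ k * g * (a * g ^+ k) by ring.
exact: JM.
Qed.

Lemma prod_ideal_colon J a w : is_ideal J ->
  prod_ideal (fun g => J (a * g)) w -> prod_ideal J (a * a * w).
Proof.
move=> idJ; have := colon_ideal (a * a) (ideal_gen_ideal (fun x => exists a b, [/\ J a, J b & x = a * b])).
move=> hi; apply: (ideal_gen_sub hi) => _ [g [h [hg hh ->]]].
by apply: ideal_gen_mem; exists (a * g), (a * h); split=> //; ring.
Qed.

(** A radical ideal of finite codimension is cut into prime ideals by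
    idempotents; the generators of the pieces are glued with partitions of unity
    that are idempotent modulo the square of the ideal. *)
Theorem radical_generators J m (v : 'I_m -> P) : is_ideal J -> radical J -> spans_mod v J ->
  exists h : 'I_N -> P, (forall i, J (h i)) /\
    forall g, J g -> exists a : 'I_N -> P, prod_ideal J (g - \sum_i a i * h i).
Proof.
elim: m J v => [|m IH] J v idJ rJ sp; have [J0 JD JM] := idJ.
  have J1 : J 1 by have [a] := sp 1; rewrite big_ord0 subr0.
  exists (fun=> 0); split=> // g hg; exists (fun=> 0).
  rewrite big1 ?subr0; last by move=> i _; rewrite mul0r.
  by apply: ideal_gen_mem; exists g, 1; rewrite mulr1.
have [J1|J1] := classic (J 1).
  exists (fun=> 0); split=> // g hg; exists (fun=> 0).
  rewrite big1 ?subr0; last by move=> i _; rewrite mul0r.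
  by apply: ideal_gen_mem; exists g, 1; rewrite mulr1.
have [prJ|nprJ] := classic (forall a b, J (a * b) -> J a \/ J b).
  have [h [szh hJ hgen]] := prime_generators idJ rJ sp J1 prJ (enum 'I_N).
  rewrite size_enum_ord in szh.
  exists (fun i => h`_i); split=> [i|g hg].
    by apply: hJ; apply: mem_nth; rewrite szh.
  have := hgen g (adjoin_all g) hg.
  have idh := ideal_gen_ideal (fun x : P => exists i : 'I_N, x = h`_i).
  have hsub x : x \in h -> family_ideal (fun i : 'I_N => h`_i) x.
    move=> hx; have lt : (index x h < N)%N by apply: (leq_trans (_ : _ < size h)%N); rewrite ?index_mem ?szh.
    by apply: ideal_gen_mem; exists (Ordinal lt); rewrite /= nth_index.
  move=> /(ideal_gen_sub idh hsub)/family_ideal_lincomb[a ->].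
  by exists a; rewrite subrr; case: (ideal_gen_ideal (fun x => exists a b, [/\ J a, J b & x = a * b])).
have [a [b [hab na nb]]] : exists a b, [/\ J (a * b), ~ J a & ~ J b].
  apply: NNPP => h; apply: nprJ => a b hab; apply: NNPP => /not_or_and[na nb].
  by apply: h; exists a, b.
have [q] := regular_mod idJ rJ sp a; set c := horner_alg a q => hac.
pose e := a * c; pose f := 1 - e.
have hef : J (e * f) by rewrite /f /e; have := JM c _ hac; rewrite mulrCA mulrA.
have ne : ~ J e.
  move=> he; apply: na; have -> : a = a * (1 - a * c) + a * e by rewrite /e; ring.
  by apply: JD => //; apply: JM.
have nf : ~ J f.
  move=> hf; apply: nb; have -> : b = b * f + c * (a * b) by rewrite /f /e; ring.
  by apply: JD; apply: JM.
have hfe : J (f * e) by rewrite mulrC.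
have [v1 sp1] := spans_mod_drop idJ (colon_ideal f idJ) (fun h => JM f h)
   hfe ne sp.
have [v2 sp2] := spans_mod_drop idJ (colon_ideal e idJ) (fun h => JM e h) hef nf sp.
have [h1 [h1J gen1]] := IH _ v1 (colon_ideal f idJ) (colon_radical idJ rJ) sp1.
have [h2 [h2J gen2]] := IH _ v2 (colon_ideal e idJ) (colon_radical idJ rJ) sp2.
(* al and be lift the two idempotents modulo the square of J: they are the terms
   of (e + f)^3, grouped according to f ^ 2 and e ^ 2, so their sum is 1 and
   their product is a multiple of (e * f) ^ 2 *)
pose al := f * f * (1 + 2%:R * e); pose be := e * e * (3%:R - 2%:R * e).
have albe : al + be = 1 by rewrite /al /be /f; ring.
have idJ2 : is_ideal (prod_ideal J) by apply: ideal_gen_ideal.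
have [_ J2D J2M] := idJ2.
have hab2 : prod_ideal J (al * be).
  have -> : al * be = (1 + 2%:R * e) * (3%:R - 2%:R * e) * ((e * f) * (e * f)).
    by rewrite /al /be; ring.
  by apply: J2M; apply: ideal_gen_mem; exists (e * f), (e * f).
exists (fun i => al * h1 i + be * h2 i); split=> [i|g hg].
  apply: JD.
    have -> : al * h1 i = f * (1 + 2%:R * e) * (f * h1 i) by rewrite /al; ring.
    exact: JM.
  have -> : be * h2 i = e * (3%:R - 2%:R * e) * (e * h2 i) by rewrite /be; ring.
  exact: JM.
have [a1 ha1] := gen1 g (JM f g hg); have [a2 ha2] := gen2 g (JM e g hg).
exists (fun i => al * a1 i + be * a2 i).
set w1 := g - _ in ha1; set w2 := g - _ in ha2.
have -> : g - \sum_i (al * a1 i + be * a2 i) * (al * h1 i + be * h2 i) =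
    (1 + 2%:R * e) * (f * f * w1) + (3%:R - 2%:R * e) * (e * e * w2)
    + \sum_i (a1 i - a2 i) * (h1 i - h2 i) * (al * be).
  have -> : \sum_i (al * a1 i + be * a2 i) * (al * h1 i + be * h2 i) =
     al * (\sum_i a1 i * h1 i) + be * (\sum_i a2 i * h2 i)
     - \sum_i (a1 i - a2 i) * (h1 i - h2 i) * (al * be).
    rewrite !mulr_sumr -big_split -sumrB /=; apply: eq_bigr => i _.
    have -> : be = 1 - al by rewrite -albe addrC addKr.
    ring.
  have -> : (1 + 2%:R * e) * (f * f * w1) = al * w1 by rewrite /al; ring.
  have -> : (3%:R - 2%:R * e) * (e * e * w2) = be * w2 by rewrite /be; ring.
  rewrite /w1 /w2 -{1}[g]mul1r -albe; ring.
apply: (J2D); last by apply: ideal_sum => // i _; apply: J2M.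
by apply: J2D; apply: J2M; apply: prod_ideal_colon.
Qed.

End RadicalGenerators.

(** * The border basis scheme *)

Section OrderIdealCombinatorics.
Variables (N mu nu : nat).
Variables (t : mu.-tuple 'X_{1..N}) (b : nu.-tuple 'X_{1..N}).
Hypotheses (t_oi : is_order_ideal t) (b_bd : is_border t b).

Lemma one_index_exists : exists i, tnth t i = 0%MM.
Proof.
have [mu0 _ cl] := t_oi.
have /tnthP[i hi] : 0%MM \in t.
  apply: (cl (tnth t (Ordinal mu0))); last exact: mem_tnth.
  by apply/mnm_lepP => i; rewrite mnm0E.
by exists i.
Qed.

Lemma tnth_inj i j : tnth t i = tnth t j -> i = j.
Proof. by have [_ ut _] := t_oi; move/tuple_uniqP: ut => ut /ut. Qed.

Lemma border_inj i j : tnth b i = tnth b j -> i = j.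
Proof. by have [ub _] := b_bd; move/tuple_uniqP: ub => ub /ub. Qed.

Lemma order_ideal_ind (Q : 'I_mu -> Prop) :
    (forall i, tnth t i = 0%MM -> Q i) ->
    (forall k m i, tnth t i = (U_(k) + tnth t m)%MM -> Q m -> Q i) ->
  forall i, Q i.
Proof.
move=> h0 hS i; have [d] := ubnP (mdeg (tnth t i)).
elim: d i => // d IH i hd; case: (eqVneq (tnth t i) 0%MM) => [/h0//|ne].
have [k hk] : exists k, tnth t i k != 0%N.
  apply/existsP; apply: contraR ne; rewrite negb_exists => /forallP h.
  by apply/eqP/mnmP => k; rewrite mnm0E; apply/eqP; have := h k; rewrite negbK.
have le : (U_(k) <= tnth t i)%MM by rewrite lep1mP.
have [_ _ cl] := t_oi.
have /tnthP[m hm] : (tnth t i - U_(k))%MM \in t.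
  exact: cl (lem_subr _ _) (mem_tnth i t).
have e : tnth t i = (U_(k) + tnth t m)%MM by rewrite -hm addmC submK.
apply: (hS _ _ _ e); apply: IH.
by move: hd; rewrite e mdegD mdeg1.
Qed.

Lemma step_cases k m :
  (exists i, tnth t i = (U_(k) + tnth t m)%MM) \/
  (exists j, tnth b j = (U_(k) + tnth t m)%MM).
Proof.
have [/tnthP[i hi]|hn] := boolP ((U_(k) + tnth t m)%MM \in t); first by left; exists i.
right; have /tnthP[j hj] : (U_(k) + tnth t m)%MM \in b.
  by have [_ hb] := b_bd; apply/hb; split=> //; exists k, m.
by exists j.
Qed.

Lemma border_step j : exists k m, tnth b j = (U_(k) + tnth t m)%MM.
Proof.
have [_ hb] := b_bd; have /hb[[k [m hm]] _] := mem_tnth j b.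
by exists k, m.
Qed.

Lemma border_notin j i : tnth b j != tnth t i.
Proof.
have [_ hb] := b_bd; have /hb[_ hn] := mem_tnth j b.
by apply: contra hn => /eqP->; apply: mem_tnth.
Qed.

Section MultMatrix.
Variables (R : comNzRingType).
Implicit Type c : 'M[R]_(mu, nu).

Lemma mult_matrix_in c k m i : tnth t i = (U_(k) + tnth t m)%MM ->
  mult_matrix t b c k *m delta_mx m 0 = delta_mx i 0 :> 'cV_mu.
Proof.
move=> e; rewrite -colE; apply/matrixP => x y; rewrite !mxE ord1 eqxx andbT.
case: pickP => [j /eqP hj|_]; first by have := border_notin j i; rewrite e hj eqxx.
by rewrite -e; congr (nat_of_bool _)%:R; apply/eqP/eqP => [/tnth_inj|->].
Qed.

Lemma mult_matrix_out c k m j : tnth b j = (U_(k) + tnth t m)%MM ->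
  mult_matrix t b c k *m delta_mx m 0 = col j c.
Proof.
move=> e; rewrite -colE; apply/matrixP => x y; rewrite !mxE.
case: pickP => [j' /eqP hj|/(_ j)]; last by rewrite e eqxx.
by congr (c _ _); apply: border_inj; rewrite hj e.
Qed.

Lemma map_mult_matrix (S : comNzRingType) (sg : {rmorphism R -> S}) c k :
  map_mx sg (mult_matrix t b c k) = mult_matrix t b (map_mx sg c) k.
Proof.
by apply/matrixP => i m; rewrite !mxE; case: pickP => [j _|_]; rewrite ?mxE ?rmorph_nat.
Qed.

End MultMatrix.

Lemma map_generic_matrix (K : fieldType) (R : comNzRingType) (tau : {rmorphism K -> R})
    (y : 'I_(mu * nu) -> R) :
  map_mx (mmap tau y) (generic_matrix mu nu K) = \matrix_(i, j) y (mxvec_index i j).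
Proof. by apply/matrixP => i j; rewrite !mxE mmapX mmap1U. Qed.

Lemma terms_spans (F : fieldType) (x : 'rV[F]_(mu * nu)) :
  spans_mod (terms F t) (fiber_ideal t b x).
Proof.
have idJ : is_ideal (fiber_ideal t b x) by apply: ideal_gen_ideal.
apply: spans_of_stable => //.
  have [i hi] := one_index_exists.
  have -> : 1 = terms F t i by rewrite /terms hi mpolyX0.
  exact: in_span_mem.
move=> k; apply: span_stable_gen => // m; rewrite /terms -mpolyXD.
have [[i <-]|[j <-]] := step_cases k m; first exact: in_span_mem.
apply: (in_span_eq idJ (h := \sum_i vec_mx x i j *: terms F t i)).
  exact: family_ideal_mem.
by apply: in_span_sum => // i _; apply: in_spanZ => //; apply: in_span_mem.
Qed.

Lemma fiber_ideal_of_corresponds (F : fieldType) J (x : 'rV[F]_(mu * nu)) :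
  is_ideal J -> corresponds t b J x -> forall g, J g <-> fiber_ideal t b x g.
Proof.
move=> idJ [[ind _] hx] g.
have sub : forall g, fiber_ideal t b x g -> J g by apply: family_ideal_sub.
split; last exact: sub.
apply: (ideal_eq_of_basis (J' := J) _ _ _ (terms_spans x)) ind _ => //.
exact: ideal_gen_ideal.
Qed.

End OrderIdealCombinatorics.

Section SchemePoints.
Variables (N m0 nu : nat).
Local Notation mu := m0.+1.
Variables (t : mu.-tuple 'X_{1..N}) (b : nu.-tuple 'X_{1..N}).
Hypotheses (t_oi : is_order_ideal t) (b_bd : is_border t b).
Variable i1 : 'I_mu.
Hypothesis t_i1 : tnth t i1 = 0%MM.

Lemma tnth0_eq i : tnth t i = 0%MM -> i = i1.
Proof. by rewrite -t_i1; apply: tnth_inj. Qed.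

Section Coordinates.
Variables (R : comNzRingType) (A : 'I_N -> 'M[R]_mu).
Hypothesis commA : forall k l, A k *m A l = A l *m A k.

Lemma mmap1_comm_step k (m : 'X_{1..N}) (e : 'cV[R]_mu) :
  mmap1 A (U_(k) + m) *m e = A k *m (mmap1 A m *m e).
Proof. by rewrite mmap1_commD // mmap1U mulmxA. Qed.

Lemma mmap1_terms (c : 'M[R]_(mu, nu)) : (forall k, A k = mult_matrix t b c k) ->
  forall i, mmap1 A (tnth t i) *m delta_mx i1 0 = delta_mx i 0 :> 'cV_mu.
Proof.
move=> hA; apply: (order_ideal_ind t_oi) => [i /[dup] /tnth0_eq -> ->|k m i e IH].
  by rewrite mmap11 mul1mx.
by rewrite e mmap1_comm_step IH hA (mult_matrix_in t_oi b_bd _ e).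
Qed.

Lemma mmap1_border (c : 'M[R]_(mu, nu)) : (forall k, A k = mult_matrix t b c k) ->
  forall j, mmap1 A (tnth b j) *m delta_mx i1 0 = col j c.
Proof.
move=> hA j; have [k [m e]] := border_step b_bd j.
by rewrite e mmap1_comm_step (mmap1_terms hA) hA (mult_matrix_out b_bd _ e).
Qed.

Variable e0 : 'cV[R]_mu.
Definition term_cols (s : nat) (w : s.-tuple 'X_{1..N}) : 'M[R]_(mu, s) :=
  \matrix_(i, j) (mmap1 A (tnth w j) *m e0) i 0.

Lemma term_cols_col s (w : s.-tuple 'X_{1..N}) j :
  term_cols w *m delta_mx j 0 = mmap1 A (tnth w j) *m e0.
Proof. by rewrite -colE; apply/matrixP => i z; rewrite !mxE ord1. Qed.

Lemma mx_colP (m p : nat) (X Y : 'M[R]_(m, p)) :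
  (forall j, X *m (delta_mx j 0 : 'cV_p) = Y *m (delta_mx j 0 : 'cV_p)) -> X = Y.
Proof.
move=> h; apply/matrixP => i j; have := h j; rewrite -!colE => /matrixP/(_ i 0).
by rewrite !mxE.
Qed.

(** Checked column by column: an indeterminate times a term of the order ideal
    is again such a term or a border term, and [y] expresses the border terms. *)
Lemma intertwine (y : 'M[R]_(mu, nu)) : term_cols t *m y = term_cols b ->
  forall k, term_cols t *m mult_matrix t b y k = A k *m term_cols t.
Proof.
move=> hy k; apply: mx_colP => m; rewrite -!mulmxA term_cols_col.
have [[i e]|[j e]] := step_cases b_bd k m.
  by rewrite (mult_matrix_in t_oi b_bd _ e) // term_cols_col e mmap1_comm_step.
by rewrite (mult_matrix_out b_bd _ e) // colE mulmxA hy term_cols_col e mmap1_comm_step.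
Qed.

Lemma term_cols_one : term_cols t *m delta_mx i1 0 = e0.
Proof. by rewrite term_cols_col t_i1 mmap11 mul1mx. Qed.

End Coordinates.

Section Fiber.
Variables (F : fieldType) (x : 'rV[F]_(mu * nu)).
Let A := mult_matrix t b (vec_mx x).
Hypothesis commA : forall k l, A k *m A l = A l *m A k.
Local Notation rho := (cyc A (delta_mx i1 0)).

Lemma cyc_terms : coords rho (terms F t) = 1%:M.
Proof.
apply/matrixP => i j; rewrite [LHS]mxE /cyc /terms mxevX.
by rewrite (mmap1_terms commA (c := vec_mx x)) // !mxE eqxx andbT.
Qed.

Lemma cyc_fiber_gen j : rho (terms F b j - \sum_i vec_mx x i j *: terms F t i) = 0.
Proof.
rewrite raddfB /= coords_comb cyc_terms mul1mx /cyc /terms mxevX.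
rewrite (mmap1_border commA (c := vec_mx x)) //.
by apply/matrixP => i z; rewrite !mxE subrr.
Qed.

(** Mourrain's criterion.  Commuting multiplication matrices define a module over
    the polynomial ring; it is generated by the basis vector of the term 1, on
    which the order ideal acts as the standard basis. *)
Lemma fiber_kerP g : fiber_ideal t b x g <-> rho g = 0.
Proof.
apply: (cyc_ker commA) => //.
- exact: cyc_fiber_gen.
- exact: terms_spans.
- by rewrite cyc_terms unitmx1.
Qed.

Lemma fiber_corresponds : corresponds t b (fiber_ideal t b x) x.
Proof.
split; first by apply/(basis_modP fiber_kerP); rewrite cyc_terms unitmx1.
by move=> j; apply: family_ideal_mem.
Qed.

End Fiber.

Definition comm_at (R : comNzRingType) (c : 'M[R]_(mu, nu)) : Prop :=
  forall k l, mult_matrix t b c k *m mult_matrix t b c l =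
              mult_matrix t b c l *m mult_matrix t b c k.

Lemma generic_comm_entry (K : fieldType) (R : comNzRingType) (tau : {rmorphism K -> R})
    (y : 'I_(mu * nu) -> R) k l i j :
  let G := generic_matrix mu nu K in
  let c := \matrix_(i, j) y (mxvec_index i j) in
  mmap tau y ((mult_matrix t b G k *m mult_matrix t b G l
              - mult_matrix t b G l *m mult_matrix t b G k) i j) =
  (mult_matrix t b c k *m mult_matrix t b c l
   - mult_matrix t b c l *m mult_matrix t b c k) i j.
Proof.
move=> G c; transitivity (map_mx (mmap tau y) (mult_matrix t b G k *m mult_matrix t b G l
              - mult_matrix t b G l *m mult_matrix t b G k) i j); first by rewrite [RHS]mxE.
by rewrite map_mxB !map_mxM !map_mult_matrix map_generic_matrix.
Qed.

Lemma scheme_points (K L : fieldType) (iota : {rmorphism K -> L}) (x : 'rV[L]_(mu * nu)) :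
  zero_locus iota (@scheme_ideal _ _ _ t b K) x <-> comm_at (vec_mx x).
Proof.
have -> : vec_mx x = \matrix_(i, j) x 0 (mxvec_index i j) by apply/matrixP => i j; rewrite !mxE.
split=> [h k l|h p].
  apply/eqP; rewrite -subr_eq0; apply/eqP/matrixP => i j.
  rewrite [RHS]mxE -(generic_comm_entry iota (fun k => x 0 k)) -[LHS]evmE; apply: h.
  by apply: ideal_gen_mem; exists k, l, i, j.
rewrite evmE; move: p.
apply: (ideal_gen_sub (J := fun p => evm iota x p = 0)); last first.
  move=> _ [k [l [i [j ->]]]].
  by rewrite /evm generic_comm_entry h subrr mxE.
split; first exact: raddf0.
- by move=> p q hp hq; rewrite raddfD /= hp hq addr0.
- by move=> p q hq; rewrite rmorphM /= hq mulr0.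
Qed.

End SchemePoints.

(** * Ideals in shape position *)

Section ShapeMatrices.
Variables (R : comNzRingType) (n m0 : nat).
Local Notation mu := m0.+1.
Variables (ell : 'I_n.+1 -> R) (li : R).
Hypothesis li_ell : li * ell ord_max = 1.
Implicit Type c : 'M[R]_(n.+1, mu).

(** Multiplication by the linear form in the basis of its powers. *)
Definition compan c : 'M[R]_mu :=
  \matrix_(i, j) if j == ord_max then c ord_max i else (i == j.+1 :> nat)%:R.

Definition row_poly c k : 'M[R]_mu := \sum_j c k j *: compan c ^+ j.

(** Multiplication by the indeterminates in the basis of powers; the last one is
    recovered from the linear form, with [li] inverse to its last coefficient. *)
Definition shape_mx c (k : 'I_n.+1) : 'M[R]_mu :=
  if unlift ord_max k is Some _ then row_poly c k
  else li *: (compan c - \sum_i ell (lift ord_max i) *: row_poly c (lift ord_max i)).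

Lemma shape_mx_lift c k : shape_mx c (lift ord_max k) = row_poly c (lift ord_max k).
Proof. by rewrite /shape_mx liftK. Qed.

Lemma shape_mx_max c : shape_mx c ord_max =
  li *: (compan c - \sum_i ell (lift ord_max i) *: row_poly c (lift ord_max i)).
Proof. by rewrite /shape_mx unlift_none. Qed.

Lemma row_poly_comm c k : compan c *m row_poly c k = row_poly c k *m compan c.
Proof.
apply: (@commr_sum 'M[R]_mu) => j _; rewrite /GRing.comm -scalerAr -scalerAl.
by congr (_ *: _); apply: commrX.
Qed.

Lemma shape_mx_compan_comm c k : compan c *m shape_mx c k = shape_mx c k *m compan c.
Proof.
rewrite /shape_mx; case: unliftP => [i|] _; first exact: row_poly_comm.
rewrite -scalemxAr -scalemxAl; congr (_ *: _).
rewrite mulmxBr mulmxBl mulmx_sumr mulmx_suml; congr (_ - _); apply: eq_bigr => i _.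
by rewrite -scalemxAr -scalemxAl row_poly_comm.
Qed.

Lemma shape_mx_commr c B : B *m compan c = compan c *m B ->
  forall k, B *m shape_mx c k = shape_mx c k *m B.
Proof.
move=> hB.
have hr k : B *m row_poly c k = row_poly c k *m B.
  apply: (@commr_sum 'M[R]_mu) => j _; rewrite /GRing.comm -scalerAr -scalerAl.
  by congr (_ *: _); apply: commrX.
move=> k; rewrite /shape_mx; case: unliftP => [i|] _ //.
rewrite -scalemxAr -scalemxAl; congr (_ *: _).
rewrite mulmxBr mulmxBl mulmx_sumr mulmx_suml hB; congr (_ - _); apply: eq_bigr => i _.
by rewrite -scalemxAr -scalemxAl hr.
Qed.

Lemma shape_mx_comm c k l : shape_mx c k *m shape_mx c l = shape_mx c l *m shape_mx c k.
Proof. by apply: shape_mx_commr; rewrite shape_mx_compan_comm. Qed.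

Lemma shape_mx_ell c : \sum_k ell k *: shape_mx c k = compan c.
Proof.
rewrite (bigD1_ord ord_max) //= shape_mx_max scalerA mulrC li_ell scale1r.
by under [X in _ + X]eq_bigr do rewrite shape_mx_lift; rewrite subrK.
Qed.

Definition e0 : 'cV[R]_mu := delta_mx ord0 0.

Lemma compan_max c : compan c *m delta_mx ord_max 0 = (row ord_max c)^T :> 'cV_mu.
Proof. by rewrite -colE; apply/matrixP => i z; rewrite !mxE eqxx. Qed.

Lemma compan_succ c (j j' : 'I_mu) : j' = j.+1 :> nat ->
  compan c *m delta_mx j 0 = delta_mx j' 0 :> 'cV_mu.
Proof.
move=> e; rewrite -colE; apply/matrixP => i z; rewrite !mxE ord1 andbT.
have -> : (j == ord_max) = false.
  by apply/negbTE/eqP => h; have := ltn_ord j'; rewrite e h ltnn.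
by rewrite -e.
Qed.

Lemma compan_exp c (j : 'I_mu) : compan c ^+ j *m e0 = delta_mx j 0.
Proof.
case: j => j hj; elim: j hj => [|j IH] hj.
  by rewrite expr0 mul1mx /e0; congr (delta_mx _ _); apply: val_inj.
have hj' : (j < mu)%N by apply: ltn_trans hj.
by rewrite exprS -[_ * _]/(_ *m _) -mulmxA (IH hj') (compan_succ c (j' := Ordinal hj)).
Qed.

Lemma compan_exp_mu c : compan c ^+ mu *m e0 = (row ord_max c)^T.
Proof.
by rewrite exprS -[_ * _]/(_ *m _) -mulmxA -[m0]/(nat_of_ord (@ord_max m0)) compan_exp compan_max.
Qed.

Lemma row_poly_e0 c k : row_poly c k *m e0 = (row k c)^T.
Proof.
rewrite mulmx_suml; apply/matrixP => i z; rewrite summxE !mxE.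
rewrite (bigD1 i) //= big1 ?addr0 => [|j ne]; rewrite -scalemxAl compan_exp !mxE ord1 ?andbT.
  by rewrite !eqxx mulr1.
by rewrite eq_sym (negPf ne) mulr0.
Qed.

Definition pow_row (r : R) : 'rV[R]_mu := \row_j r ^+ j.

(** The zero of the shape generators at which the linear form takes the value
    [r], for [r] a root of the polynomial in the last row of [c]. *)
Definition root_point c (r : R) (k : 'I_n.+1) : R :=
  if unlift ord_max k is Some _ then \sum_j c k j * r ^+ j
  else li * (r - \sum_i ell (lift ord_max i) * \sum_j c (lift ord_max i) j * r ^+ j).

Variables (c : 'M[R]_(n.+1, mu)) (r : R).
Hypothesis r_root : r ^+ mu = \sum_j c ord_max j * r ^+ j.

(** The companion matrix shifts the powers of [r], and its last column closes
    the cycle because [r] is a root.  So the row of powers is a left eigenvector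
    of all the multiplication matrices, with the coordinates of the point above
    [r] as eigenvalues. *)
Lemma pow_row_compan : pow_row r *m compan c = r *: pow_row r.
Proof.
apply/rowP => j; rewrite !mxE -exprS.
case: (eqVneq j ord_max) => [->|ne].
  by rewrite r_root; apply: eq_bigr => i _; rewrite !mxE eqxx mulrC.
have hj : (j.+1 < mu)%N.
  by rewrite ltn_neqAle ltn_ord andbT; apply: contra ne => /eqP[e]; apply/eqP/val_inj.
rewrite (bigD1 (Ordinal hj)) //= big1 ?addr0 => [|i hi]; rewrite !mxE (negPf ne).
  by rewrite eqxx mulr1.
have /negbTE-> : i != j.+1 :> nat by apply: contra hi => /eqP e; apply/eqP/val_inj.
by rewrite mulr0.
Qed.

Lemma pow_row_row_poly k : pow_row r *m row_poly c k = (\sum_j c k j * r ^+ j) *: pow_row r.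
Proof.
have hX j : pow_row r *m compan c ^+ j = r ^+ j *: pow_row r.
  elim: j => [|j IH]; first by rewrite !expr0 mulmx1 scale1r.
  by rewrite !exprSr -[_ * compan c]/(_ *m compan c) mulmxA IH -scalemxAl pow_row_compan scalerA.
rewrite mulmx_sumr scaler_suml; apply: eq_bigr => j _.
by rewrite -scalemxAr hX scalerA.
Qed.

Lemma pow_row_shape k : pow_row r *m shape_mx c k = root_point c r k *: pow_row r.
Proof.
rewrite /shape_mx /root_point; case: unliftP => [i|] _; first exact: pow_row_row_poly.
rewrite -scalemxAr mulmxBr pow_row_compan mulmx_sumr -scalerA; congr (_ *: _).
rewrite scalerBl scaler_suml; congr (_ - _); apply: eq_bigr => i _.
by rewrite -scalemxAr pow_row_row_poly scalerA.
Qed.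

Lemma pow_row_mmap1 m : pow_row r *m mmap1 (shape_mx c) m = mmap1 (root_point c r) m *: pow_row r.
Proof.
have hX k j : pow_row r *m shape_mx c k ^+ j = root_point c r k ^+ j *: pow_row r.
  elim: j => [|j IH]; first by rewrite !expr0 mulmx1 scale1r.
  by rewrite !exprSr -[_ * shape_mx c k]/(_ *m shape_mx c k) mulmxA IH -scalemxAl pow_row_shape scalerA.
rewrite /mmap1; elim: (index_enum _) => [|i s IH]; first by rewrite !big_nil mulmx1 scale1r.
rewrite !big_cons -[_ i ^+ _ * _]/(_ *m _) mulmxA hX -scalemxAl IH scalerA.
by [].
Qed.

Lemma pow_row_term_cols s (w : s.-tuple 'X_{1..n.+1}) :
  pow_row r *m term_cols (shape_mx c) e0 w = \row_j mmap1 (root_point c r) (tnth w j).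
Proof.
apply: mx_colP => j; rewrite -mulmxA term_cols_col mulmxA pow_row_mmap1.
apply/matrixP => x y; rewrite -colE !mxE (bigD1 ord0) //= !mxE big1 ?addr0 => [|i ne].
  by rewrite expr0 mulr1 eqxx ord1 eqxx mulr1.
by rewrite !mxE (negPf ne) mulr0.
Qed.

End ShapeMatrices.

Lemma map_compan (R S : comNzRingType) n m0 (sg : {rmorphism R -> S}) (c : 'M[R]_(n.+1, m0.+1)) :
  map_mx sg (compan c) = compan (map_mx sg c).
Proof. by apply/matrixP => i j; rewrite !mxE; case: ifP => // _; rewrite rmorph_nat. Qed.

Section ShapeNaturality.
Variables (R S : comNzRingType) (n m0 : nat) (sg : {rmorphism R -> S}).
Variables (ell : 'I_n.+1 -> R) (li : R) (c : 'M[R]_(n.+1, m0.+1)).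

Lemma map_row_poly k : map_mx sg (row_poly c k) = row_poly (map_mx sg c) k.
Proof.
rewrite /row_poly map_mx_sum; apply: eq_bigr => j _.
by rewrite map_mxZ -map_compan mxE; congr (_ *: _); apply: rmorphXn.
Qed.

Lemma map_shape_mx k : map_mx sg (shape_mx ell li c k) =
  shape_mx (fun i => sg (ell i)) (sg li) (map_mx sg c) k.
Proof.
rewrite /shape_mx; case: unliftP => [i|] _; first exact: map_row_poly.
rewrite map_mxZ map_mxB map_compan map_mx_sum; congr (_ *: (_ - _)).
by apply: eq_bigr => i _; rewrite map_mxZ map_row_poly.
Qed.

Lemma map_e0 : map_mx sg (e0 R m0) = e0 S m0.
Proof. by apply/matrixP => i j; rewrite !mxE rmorph_nat. Qed.

Lemma map_term_cols s (w : s.-tuple 'X_{1..n.+1}) :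
  map_mx sg (term_cols (shape_mx ell li c) (e0 R m0) w) =
  term_cols (shape_mx (fun i => sg (ell i)) (sg li) (map_mx sg c)) (e0 S m0) w.
Proof.
apply/matrixP => i j.
transitivity (map_mx sg (mmap1 (shape_mx ell li c) (tnth w j) *m e0 R m0) i 0).
  by rewrite !mxE.
rewrite map_mxM map_e0 [RHS]mxE; congr ((_ *m _) _ _).
rewrite /mmap1 (rmorph_prod (map_mx sg : {rmorphism 'M[R]_m0.+1 -> 'M[S]_m0.+1})).
by apply: eq_bigr => k _; rewrite rmorphXn /= map_shape_mx.
Qed.

End ShapeNaturality.

Section ShapeIdeals.
Variables (F : fieldType) (n m0 : nat).
Local Notation mu := m0.+1.
Local Notation P := {mpoly F[n.+1]}.
Variable ell : 'I_n.+1 -> F.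
Hypothesis ell_last : ell ord_max != 0.
Variable c : 'M[F]_(n.+1, mu).

(** The shape generators in terms of a single matrix: its last row holds the
    coefficients of the polynomial in the linear form, the others those of the
    polynomials that express the first indeterminates. *)
Definition shape_fam (i : 'I_n.+1) : P :=
  pseudo_border mu ell i - \sum_j c i j *: powers ell j.

Let J := family_ideal shape_fam.
Let A := shape_mx ell (ell ord_max)^-1 c.
Let liE : (ell ord_max)^-1 * ell ord_max = 1. Proof. by rewrite mulVf. Qed.
Let commA := shape_mx_comm ell (ell ord_max)^-1 c.

Lemma mxev_linear_form : mxev (idfun : {rmorphism F -> F}) A (linear_form ell) = compan c.
Proof.
rewrite /linear_form mxev_sum -(shape_mx_ell liE); apply: eq_bigr => k _.
by rewrite mxevZ mxevXU.
Qed.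

Lemma cyc_power (j : nat) : cyc A (e0 F m0) (linear_form ell ^+ j) = compan c ^+ j *m e0 F m0.
Proof. by rewrite /cyc mxevXn // mxev_linear_form. Qed.

Lemma cyc_powers : coords (cyc A (e0 F m0)) (powers (mu := mu) ell) = 1%:M.
Proof.
apply/matrixP => i j; rewrite [LHS]mxE /powers cyc_power compan_exp !mxE.
by rewrite andbT.
Qed.

Lemma shape_spans : spans_mod (powers (mu := mu) ell) J.
Proof.
have idJ : is_ideal J by apply: ideal_gen_ideal.
set l := linear_form ell.
have mem (j : 'I_mu) : in_span (powers (mu := mu) ell) J (l ^+ j).
  exact: (in_span_mem (powers (mu := mu) ell) idJ j).
have fam k : J (pseudo_border mu ell k - \sum_j c k j *: powers (mu := mu) ell j).
  exact: family_ideal_mem.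
have stl : span_stable (powers (mu := mu) ell) J l.
  apply: span_stable_gen => // j; rewrite /powers -exprS.
  case: (eqVneq j ord_max) => [->|ne].
    apply: (in_span_eq idJ (h := \sum_j c ord_max j *: powers ell j)).
      by have := fam ord_max; rewrite /pseudo_border unlift_none.
    by apply: in_span_sum => // i _; apply: in_spanZ => //; apply: in_span_mem.
  have hj : (j.+1 < mu)%N.
    by rewrite ltn_neqAle ltn_ord andbT; apply: contra ne => /eqP[e]; apply/eqP/val_inj.
  exact: (mem (Ordinal hj)).
have stk (k : 'I_n) : span_stable (powers (mu := mu) ell) J 'X_(lift ord_max k).
  apply: (span_stable_eq idJ (h := \sum_j c (lift ord_max k) j *: powers ell j)).
    by have := fam (lift ord_max k); rewrite /pseudo_border liftK.
  apply: span_stable_sum => // j _; apply: span_stableZ => //.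
  exact: span_stableX.
apply: spans_of_stable => //; first by have := mem ord0; rewrite expr0.
move=> k; case: (unliftP ord_max k) => [k' ->|->]; first exact: stk.
have -> : 'X_ord_max = (ell ord_max)^-1 *:
    (l - \sum_k ell (lift ord_max k) *: 'X_(lift ord_max k)) :> P.
  by rewrite /l /linear_form (bigD1_ord ord_max) //= addrK scalerA mulVf ?scale1r.
apply: span_stableZ => //; apply: span_stableD => //.
rewrite -scaleN1r; apply: span_stableZ => //; apply: span_stable_sum => // i _.
exact: span_stableZ.
Qed.

Lemma shape_kerP g : J g <-> cyc A (e0 F m0) g = 0.
Proof.
apply: (cyc_ker commA (v := powers ell)); last by rewrite cyc_powers unitmx1.
- move=> i; rewrite raddfB /= (coords_comb _ (powers ell) (c i)) cyc_powers mul1mx.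
  rewrite /pseudo_border.
  have -> : \col_j c i j = (row i c)^T by apply/matrixP => x y; rewrite !mxE.
  apply/eqP; rewrite subr_eq0; apply/eqP; case: (unliftP ord_max i) => [k|] ->.
    by rewrite /cyc mxevXU /A shape_mx_lift row_poly_e0.
  by rewrite cyc_power compan_exp_mu.
- exact: shape_spans.
Qed.

Lemma shape_powers_basis : basis_mod (powers (mu := mu) ell) J.
Proof. by apply/(basis_modP shape_kerP); rewrite cyc_powers unitmx1. Qed.

Lemma coords_shape_terms s (w : s.-tuple 'X_{1..n.+1}) :
  coords (cyc A (e0 F m0)) (terms F w) = term_cols A (e0 F m0) w.
Proof. by apply/matrixP => i j; rewrite [LHS]mxE [RHS]mxE /cyc mxevX. Qed.

Lemma shape_correspondsP nu (t : mu.-tuple 'X_{1..n.+1}) (b : nu.-tuple 'X_{1..n.+1}) x :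
  corresponds t b J x <->
  term_cols A (e0 F m0) t \in unitmx /\
  term_cols A (e0 F m0) t *m vec_mx x = term_cols A (e0 F m0) b.
Proof.
rewrite /corresponds /has_border_basis.
have := basis_modP shape_kerP (terms F t).
have := congr_modP shape_kerP (terms F t) (terms F b) (vec_mx x).
rewrite !coords_shape_terms; tauto.
Qed.

End ShapeIdeals.

(** * Tangent vectors of the border basis scheme at radical ideals *)

Section DualMatrices.
Variable R : comNzRingType.

Lemma dsnd_mulmx m n p (X : 'M[dual R]_(m, n)) (Y : 'M[dual R]_(n, p)) :
  map_mx (@dsnd R) (X *m Y) = map_mx (@dfst R) X *m map_mx (@dsnd R) Y
                             + map_mx (@dsnd R) X *m map_mx (@dfst R) Y.
Proof.
apply/matrixP => i j; rewrite !mxE raddf_sum -big_split /=; apply: eq_bigr => k _.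
by rewrite dsndM !mxE.
Qed.

End DualMatrices.

Section MapMxev.
Variables (K R S : comNzRingType) (tau : {rmorphism K -> R}) (sg : {rmorphism R -> S}).
Variables (N m0 : nat) (A : 'I_N -> 'M[R]_m0.+1).

Lemma map_mxev (tau' : {rmorphism K -> S}) (A' : 'I_N -> 'M[S]_m0.+1) p :
  (forall z, sg (tau z) = tau' z) -> (forall k, map_mx sg (A k) = A' k) ->
  map_mx sg (mxev tau A p) = mxev tau' A' p.
Proof.
move=> ht hA; pose sgm : {rmorphism 'M[R]_m0.+1 -> 'M[S]_m0.+1} := map_mx sg.
rewrite -[LHS]/(sgm (mmap (fun z => (tau z)%:M) A p)) mmap_morph.
by apply: eq_mmap => [z|k] //=; rewrite map_scalar_mx /= ht.
Qed.

End MapMxev.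

Section TangentBound.
Variables (L : fieldType) (N m0 nu : nat).
Local Notation mu := m0.+1.
Local Notation P := {mpoly L[N]}.
Variables (t : mu.-tuple 'X_{1..N}) (b : nu.-tuple 'X_{1..N}).
Hypotheses (t_oi : is_order_ideal t) (b_bd : is_border t b).
Variable i1 : 'I_mu.
Hypothesis t_i1 : tnth t i1 = 0%MM.
Variable x : 'rV[L]_(mu * nu).
Hypothesis x_comm : comm_at t b (vec_mx x).
Let A := mult_matrix t b (vec_mx x).
Let e1 : 'cV[L]_mu := delta_mx i1 0.
Let J := fiber_ideal t b x.

Definition dual_pt (v : 'rV[L]_(mu * nu)) : 'I_(mu * nu) -> dual L :=
  fun k => (x 0 k, v 0 k).
Definition dual_mx (v : 'rV[L]_(mu * nu)) : 'M[dual L]_(mu, nu) :=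
  \matrix_(i, j) dual_pt v (mxvec_index i j).

(** The multiplication matrices commute to first order in the direction [v]:
    the border basis deforms to a flat family over the dual numbers. *)
Definition flat_along v := comm_at t b (dual_mx v).

Let fiber_gen j : P := terms L b j - \sum_i vec_mx x i j *: terms L t i.

Lemma mxev_fiber0 g : J g -> mxev (idfun : {rmorphism L -> L}) A g = 0.
Proof.
move=> hg; apply: mx_colP => m; rewrite mul0mx.
have <- : mmap1 A (tnth t m) *m delta_mx i1 0 = delta_mx m 0 :> 'cV_mu.
  exact: (mmap1_terms t_oi b_bd t_i1 x_comm).
rewrite -(mxevX (idfun : {rmorphism L -> L})) mulmxA -mxevM //.
apply/(fiber_kerP t_oi b_bd t_i1 x_comm).
by apply: ideal_mulr => //; apply: ideal_gen_ideal.
Qed.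

Section Along.
Variable v : 'rV[L]_(mu * nu).
Hypothesis v_flat : flat_along v.
Let B := mult_matrix t b (dual_mx v).
Let inj : {rmorphism L -> dual L} := @dinj L.

(** On the ideal this is the homomorphism to the quotient that corresponds to
    the tangent vector [v], in the coordinates given by the order ideal. *)
Definition defo (g : P) : 'cV[L]_mu :=
  map_mx (@dsnd L) (mxev inj B g *m delta_mx i1 0).

Lemma map_dfst_mx k : map_mx (@dfst L) (B k) = A k.
Proof.
rewrite map_mult_matrix; congr (mult_matrix t b _ k).
by apply/matrixP => i j; rewrite !mxE.
Qed.

Lemma dfst_mxev g : map_mx (@dfst L) (mxev inj B g) = mxev (idfun : {rmorphism L -> L}) A g.
Proof. by apply: map_mxev => // k; apply: map_dfst_mx. Qed.

(** Elements of the ideal act by zero at the point itself, so only the first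
    order of the second factor survives. *)
Lemma defoM g h : J h -> defo (g * h) = mxev (idfun : {rmorphism L -> L}) A g *m defo h.
Proof.
move=> hh; rewrite /defo mxevM // -mulmxA dsnd_mulmx dfst_mxev.
by rewrite [X in _ + _ *m X]map_mxM dfst_mxev (mxev_fiber0 hh) mul0mx mulmx0 addr0.
Qed.

Lemma defoD g h : defo (g + h) = defo g + defo h.
Proof. by rewrite /defo mxevD mulmxDl raddfD. Qed.

Lemma defo0 : defo 0 = 0.
Proof. by apply: (addrI (defo 0)); rewrite -defoD !addr0. Qed.

Lemma defoN g : defo (- g) = - defo g.
Proof. by apply: (addrI (defo g)); rewrite -defoD !subrr defo0. Qed.

Lemma defo_sum (I : Type) (r : seq I) (Q : pred I) (G : I -> P) :
  defo (\sum_(i <- r | Q i) G i) = \sum_(i <- r | Q i) defo (G i).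
Proof. exact: (big_morph defo defoD defo0). Qed.

Lemma defo_fiber_gen j : defo (fiber_gen j) = col j (vec_mx v).
Proof.
have dX m : mxev inj B 'X_[m] = mmap1 B m by apply: mxevX.
have E i : defo (vec_mx x i j *: terms L t i) = 0.
  rewrite /defo mxevZ -scalemxAl dX (mmap1_terms t_oi b_bd t_i1 v_flat (c := dual_mx v)) //.
  by apply/matrixP => p q; rewrite !mxE /=; case: (_ && _); rewrite ?mulr1 ?mulr0.
rewrite defoD defoN defo_sum [X in - X]big1 ?subr0 => [|i _]; last exact: E.
rewrite /defo dX (mmap1_border t_oi b_bd t_i1 v_flat (c := dual_mx v)) //.
by apply/matrixP => p q; rewrite !mxE.
Qed.

Lemma defo_prod g : prod_ideal J g -> defo g = 0.
Proof.
have idJ : is_ideal J by apply: ideal_gen_ideal.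
suff : prod_ideal J g -> J g /\ defo g = 0 by move=> h /h[].
apply: (ideal_gen_sub (J := fun g => J g /\ defo g = 0)).
  have [J0 JD JM] := idJ; split.
  - by split=> //; apply: defo0.
  - by move=> p q [hp ep] [hq eq]; split; [apply: JD|rewrite defoD ep eq addr0].
  - by move=> p q [hq eq]; split; [apply: JM|rewrite defoM // eq mulmx0].
move=> _ [p [q [hp hq ->]]]; split; first exact: ideal_mulr.
by rewrite defoM // mxev_fiber0 // mul0mx.
Qed.

End Along.

Section Combination.
Variable a : 'I_N -> 'I_nu -> P.

(** The values of [defo v] at the elements [\sum_j a i j * fiber_gen j], in a form
    that is defined and linear for all [v], tangent or not. *)
Definition defo_comb (v : 'rV[L]_(mu * nu)) : 'rV[L]_(N * mu) :=
  mxvec (\matrix_(i, l)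
    (\sum_j mxev (idfun : {rmorphism L -> L}) A (a i j) *m col j (vec_mx v)) l 0).

Fact defo_comb_is_linear : linear defo_comb.
Proof.
move=> c u w; rewrite /defo_comb -linearZ /= -linearD /=; congr mxvec.
have [S hS] : exists S : 'I_N -> 'rV[L]_(mu * nu) -> 'cV[L]_mu, forall i v,
    S i v = \sum_j mxev (idfun : {rmorphism L -> L}) A (a i j) *m col j (vec_mx v).
  by eexists.
apply/matrixP => i l; rewrite [LHS]mxE -hS.
have -> : S i (c *: u + w) = c *: S i u + S i w.
  rewrite !hS scaler_sumr -big_split; apply: eq_bigr => j _ /=.
  rewrite scalemxAr -mulmxDr; congr (_ *m _).
  by apply/matrixP => p q; rewrite !mxE.
rewrite [RHS]mxE [X in _ = X + _]mxE [X in _ = _ * X + _]mxE [X in _ = _ + X]mxE -!hS.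
by rewrite mxE [X in X + _ = _]mxE.
Qed.
HB.instance Definition _ := GRing.isLinear.Build L 'rV[L]_(mu * nu) 'rV[L]_(N * mu) *:%R
  defo_comb defo_comb_is_linear.

End Combination.

(** Tangent vectors are homomorphisms from [J] to the quotient by [J]; they
    vanish on the square of [J], hence are determined by the values on
    generators modulo the square. *)
Theorem tangent_bound D (T : 'M[L]_(D, mu * nu)) : radical J ->
  row_free T -> (forall v : 'rV_(mu * nu), (v <= T)%MS -> flat_along v) -> (D <= N * mu)%N.
Proof.
move=> rJ fT hT; have idJ : is_ideal J by apply: ideal_gen_ideal.
have [h [hJ hgen]] := radical_generators idJ rJ (terms_spans t_oi b_bd x).
have /fin_all_exists[a ha] i := family_ideal_lincomb (hJ i).
pose Lam := lin1_mx (defo_comb a).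
suff : row_free (T *m Lam) by rewrite /row_free => /eqP <-; apply: rank_leq_col.
apply: inj_row_free => u; rewrite mulmxA mul_rV_lin1 /= => h0.
set v := u *m T in h0; have vT : (v <= T)%MS by apply: submxMl.
have fl := hT v vT.
have hi i : defo v (h i) = 0.
  rewrite ha defo_sum.
  transitivity (\sum_j mxev (idfun : {rmorphism L -> L}) A (a i j) *m col j (vec_mx v)).
    apply: eq_bigr => j _; rewrite defoM ?defo_fiber_gen //.
    exact: family_ideal_mem.
  have := congr1 vec_mx h0; rewrite /defo_comb mxvecK linear0 => /matrixP e.
  by apply/matrixP => l z; have := e i l; rewrite ord1 [LHS]mxE => ->; rewrite !mxE.
have J0 g : J g -> defo v g = 0.
  move=> hg; have [c hc] := hgen g hg.
  rewrite -(subrK (\sum_i c i * h i) g) defoD (defo_prod fl hc) add0r defo_sum.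
  by rewrite big1 // => i _; rewrite defoM // hi mulmx0.
have v0 : v = 0.
  rewrite -[v]vec_mxK; apply/eqP; rewrite mxvec_eq0; apply/eqP/matrixP => i j.
  have := J0 _ (family_ideal_mem _ j); rewrite defo_fiber_gen // => /matrixP/(_ i 0).
  by rewrite !mxE.
by have /(row_free_inj fT) : u *m T = 0 *m T by rewrite mul0mx.
Qed.

End TangentBound.

Section TangentOfIdeal.
Variables (K L : fieldType) (iota : {rmorphism K -> L}) (N m0 nu : nat).
Local Notation mu := m0.+1.
Variables (t : mu.-tuple 'X_{1..N}) (b : nu.-tuple 'X_{1..N}).

Definition is_tangent Nv (J : {mpoly K[Nv]} -> Prop) (x v : 'rV[L]_Nv) : Prop :=
  forall p, J p -> \sum_k v 0 k * ev iota (mderiv k p) x = 0.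

Lemma tangent_flat (x v : 'rV[L]_(mu * nu)) :
  zero_locus iota (@scheme_ideal _ _ _ t b K) x ->
  is_tangent (@scheme_ideal _ _ _ t b K) x v -> flat_along t b x v.
Proof.
move=> hx hv k l; apply/eqP; rewrite -subr_eq0; apply/eqP/matrixP => i j.
pose tau : {rmorphism K -> dual L} := (@dinj L) \o iota.
rewrite [RHS]mxE -(generic_comm_entry t b tau (dual_pt x v)).
set p := (X in mmap _ _ X); have hp : @scheme_ideal _ _ _ t b K p.
  by apply: ideal_gen_mem; exists k, l, i, j.
apply: dual_eqP.
  by rewrite mmap_morph -[LHS]/(evm iota x p) -evmE; apply: hx.
rewrite -[mmap tau]/(mmap (fun z => dinj (iota z))) dual_taylor raddf0 -[RHS](hv p hp).
by apply: eq_bigr => s _; rewrite evE.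
Qed.

End TangentOfIdeal.

(** * The chart given by the coefficients of the shape generators *)

Section ChartRing.
Variables (n m0 nu : nat).
Local Notation mu := m0.+1.
Variables (t : mu.-tuple 'X_{1..n.+1}) (b : nu.-tuple 'X_{1..n.+1}).
Hypotheses (t_oi : is_order_ideal t) (b_bd : is_border t b).
Variable i1 : 'I_mu.
Hypothesis t_i1 : tnth t i1 = 0%MM.

Definition chart_M (R : comNzRingType) (ell : 'I_n.+1 -> R) (li : R)
    (c : 'M[R]_(n.+1, mu)) : 'M[R]_mu := term_cols (shape_mx ell li c) (e0 R m0) t.
Definition chart_N (R : comNzRingType) (ell : 'I_n.+1 -> R) (li : R)
    (c : 'M[R]_(n.+1, mu)) : 'M[R]_(mu, nu) := term_cols (shape_mx ell li c) (e0 R m0) b.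

Lemma map_chart_M (R S : comNzRingType) (sg : {rmorphism R -> S}) ell li c :
  map_mx sg (chart_M ell li c) = chart_M (fun i => sg (ell i)) (sg li) (map_mx sg c).
Proof. exact: map_term_cols. Qed.

Lemma map_chart_N (R S : comNzRingType) (sg : {rmorphism R -> S}) ell li c :
  map_mx sg (chart_N ell li c) = chart_N (fun i => sg (ell i)) (sg li) (map_mx sg c).
Proof. exact: map_term_cols. Qed.

Lemma eq_shape_mx (R : comNzRingType) ell ell' (li : R) (c : 'M[R]_(n.+1, mu)) :
  ell =1 ell' -> shape_mx ell li c =1 shape_mx ell' li c.
Proof.
move=> e k; rewrite /shape_mx; case: unliftP => // _.
by congr (_ *: (_ - _)); apply: eq_bigr => i _; rewrite e.
Qed.

Lemma eq_term_cols (R : comNzRingType) ell ell' (li : R) (c : 'M[R]_(n.+1, mu)) e s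
    (w : s.-tuple 'X_{1..n.+1}) : ell =1 ell' ->
  term_cols (shape_mx ell li c) e w = term_cols (shape_mx ell' li c) e w.
Proof.
move=> h; apply/matrixP => i j; rewrite [LHS]mxE [RHS]mxE.
by rewrite (mmap1_eq _ (eq_shape_mx li c h)).
Qed.

Section Inverse.
Variables (R : comNzRingType) (ell : 'I_n.+1 -> R) (y : 'M[R]_(mu, nu)).

Definition ell_mult : 'M[R]_mu := \sum_k ell k *: mult_matrix t b y k.
(** The coordinates of the powers of the linear form with respect to the order
    ideal; invertibility of this matrix describes the image of the chart. *)
Definition power_cols : 'M[R]_mu :=
  \matrix_(i, j) (ell_mult ^+ j *m delta_mx i1 0 : 'cV_mu) i 0.
(** Likewise for the leading terms of the shape generators. *)
Definition target (k : 'I_n.+1) : 'cV[R]_mu :=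
  (if unlift ord_max k is Some _ then mult_matrix t b y k else ell_mult ^+ mu)
    *m delta_mx i1 0.

Variables (li : R) (c : 'M[R]_(n.+1, mu)).
Hypothesis li_ell : li * ell ord_max = 1.
Hypothesis y_chart : chart_M ell li c *m y = chart_N ell li c.

Let M := chart_M ell li c.

Lemma chart_intertwine k : M *m mult_matrix t b y k = shape_mx ell li c k *m M.
Proof. exact: (intertwine t_oi b_bd (shape_mx_comm ell li c)). Qed.

Lemma chart_one : M *m delta_mx i1 0 = e0 R m0.
Proof. exact: term_cols_one. Qed.

Lemma chart_ell : M *m ell_mult = compan c *m M.
Proof.
rewrite -(shape_mx_ell li_ell c) mulmx_sumr mulmx_suml; apply: eq_bigr => k _.
by rewrite -scalemxAr -scalemxAl chart_intertwine.
Qed.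

Lemma chart_ell_exp j : M *m ell_mult ^+ j = compan c ^+ j *m M.
Proof.
elim: j => [|j IH]; first by rewrite !expr0 mulmx1 mul1mx.
by rewrite !exprSr -[_ * ell_mult]/(_ *m _) mulmxA IH -mulmxA chart_ell mulmxA.
Qed.

(** The chart matrix conjugates multiplication in one basis into multiplication
    in the other, where the powers of the linear form are the standard basis. *)
Lemma chart_power_cols : M *m power_cols = 1%:M.
Proof.
apply: mx_colP => j; rewrite mul1mx -mulmxA.
have -> : power_cols *m delta_mx j 0 = ell_mult ^+ j *m delta_mx i1 0 :> 'cV_mu.
  by rewrite -colE; apply/matrixP => i z; rewrite [LHS]mxE [LHS]mxE ord1.
by rewrite mulmxA chart_ell_exp -mulmxA chart_one compan_exp.
Qed.

Lemma chart_target k : M *m target k = (row k c)^T.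
Proof.
rewrite /target mulmxA; case: (unliftP ord_max k) => [i|] ->.
  by rewrite chart_intertwine -mulmxA chart_one shape_mx_lift row_poly_e0.
by rewrite chart_ell_exp -mulmxA chart_one compan_exp_mu.
Qed.

Lemma power_cols_target k : power_cols *m (row k c)^T = target k.
Proof. by rewrite -chart_target mulmxA (mulmx1C chart_power_cols) mul1mx. Qed.

End Inverse.

Section InverseNaturality.
Variables (R S : comNzRingType) (sg : {rmorphism R -> S}).
Variables (ell : 'I_n.+1 -> R) (y : 'M[R]_(mu, nu)).

Lemma map_ell_mult : map_mx sg (ell_mult ell y) = ell_mult (fun i => sg (ell i)) (map_mx sg y).
Proof.
rewrite /ell_mult map_mx_sum; apply: eq_bigr => k _.
by rewrite map_mxZ map_mult_matrix.
Qed.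

Lemma map_delta_mx m p i j : map_mx sg (delta_mx i j : 'M[R]_(m, p)) = delta_mx i j.
Proof. by apply/matrixP => x z; rewrite !mxE rmorph_nat. Qed.

Lemma map_ell_mult_exp j : map_mx sg (ell_mult ell y ^+ j) =
  ell_mult (fun i => sg (ell i)) (map_mx sg y) ^+ j.
Proof. by rewrite -map_ell_mult; apply: rmorphXn. Qed.

Lemma map_power_cols : map_mx sg (power_cols ell y) =
  power_cols (fun i => sg (ell i)) (map_mx sg y).
Proof.
apply/matrixP => i j; rewrite [LHS]mxE [in LHS]mxE [RHS]mxE.
by rewrite -map_ell_mult_exp -(map_delta_mx i1 0) -map_mxM [RHS]mxE.
Qed.

Lemma map_target k : map_mx sg (target ell y k) = target (fun i => sg (ell i)) (map_mx sg y) k.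
Proof.
rewrite /target map_mxM map_delta_mx; congr (_ *m _).
by case: unliftP => [i|] _; [exact: map_mult_matrix|exact: map_ell_mult_exp].
Qed.

End InverseNaturality.

Section ChartField.
Variables (F : fieldType) (ell : 'I_n.+1 -> F).
Hypothesis ell_last : ell ord_max != 0.
Let li := (ell ord_max)^-1.
Let li_ell : li * ell ord_max = 1. Proof. by rewrite /li mulVf. Qed.
Implicit Types (c : 'M[F]_(n.+1, mu)) (x : 'rV[F]_(mu * nu)).
Local Notation Jc c := (family_ideal (shape_fam ell c)).

Lemma corresponds_chartP c x : corresponds t b (Jc c) x <->
  chart_M ell li c \in unitmx /\ chart_M ell li c *m vec_mx x = chart_N ell li c.
Proof. exact: shape_correspondsP. Qed.

Definition chart_pt c : 'rV[F]_(mu * nu) :=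
  mxvec (invmx (chart_M ell li c) *m chart_N ell li c).

Lemma chart_ptE c : chart_M ell li c \in unitmx ->
  chart_M ell li c *m vec_mx (chart_pt c) = chart_N ell li c.
Proof. by move=> hM; rewrite mxvecK mulKVmx. Qed.

Lemma chart_corresponds c : chart_M ell li c \in unitmx -> corresponds t b (Jc c) (chart_pt c).
Proof. by move=> hM; apply/corresponds_chartP; rewrite chart_ptE. Qed.

Lemma chart_comm c x : chart_M ell li c \in unitmx ->
  chart_M ell li c *m vec_mx x = chart_N ell li c -> comm_at t b (vec_mx x).
Proof.
move=> hM hx k l; apply: (can_inj (mulKmx hM)).
by rewrite !mulmxA !(chart_intertwine hx) -!mulmxA !(chart_intertwine hx) !mulmxA shape_mx_comm.
Qed.

Section FiberPowers.
Variable x : 'rV[F]_(mu * nu).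
Hypothesis x_comm : comm_at t b (vec_mx x).
Let A := mult_matrix t b (vec_mx x).
Local Notation rho := (cyc A (delta_mx i1 0)).

Lemma cyc_ell_exp j : rho (linear_form ell ^+ j) = ell_mult ell (vec_mx x) ^+ j *m delta_mx i1 0.
Proof.
rewrite /cyc mxevXn //; congr (_ ^+ j *m _).
rewrite /linear_form mxev_sum; apply: eq_bigr => k _.
by rewrite mxevZ mxevXU.
Qed.

Lemma coords_fiber_powers :
  coords rho (powers (mu := mu) ell) = power_cols ell (vec_mx x).
Proof. by apply/matrixP => i j; rewrite [LHS]mxE [RHS]mxE /powers cyc_ell_exp. Qed.

Lemma fiber_powers_basisP : basis_mod (powers (mu := mu) ell) (fiber_ideal t b x) <->
  power_cols ell (vec_mx x) \in unitmx.
Proof.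
by have := basis_modP (fiber_kerP t_oi b_bd t_i1 x_comm) (powers (mu := mu) ell);
   rewrite coords_fiber_powers.
Qed.

Definition chart_coords : 'M[F]_(n.+1, mu) :=
  \matrix_(k, j) (invmx (power_cols ell (vec_mx x)) *m target ell (vec_mx x) k) j 0.

Hypothesis x_basis : power_cols ell (vec_mx x) \in unitmx.

(** The shape generators with these coefficients lie in the fiber ideal by
    construction.  The ideals agree because the powers of the linear form span
    modulo the smaller one and are independent modulo the larger one. *)
Lemma chart_coords_corresponds : corresponds t b (Jc chart_coords) x.
Proof.
set c := chart_coords.
have gen0 k : rho (shape_fam ell c k) = 0.
  rewrite /shape_fam raddfB /= (coords_comb _ (powers ell) (c k)) coords_fiber_powers.
  have -> : \col_j c k j = invmx (power_cols ell (vec_mx x)) *m target ell (vec_mx x) k.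
    by apply/matrixP => i z; rewrite [LHS]mxE [LHS]mxE ord1.
  rewrite mulKVmx // /target /pseudo_border.
  case: (unliftP ord_max k) => [i ->|_]; last by rewrite cyc_ell_exp subrr.
  by rewrite /cyc mxevXU subrr.
have fib := fiber_kerP t_oi b_bd t_i1 x_comm.
have idJ : is_ideal (Jc c) by apply: ideal_gen_ideal.
have idI : is_ideal (fiber_ideal t b x) by apply: ideal_gen_ideal.
have sub g : Jc c g -> fiber_ideal t b x g.
  by apply: (family_ideal_sub idI) => k; apply/fib/gen0.
have [ind _] := (fiber_powers_basisP).2 x_basis.
have eJ g : fiber_ideal t b x g <-> Jc c g.
  split; last exact: sub.
  exact: (ideal_eq_of_basis idI sub idJ (shape_spans ell_last c) ind).
have [hb hc] := fiber_corresponds t_oi b_bd t_i1 x_comm.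
split; first exact: (basis_mod_ext (fun=> erefl) eJ hb).
exact: (congr_mod_ext (fun=> erefl) eJ hc).
Qed.

End FiberPowers.

Lemma chart_coordsK c x : chart_M ell li c *m vec_mx x = chart_N ell li c ->
  chart_coords x = c.
Proof.
move=> hx; have hQ := mulmx1_unit (chart_power_cols li_ell hx).
apply/matrixP => k j; rewrite mxE -(power_cols_target li_ell hx) mulKmx ?(proj2 hQ) //.
by rewrite !mxE.
Qed.

End ChartField.
End ChartRing.

(** * Clearing denominators *)

Section Cramer.
Variables (K L : fieldType) (iota : {rmorphism K -> L}) (mu nu : nat).

Definition cramer_pt (M : 'M[L]_mu) (Nm : 'M[L]_(mu, nu)) : 'rV[L]_(mu * nu) :=
  mxvec (invmx M *m Nm).

(** A power of [\det M] times the value of [p] at the solution [y] of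
    [M *m y = Nm], polynomial in the entries of [M] and [Nm]. *)
Definition cramer_num (R : comNzRingType) (tau : K -> R) k (M : 'M[R]_mu) (Nm : 'M[R]_(mu, nu))
    (p : {mpoly K[mu * nu]}) : R :=
  homogenize k tau (\det M) (fun i => mxvec (\adj M *m Nm) 0 i) p.

Lemma cramer_num_morph (R S : comNzRingType) (sg : {rmorphism R -> S}) (tau : K -> R)
    (tau' : K -> S) k M Nm p : (forall z, sg (tau z) = tau' z) ->
  sg (cramer_num tau k M Nm p) = cramer_num tau' k (map_mx sg M) (map_mx sg Nm) p.
Proof.
move=> ht; rewrite homogenize_morph; apply: eq_homogenize => // [|i].
  by rewrite det_map_mx.
by rewrite -map_mx_adj -map_mxM -map_mxvec [RHS]mxE.
Qed.

(** Cramer's rule, in a form that applies over polynomial rings and over the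
    dual numbers. *)
Lemma cramer_numE (R : comNzRingType) (tau : {rmorphism K -> R}) k M Nm y p :
    (msize p <= k.+1)%N -> M *m vec_mx y = Nm ->
  cramer_num tau k M Nm p = \det M ^+ k * mmap tau (fun i => y 0 i) p.
Proof.
move=> hk hy; apply: homogenizeE => // i.
by rewrite -hy mulmxA mul_adj_mx mul_scalar_mx linearZ /= vec_mxK mxE.
Qed.

Lemma cramer_num_pt k M Nm p : (msize p <= k.+1)%N -> M \in unitmx ->
  cramer_num iota k M Nm p = \det M ^+ k * evm iota (cramer_pt M Nm) p.
Proof. by move=> hk hM; apply: cramer_numE => //; rewrite mxvecK mulKVmx. Qed.

End Cramer.

(** * Descent of linear relations to the ground field *)

(** A system of linear equations over [K] that is solvable over [L] is solvable
    over [K], because ranks are invariant under field extensions. *)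
Lemma lincomb_descent (K L : fieldType) (iota : {rmorphism K -> L}) N (T : finType)
    (w : T -> {mpoly K[N]}) (p : {mpoly K[N]}) (al : T -> L) :
    map_mpoly iota p = \sum_i al i *: map_mpoly iota (w i) ->
  exists c : T -> K, p = \sum_i c i *: w i.
Proof.
move=> hp; pose S := msupp p ++ flatten [seq msupp (w i) | i : T].
pose u : 'rV[K]_(size S) := \row_j p@_(nth 0%MM S j).
pose W : 'M[K]_(#|T|, size S) := \matrix_(i, j) (w (enum_val i))@_(nth 0%MM S j).
have : (u <= W)%MS.
  rewrite -(map_submx iota); apply/submxP; exists (\row_i al (enum_val i)).
  apply/rowP => j; rewrite !mxE -mcoeff_map_mpoly hp raddf_sum /=.
  rewrite (reindex (@enum_val T predT)) /=; last exact: (onW_bij _ (@enum_val_bij T)).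
  by apply: eq_bigr => i _; rewrite !mxE mcoeffZ mcoeff_map_mpoly.
case/submxP => c hc; exists (fun i => c 0 (enum_rank i)).
have small (q : {mpoly K[N]}) m : {subset msupp q <= S} -> m \notin S -> q@_m = 0.
  by move=> sub hm; apply/eqP; rewrite mcoeff_eq0; apply: contra hm => /sub.
have subw i : {subset msupp (w i) <= S}.
  move=> m hm; rewrite mem_cat; apply/orP; right; apply/flattenP.
  by exists (msupp (w i)) => //; apply/mapP; exists i; rewrite ?mem_enum.
apply/mpolyP => m; rewrite raddf_sum /=.
have [hm|hm] := boolP (m \in S); last first.
  rewrite small //; last by move=> z hz; rewrite mem_cat hz.
  by rewrite big1 // => i _; rewrite mcoeffZ (small (w i)) // mulr0.
have lt : (index m S < size S)%N by rewrite index_mem.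
have /rowP/(_ (Ordinal lt)) := hc; rewrite !mxE /= nth_index // => ->.
rewrite (reindex (@enum_val T predT)) /=; last exact: (onW_bij _ (@enum_val_bij T)).
by apply: eq_bigr => i _; rewrite !mxE /= nth_index // mcoeffZ enum_valK.
Qed.

(** Only finitely many products of monomials with elements of [J] occur in a
    given relation, so membership is a matter of linear equations. *)
Lemma extended_ideal_descent (K L : fieldType) (iota : {rmorphism K -> L}) N
    (J : {mpoly K[N]} -> Prop) p : is_ideal J ->
  extended_ideal iota J (map_mpoly iota p) -> J p.
Proof.
move=> idJ [r [a [s [hs e]]]].
have /fin_all_exists[q hq] i : exists q, J q /\ s i = map_mpoly iota q.
  by have [q ? ?] := hs i; exists q.
pose B := (\max_i msize (a i))%N.
pose w (z : 'I_r * 'X_{1..N < B}) := 'X_[z.2] * q z.1.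
have [c ->] : exists c, p = \sum_z c z *: w z.
  apply: (@lincomb_descent _ _ iota _ _ w p (fun z => (a z.1)@_z.2)).
  rewrite e.
  transitivity (\sum_(i < r) \sum_(m : 'X_{1..N < B}) (a i)@_m *: map_mpoly iota (w (i, m))).
    apply: eq_bigr => i _; rewrite (proj2 (hq i)) {1}(mpolywE (k := B) (p := a i)).
      rewrite mulr_suml; apply: eq_bigr => m _.
      by rewrite rmorphM /= map_mpolyX scalerAl.
    exact: (leq_bigmax i).
  by rewrite pair_big /=; apply: eq_bigr => [[i m] _].
have [_ _ JM] := idJ.
by apply: ideal_sum => // z _; apply: idealZ => //; apply: JM; case: (hq z.1).
Qed.

(** * Counting monomials *)

Section Counting.
Variables (K : fieldType) (N : nat).
Implicit Types p q : {mpoly K[N]}.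

Lemma msizeM_bound p q e e' :
  (msize p <= e.+1)%N -> (msize q <= e'.+1)%N -> (msize (p * q) <= (e + e').+1)%N.
Proof.
move=> hp hq; have [->|p0] := eqVneq p 0; first by rewrite mul0r msize0.
have [->|q0] := eqVneq q 0; first by rewrite mulr0 msize0.
rewrite msizeM // -subn1 leq_subLR add1n.
by apply: (leq_trans (leq_add hp hq)); rewrite addSn addnS.
Qed.

Lemma msizeX_bound p e k : (msize p <= e.+1)%N -> (msize (p ^+ k) <= (k * e).+1)%N.
Proof.
move=> hp; elim: k => [|k IH]; first by rewrite expr0 msize1.
by rewrite exprS mulSn; apply: msizeM_bound.
Qed.

Lemma msize_prod_bound (I : Type) (r : seq I) (P : I -> {mpoly K[N]}) (e : I -> nat) :
  (forall i, msize (P i) <= (e i).+1)%N ->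
  (msize (\prod_(i <- r) P i) <= (\sum_(i <- r) e i).+1)%N.
Proof.
move=> h; elim: r => [|i r IH]; first by rewrite !big_nil msize1.
by rewrite !big_cons; apply: msizeM_bound.
Qed.

(** There are more polynomials than monomials to write them with. *)
Lemma monomials_dependent (T : finType) (g : T -> {mpoly K[N]}) B :
    (forall h, msize (g h) <= B.+1)%N -> (B.+1 ^ N < #|T|)%N ->
  exists2 al : T -> K, exists h, al h != 0 & \sum_h al h *: g h = 0.
Proof.
move=> hg hT; pose C := {ffun 'I_N -> 'I_B.+1}.
pose mo (c : C) : 'X_{1..N} := [multinom (c i : nat) | i < N].
pose A : 'M[K]_(#|T|, #|C|) := \matrix_(i, j) (g (enum_val i))@_(mo (enum_val j)).
have cC : #|C| = (B.+1 ^ N)%N by rewrite card_ffun !card_ord.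
have /rowV0Pn[u /sub_kermxP uA u0] : kermx A != 0.
  rewrite -mxrank_eq0 mxrank_ker -lt0n subn_gt0.
  by apply: leq_ltn_trans (rank_leq_col _) _; rewrite cC.
have [i ui] : exists i, u 0 i != 0 by apply/rV0Pn.
exists (fun h => u 0 (enum_rank h)); first by exists (enum_val i); rewrite enum_valK.
apply/mpolyP => m; rewrite raddf_sum mcoeff0 /=.
have [/forallP hm|] := boolP [forall i, m i < B.+1]%N; last first.
  rewrite negb_forall => /existsP[l hl]; apply: big1 => h _.
  rewrite mcoeffZ (memN_msupp_eq0 (_ : m \notin msupp (g h))) ?mulr0 //.
  apply: msize_mdeg_ge; apply: leq_trans (hg h) _; move: hl; rewrite -leqNgt => hl.
  by apply: leq_trans hl _; rewrite mdegE (bigD1 l) //= leq_addr.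
pose c : C := [ffun l => Ordinal (hm l)].
have mc : mo c = m by apply/mnmP => l; rewrite mnmE ffunE.
have /rowP/(_ (enum_rank c)) := uA; rewrite !mxE => e; rewrite -[RHS]e.
rewrite (reindex (@enum_val T predT)) /=; last exact: (onW_bij _ (@enum_val_bij T)).
by apply: eq_bigr => l _; rewrite mcoeffZ enum_valK !mxE enum_rankK mc.
Qed.

End Counting.

(** * Reduced points *)

Section Configurations.
Variables (mu N nu : nat) (t : mu.-tuple 'X_{1..N}) (b : nu.-tuple 'X_{1..N}).

Definition term_values (R : comNzRingType) (X : 'M[R]_(mu, N)) s (w : s.-tuple 'X_{1..N}) :
  'M[R]_(mu, s) := \matrix_(p, j) mmap1 (X p) (tnth w j).

Lemma map_term_values (R S : comNzRingType) (sg : {rmorphism R -> S}) X s (w : s.-tuple 'X_{1..N}) :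
  map_mx sg (term_values X w) = term_values (map_mx sg X) w.
Proof.
apply/matrixP => i j; rewrite !mxE /mmap1 rmorph_prod; apply: eq_bigr => k _.
by rewrite rmorphXn mxE.
Qed.

Variable L : fieldType.

Section Values.
Variable X : 'I_mu -> 'rV[L]_N.
Definition values (g : {mpoly L[N]}) : 'cV[L]_mu := \col_p g.@[fun k => X p 0 k].
Fact values_is_linear : linear values.
Proof. by move=> c g h; apply/matrixP => i j; rewrite !mxE mevalD mevalZ. Qed.
HB.instance Definition _ := GRing.isLinear.Build L {mpoly L[N]} 'cV[L]_mu *:%R
  values values_is_linear.

Lemma values_ker g : vanishing_ideal X g <-> values g = 0.
Proof.
split=> [h|h i]; first by apply/matrixP => i j; rewrite !mxE.
by have /matrixP/(_ i 0) := h; rewrite !mxE.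
Qed.

Lemma coords_values s (w : s.-tuple 'X_{1..N}) :
  coords values (terms L w) = term_values (\matrix_(p, k) X p 0 k) w.
Proof.
apply/matrixP => i j; rewrite !mxE /terms mevalX; apply: eq_bigr => k _.
by rewrite mxE.
Qed.
End Values.

(** An invertible matrix of values forces the points to be distinct.  Hence the
    reduced points are the image of an open set of configurations of points, and
    density can be tested on configurations. *)
Lemma reduced_pointP (x : 'rV[L]_(mu * nu)) : reduced_point t b x <->
  exists2 X : 'M[L]_(mu, N), term_values X t \in unitmx
    & x = cramer_pt (term_values X t) (term_values X b).
Proof.
split=> [[X [_ [hb hc]]]|[X hX ->]].
  exists (\matrix_(p, k) X p 0 k).
    by rewrite -coords_values; apply/(basis_modP (values_ker X)).
  have /(congr_modP (values_ker X)) := hc; rewrite !coords_values => e.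
  rewrite /cramer_pt -e mulKmx ?vec_mxK // -coords_values.
  exact/(basis_modP (values_ker X)).
exists (fun p => row p X); split.
  move=> p q e; apply/eqP; apply: contraT => ne; move: hX; rewrite unitmxE.
  rewrite (determinant_alternate ne) ?unitr0 // => j; rewrite !mxE.
  by apply: eq_bigr => k _; have /rowP/(_ k) := e; rewrite !mxE => ->.
have E s (w : s.-tuple 'X_{1..N}) :
    coords (values (fun p => row p X)) (terms L w) = term_values X w.
  rewrite coords_values; suff -> : \matrix_(p, k) row p X 0 k = X by [].
  by apply/matrixP => p k; rewrite !mxE.
have ker := values_ker (fun p => row p X).
split; first by apply/(basis_modP ker); rewrite E.
by apply/(congr_modP ker); rewrite !E mxvecK mulKVmx.
Qed.

End Configurations.

(** * The principal component *)

Section Line.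
Variable L : fieldType.

(** Density statements are reduced to such lines: a polynomial in one variable
    with one nonzero value vanishes only finitely often. *)
Definition line_mx m p (X Y : 'M[L]_(m, p)) : 'M[{poly L}]_(m, p) :=
  \matrix_(i, j) ((X i j)%:P + 'X * (Y i j - X i j)%:P).

Lemma line_mx_at m p (X Y : 'M[L]_(m, p)) s :
  map_mx (horner_eval s) (line_mx X Y) = X + s *: (Y - X).
Proof. by apply/matrixP => i j; rewrite !mxE horner_evalE !hornerE. Qed.

Lemma line_mx0 m p (X Y : 'M[L]_(m, p)) : map_mx (horner_eval 0) (line_mx X Y) = X.
Proof. by rewrite line_mx_at scale0r addr0. Qed.

Lemma line_mx1 m p (X Y : 'M[L]_(m, p)) : map_mx (horner_eval 1) (line_mx X Y) = Y.
Proof. by rewrite line_mx_at scale1r addrC subrK. Qed.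

End Line.

Section Principal.
Variables (K : fieldType) (Kbar : closedFieldType) (iota : {rmorphism K -> Kbar}).
Variables (n m0 nu : nat).
Local Notation mu := m0.+1.
Variables (t : mu.-tuple 'X_{1..n.+1}) (b : nu.-tuple 'X_{1..n.+1}).
Variable IC : {mpoly K[mu * nu]} -> Prop.
Hypothesis IC_pc : is_principal_component t b iota IC.

Let IC_ideal : is_ideal IC. Proof. by case: IC_pc. Qed.

(** The component is characterised by polynomials over the algebraic closure;
    membership descends to [K]. *)
Lemma principal_vanish p : IC p <->
  forall x : 'rV[Kbar]_(mu * nu), reduced_point t b x -> evm iota x p = 0.
Proof.
have [_ _ h] := IC_pc; split=> [hp x hx|hp].
  rewrite -evmE; apply: (proj1 (h (map_mpoly iota p)) _ x hx).
  by apply: ideal_gen_mem; exists p.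
apply: (extended_ideal_descent (iota := iota)) => //; apply/h => x hx.
by rewrite -[LHS]/(ev iota p x) evmE; apply: hp.
Qed.

Lemma horner_evalC (s : Kbar) z : horner_eval s (iota z)%:P = iota z.
Proof. by rewrite horner_evalE hornerC. Qed.

Let tauP : {rmorphism K -> {poly Kbar}} := (@polyC Kbar) \o iota.

Lemma unitmx_detP m (M : 'M[Kbar]_m) : (M \in unitmx) = (\det M != 0).
Proof. by rewrite unitmxE unitfE. Qed.

Section AlongPath.
Variables (M : 'M[{poly Kbar}]_mu) (Nm : 'M[{poly Kbar}]_(mu, nu)) (p : {mpoly K[mu * nu]}).
Definition path_num : {poly Kbar} := cramer_num tauP (msize p) M Nm p.

Lemma path_num_at s : map_mx (horner_eval s) M \in unitmx ->
  path_num.[s] = (\det M).[s] ^+ msize p *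
    evm iota (cramer_pt (map_mx (horner_eval s) M) (map_mx (horner_eval s) Nm)) p.
Proof.
move=> hM; rewrite -[LHS]/(horner_eval s _) (@cramer_num_morph _ _ _ _ _ _ _ iota).
  by rewrite cramer_num_pt // det_map_mx.
by move=> z; apply: horner_evalC.
Qed.
End AlongPath.

Lemma det_path_at (M : 'M[{poly Kbar}]_mu) s :
  (map_mx (horner_eval s) M \in unitmx) = ((\det M).[s] != 0).
Proof. by rewrite unitmx_detP det_map_mx. Qed.

(** Join a configuration at which one function does not vanish to one for the
    other function: a general configuration on the line gives a reduced point at
    which neither of them vanishes. *)
Lemma principal_mul p q : IC (p * q) -> IC p \/ IC q.
Proof.
move=> hpq; apply: NNPP => /not_or_and[hp hq].
have ex r : ~ IC r -> exists2 X : 'M[Kbar]_(mu, n.+1), term_values X t \in unitmx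
    & evm iota (cramer_pt (term_values X t) (term_values X b)) r != 0.
  move=> hr; apply: NNPP => h; apply: hr; apply/principal_vanish => x.
  case/reduced_pointP => X hX ->; apply/eqP; apply: contraT => ne.
  by case: h; exists X.
have [X hX pX] := ex p hp; have [Y hY qY] := ex q hq.
pose M := term_values (line_mx X Y) t; pose Nm := term_values (line_mx X Y) b.
have at0 s (w : s.-tuple _) : map_mx (horner_eval 0) (term_values (line_mx X Y) w) = term_values X w.
  by rewrite map_term_values line_mx0.
have at1 s (w : s.-tuple _) : map_mx (horner_eval 1) (term_values (line_mx X Y) w) = term_values Y w.
  by rewrite map_term_values line_mx1.
have nz0 (f : {poly Kbar}) s : f.[s] != 0 -> f != 0.
  by apply: contraNneq => ->; rewrite horner0.
have d0 : \det M != 0 by apply: (nz0 _ 0); rewrite -det_path_at at0.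
have p0 : path_num M Nm p != 0.
  apply: (nz0 _ 0); rewrite path_num_at /M /Nm !at0 // mulf_neq0 // expf_neq0 //.
  by rewrite -det_path_at at0.
have q0 : path_num M Nm q != 0.
  apply: (nz0 _ 1); rewrite path_num_at /M /Nm !at1 // mulf_neq0 // expf_neq0 //.
  by rewrite -det_path_at at1.
have /closed_nonrootP[s] : \det M * path_num M Nm p * path_num M Nm q != 0.
  by rewrite !mulf_neq0.
rewrite rootE !hornerM !mulf_eq0 !negb_or -det_path_at => /andP[/andP[hM]].
rewrite !path_num_at // !mulf_eq0 !negb_or => /andP[_ pn] /andP[_ qn].
have red : reduced_point t b (cramer_pt (map_mx (horner_eval s) M) (map_mx (horner_eval s) Nm)).
  apply/reduced_pointP; exists (map_mx (horner_eval s) (line_mx X Y)).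
    by rewrite -map_term_values.
  by rewrite -!map_term_values.
have /principal_vanish/(_ _ red)/eqP := hpq.
by rewrite rmorphM /= mulf_eq0 (negPf pn) (negPf qn).
Qed.

Section Chart.
Variable ell : 'I_n.+1 -> Kbar.
Let li := (ell ord_max)^-1.
Local Notation chM c := (chart_M t ell li c).
Local Notation chN c := (chart_N b ell li c).
Local Notation chpt c := (cramer_pt (chM c) (chN c)).

Lemma prod_roots_rel (R : comNzRingType) (r : 'I_mu -> R) i :
  r i ^+ mu = \sum_(j < mu) - (\prod_i ('X - (r i)%:P))`_j * r i ^+ j.
Proof.
set P := \prod_i _.
have szP : size P = mu.+1 by rewrite size_prod_XsubC /index_enum -enumT size_enum_ord.
have topP : P`_mu = 1.
  have /monicP : P \is monic by apply: monic_prod_XsubC.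
  by rewrite lead_coefE szP.
have : P.[r i] = 0 by rewrite /P (bigD1 i) //= hornerM hornerXsubC subrr mul0r.
rewrite horner_coef szP big_ord_recr /= topP mul1r => /eqP; rewrite addrC addr_eq0 => /eqP ->.
by rewrite -sumrN; apply: eq_bigr => j _; rewrite mulNr.
Qed.

(** The matrix of values at the points above the roots is a Vandermonde matrix
    times the chart matrix. *)
Lemma chart_reduced (c : 'M[Kbar]_(n.+1, mu)) (r : 'I_mu -> Kbar) : injective r ->
    (forall i, r i ^+ mu = \sum_j c ord_max j * r i ^+ j) ->
  chM c \in unitmx -> reduced_point t b (chpt c).
Proof.
move=> injr hr hM; apply/reduced_pointP.
pose X := \matrix_(p, k) root_point ell li c (r p) k.
pose V : 'M[Kbar]_mu := \matrix_(p, j) r p ^+ j.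
have VE s (w : s.-tuple _) : term_values X w = V *m term_cols (shape_mx ell li c) (e0 Kbar m0) w.
  apply/row_matrixP => p; rewrite row_mul.
  have -> : row p V = pow_row m0 (r p) by apply/rowP => j; rewrite !mxE.
  rewrite (pow_row_term_cols ell li (hr p)); apply/rowP => j; rewrite !mxE.
  by apply: eq_bigr => k _; rewrite mxE.
have hV : V \in unitmx.
  have -> : V = (Vandermonde mu (\row_j r j))^T by apply/matrixP => p j; rewrite !mxE.
  rewrite unitmx_tr unitmx_detP det_Vandermonde.
  apply/prodf_neq0 => i _; apply/prodf_neq0 => j lt; rewrite !mxE subr_eq0.
  by apply: contraTneq lt => /injr ->; rewrite ltnn.
exists X; first by rewrite VE unitmx_mul hV.
rewrite /cramer_pt !VE; congr mxvec; apply: (can_inj (mulKmx hM)); rewrite mulKVmx //.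
apply: (can_inj (mulKmx hV)); rewrite mulmxA mulmxA mulmxV ?mul1mx //.
by rewrite unitmx_mul hV.
Qed.

Section Path.
Variable cp : 'M[{poly Kbar}]_(n.+1, mu).
Definition path_M : 'M[{poly Kbar}]_mu := chart_M t (fun i => (ell i)%:P) li%:P cp.
Definition path_N : 'M[{poly Kbar}]_(mu, nu) := chart_N b (fun i => (ell i)%:P) li%:P cp.

Let ell_at s : (fun i => horner_eval s (ell i)%:P) =1 ell.
Proof. by move=> i; rewrite horner_evalE hornerC. Qed.
Let li_at s : horner_eval s li%:P = li. Proof. by rewrite horner_evalE hornerC. Qed.

Lemma path_M_at s : map_mx (horner_eval s) path_M = chM (map_mx (horner_eval s) cp).
Proof. by rewrite map_chart_M /chart_M (eq_term_cols _ _ _ _ (ell_at s)) /= li_at. Qed.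

Lemma path_N_at s : map_mx (horner_eval s) path_N = chN (map_mx (horner_eval s) cp).
Proof. by rewrite map_chart_N /chart_N (eq_term_cols _ _ _ _ (ell_at s)) /= li_at. Qed.
End Path.

(** Move the roots of the polynomial along a line towards distinct ones: almost
    all points of this path in the chart are reduced. *)
Lemma principal_chart p (c : 'M[Kbar]_(n.+1, mu)) : IC p -> chM c \in unitmx ->
  evm iota (chpt c) p = 0.
Proof.
move=> hp hM.
pose chi : {poly Kbar} := 'X^mu - \poly_(j < mu) c ord_max (inord j).
have szchi : size chi = mu.+1.
  by rewrite /chi size_polyDl ?size_polyXn // size_polyN ltnS size_poly.
have mchi : lead_coef chi = 1.
  by rewrite lead_coefE szchi coefB coefXn eqxx coef_poly ltnn subr0.
have [rs ers] := closed_field_poly_normal chi; rewrite mchi scale1r in ers.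
have szr : size rs = mu by apply: succn_inj; rewrite -szchi ers size_prod_XsubC.
pose r (i : 'I_mu) := rs`_i.
have chiE : \prod_(i < mu) ('X - (r i)%:P) = chi.
  by rewrite ers [RHS](big_nth 0) szr big_mkord.
have cE j : c ord_max j = - chi`_j.
  by rewrite coefB coefXn coef_poly ltn_ord inord_val (ltn_eqF (ltn_ord j)) sub0r opprK.
have [r1 injr1] := distinct_elements Kbar mu.
(* rp moves the roots r to the distinct elements r1; all rows of c but the last
   one stay fixed *)
pose rp (i : 'I_mu) : {poly Kbar} := (r i)%:P + 'X * (r1 i - r i)%:P.
pose cp : 'M[{poly Kbar}]_(n.+1, mu) := \matrix_(k, j)
  if k == ord_max then - (\prod_i ('X - (rp i)%:P))`_j else (c k j)%:P.
have rp_at s i : (rp i).[s] = r i + s * (r1 i - r i) by rewrite !hornerE.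
have cp_at s : map_mx (horner_eval s) cp = \matrix_(k, j)
    if k == ord_max then - (\prod_i ('X - ((rp i).[s])%:P))`_j else c k j.
  apply/matrixP => k j; rewrite !mxE; case: ifP => _; last by rewrite horner_evalE hornerC.
  rewrite raddfN -coef_map; set q := \prod_i _; set q' := \prod_i _.
  suff -> : map_poly (horner_eval s) q = q' by []; rewrite /q rmorph_prod; apply: eq_bigr => i _.
  by rewrite /= map_polyXsubC.
have cp0 : map_mx (horner_eval 0) cp = c.
  rewrite cp_at; apply/matrixP => k j; rewrite mxE; case: eqP => // ->.
  rewrite cE -chiE; set q := \prod_i _; set q' := \prod_(i < mu) _.
  suff -> : q = q' by []; apply: eq_bigr => i _.
  by rewrite rp_at mul0r addr0.
pose M := path_M cp; pose Nm := path_N cp.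
have M_at s : map_mx (horner_eval s) M = chM (map_mx (horner_eval s) cp) := path_M_at cp s.
have N_at s : map_mx (horner_eval s) Nm = chN (map_mx (horner_eval s) cp) := path_N_at cp s.
pose disc : {poly Kbar} := \prod_(z : 'I_mu * 'I_mu | z.1 != z.2) (rp z.1 - rp z.2).
have disc0 : disc != 0.
  apply/prodf_neq0 => -[i j] /= ne; apply: contraNneq ne => /(congr1 (horner_eval 1)).
  rewrite raddfB raddf0 /= !horner_evalE !rp_at !mul1r !addrA ![_ + r1 _]addrC !addrK.
  by move/eqP; rewrite subr_eq0 => /eqP/injr1 ->.
have dM0 : (\det M).[0] != 0 by rewrite -det_path_at M_at cp0.
have dM : \det M != 0 by apply: contraNneq dM0 => ->; rewrite horner0.
have num0 : path_num M Nm p = 0.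
  apply: (@poly_eq0_generic _ _ (\det M * disc)); first by rewrite mulf_neq0.
  move=> s; rewrite hornerM mulf_eq0 negb_or -det_path_at => /andP[hMs ds].
  rewrite path_num_at //; apply/eqP; rewrite mulf_eq0; apply/orP; right; apply/eqP.
  rewrite M_at N_at; move: hMs; rewrite M_at => hMs.
  have /principal_vanish := hp; apply.
  apply: (chart_reduced (r := fun i => (rp i).[s])) => // [i j e|i].
    apply/eqP; apply: contraT => ne; move: ds; rewrite /disc horner_prod.
    by rewrite (bigD1 (i, j)) //= hornerD hornerN e subrr mul0r eqxx.
  rewrite (@prod_roots_rel _ (fun i => (rp i).[s]) i); apply: eq_bigr => j _.
  by rewrite cp_at mxE eqxx.
have := @path_num_at M Nm p 0; rewrite num0 horner0 M_at N_at cp0 => /(_ hM)/esym/eqP.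
by rewrite mulf_eq0 expf_eq0 (negPf dM0) andbF => /eqP.
Qed.

End Chart.
End Principal.

(** * The chart as an isomorphism of varieties *)

Section MainChart.
Variables (K : fieldType) (Kbar : closedFieldType) (iota : {rmorphism K -> Kbar}).
Variables (n m0 nu : nat).
Local Notation mu := m0.+1.
Local Notation D := (n.+1 * mu)%N.
Variables (t : mu.-tuple 'X_{1..n.+1}) (b : nu.-tuple 'X_{1..n.+1}).
Hypotheses (t_oi : is_order_ideal t) (b_bd : is_border t b).
Variable i1 : 'I_mu.
Hypothesis t_i1 : tnth t i1 = 0%MM.
Variable IC : {mpoly K[mu * nu]} -> Prop.
Hypothesis IC_pc : is_principal_component t b iota IC.
Variable ell : 'I_n.+1 -> K.
Hypothesis ell_last : ell ord_max != 0.
Variable c0 : 'M[K]_(n.+1, mu).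

Let li := (ell ord_max)^-1.
Let ellb i := iota (ell i).
Let lib := (ellb ord_max)^-1.
Let ellb_last : ellb ord_max != 0. Proof. by rewrite /ellb fmorph_eq0. Qed.
Let libE : lib = iota li. Proof. by rewrite /lib /ellb fmorphV. Qed.
Let lib_ell : lib * ellb ord_max = 1. Proof. by rewrite /lib mulVf. Qed.
Let IC_ideal : is_ideal IC. Proof. by case: IC_pc. Qed.

(** The parameter space is centred at the given ideal, with matrix [c0]. *)
Definition cpt (d : 'rV[Kbar]_D) : 'M[Kbar]_(n.+1, mu) := map_mx iota c0 + vec_mx d.
Let M d := chart_M t ellb lib (cpt d).
Let Nm d := chart_N b ellb lib (cpt d).
Definition chart_dom (d : 'rV[Kbar]_D) : Prop := M d \in unitmx.
Definition chart_map (d : 'rV[Kbar]_D) : 'rV[Kbar]_(mu * nu) := chart_pt t b ellb (cpt d).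
Definition chart_inv (x : 'rV[Kbar]_(mu * nu)) : 'rV[Kbar]_D :=
  mxvec (chart_coords t b i1 ellb x - map_mx iota c0).

Let mapE d : chart_map d = cramer_pt (M d) (Nm d). Proof. by []. Qed.

Let cC N : {rmorphism K -> {mpoly K[N]}} := @mpolyC N K.
Let cgen : 'M[{mpoly K[D]}]_(n.+1, mu) := map_mx (cC D) c0 + generic_matrix n.+1 mu K.
(** The chart at indeterminate coefficients, whence its equations over [K]. *)
Definition gen_M := chart_M t (fun i => cC D (ell i)) (cC D li) cgen.
Definition gen_N := chart_N b (fun i => cC D (ell i)) (cC D li) cgen.

Lemma evm_C N (x : 'rV[Kbar]_N) z : evm iota x (cC N z) = iota z.
Proof. exact: mmapC. Qed.

Lemma map_generic r s (x : 'rV[Kbar]_(r * s)) :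
  map_mx (evm iota x) (generic_matrix r s K) = vec_mx x.
Proof.
by rewrite map_generic_matrix; apply/matrixP => i j; rewrite !mxE.
Qed.

Let map_cgen d : map_mx (evm iota d) cgen = cpt d.
Proof.
rewrite /cgen map_mxD map_generic; congr (_ + _).
by apply/matrixP => i j; rewrite !mxE; apply: evm_C.
Qed.

Lemma map_gen_M d : map_mx (evm iota d) gen_M = M d.
Proof.
rewrite map_chart_M map_cgen /M /chart_M.
rewrite (eq_term_cols (ell' := ellb)) => [|i]; last exact: evm_C.
set z := (X in shape_mx _ X _); suff -> : z = lib by [].
by rewrite libE; apply: evm_C.
Qed.

Lemma map_gen_N d : map_mx (evm iota d) gen_N = Nm d.
Proof.
rewrite map_chart_N map_cgen /Nm /chart_N.
rewrite (eq_term_cols (ell' := ellb)) => [|i]; last exact: evm_C.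
set z := (X in shape_mx _ X _); suff -> : z = lib by [].
by rewrite libE; apply: evm_C.
Qed.

Lemma chart_domP d : chart_dom d <-> ev iota (\det gen_M) d != 0.
Proof. by rewrite evmE -det_map_mx map_gen_M -unitmx_detP. Qed.

Lemma chart_dom_open : open_in iota (fun _ => True) chart_dom.
Proof.
exists (fun g => g = \det gen_M) => d; rewrite chart_domP; split=> [h|[_ [_ -> //]]].
by split=> //; exists (\det gen_M).
Qed.

Lemma chart_map_regular k : regular_on iota chart_dom (fun d => chart_map d 0 k).
Proof.
move=> d0 hd0; exists (mxvec (\adj gen_M *m gen_N) 0 k), (\det gen_M).
split; first by apply/chart_domP.
move=> d hd ne; have hM : M d \in unitmx by [].
rewrite !evmE -det_map_mx map_gen_M.
have -> : evm iota d (mxvec (\adj gen_M *m gen_N) 0 k) = mxvec (\adj (M d) *m Nm d) 0 k.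
  by rewrite -map_gen_M -map_gen_N -map_mx_adj -map_mxM -map_mxvec [RHS]mxE.
rewrite mapE /cramer_pt /invmx hM -scalemxAl linearZ /= [LHS]mxE mulrC.
by [].
Qed.

Let ygen := generic_matrix mu nu K.
Definition gen_Q := power_cols t b i1 (fun i => cC _ (ell i)) ygen.
Definition gen_target k := target t b i1 (fun i => cC _ (ell i)) ygen k.
(** The numerators of the inverse of the chart, over the common denominator
    [\det gen_Q]. *)
Definition gen_num : 'rV[{mpoly K[mu * nu]}]_D :=
  mxvec (\matrix_(k, j) ((\adj gen_Q *m gen_target k) j 0 - \det gen_Q * cC _ (c0 k j))).

Lemma power_cols_ext (R : comNzRingType) (e e' : 'I_n.+1 -> R) (y : 'M[R]_(mu, nu)) :
  e =1 e' -> power_cols t b i1 e y = power_cols t b i1 e' y.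
Proof.
move=> h; rewrite /power_cols; suff -> : ell_mult t b e y = ell_mult t b e' y by [].
by apply: eq_bigr => k _; rewrite h.
Qed.

Lemma target_ext (R : comNzRingType) (e e' : 'I_n.+1 -> R) (y : 'M[R]_(mu, nu)) k :
  e =1 e' -> target t b i1 e y k = target t b i1 e' y k.
Proof.
move=> h; rewrite /target; suff -> : ell_mult t b e y = ell_mult t b e' y by [].
by apply: eq_bigr => i _; rewrite h.
Qed.

Section AnyRing.
Variables (R : comNzRingType) (tau : {rmorphism K -> R}) (y : 'rV[R]_(mu * nu)).
Let sg : {rmorphism {mpoly K[mu * nu]} -> R} := mmap tau (fun i => y 0 i).
Let ellR i := tau (ell i).

Let sgC z : sg (cC _ z) = tau z. Proof. exact: mmapC. Qed.
Let sg_ygen : map_mx sg ygen = vec_mx y.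
Proof. by rewrite map_generic_matrix; apply/matrixP => i j; rewrite !mxE. Qed.

Lemma map_gen_Q : map_mx sg gen_Q = power_cols t b i1 ellR (vec_mx y).
Proof. by rewrite map_power_cols sg_ygen; apply: power_cols_ext => i; rewrite sgC. Qed.

Lemma map_gen_target k : map_mx sg (gen_target k) = target t b i1 ellR (vec_mx y) k.
Proof. by rewrite map_target sg_ygen; apply: target_ext => i; rewrite sgC. Qed.

Lemma map_gen_num : map_mx sg gen_num = mxvec (\matrix_(k, j)
  ((\adj (power_cols t b i1 ellR (vec_mx y)) *m target t b i1 ellR (vec_mx y) k) j 0
   - \det (power_cols t b i1 ellR (vec_mx y)) * tau (c0 k j))).
Proof.
rewrite map_mxvec; congr mxvec; apply/matrixP => k j.
rewrite [LHS]mxE [in LHS]mxE [RHS]mxE rmorphB rmorphM sgC -det_map_mx map_gen_Q.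
by rewrite -map_gen_Q -map_gen_target -map_mx_adj -map_mxM [in RHS]mxE.
Qed.

(** The formula for the inverse, with its denominator cleared; over the dual
    numbers it contains the derivative of the inverse. *)
Lemma gen_num_chart (liR : R) c : liR * ellR ord_max = 1 ->
    chart_M t ellR liR c *m vec_mx y = chart_N b ellR liR c ->
  map_mx sg gen_num = mmap tau (fun i => y 0 i) (\det gen_Q) *: mxvec (c - map_mx tau c0).
Proof.
move=> hl hy; rewrite map_gen_num -linearZ /=; congr mxvec; apply/matrixP => k j.
rewrite [LHS]mxE -(power_cols_target t_oi b_bd t_i1 hl hy) // mulmxA mul_adj_mx mul_scalar_mx.
have -> : mmap tau (fun i => y 0 i) (\det gen_Q) = \det (power_cols t b i1 ellR (vec_mx y)).
  by rewrite -map_gen_Q det_map_mx.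
by rewrite !mxE mulrBr.
Qed.

End AnyRing.

Lemma gen_Q_at x : evm iota x (\det gen_Q) = \det (power_cols t b i1 ellb (vec_mx x)).
Proof. by rewrite -det_map_mx [X in \det X](map_gen_Q iota x). Qed.

Lemma gen_num_at x k : power_cols t b i1 ellb (vec_mx x) \in unitmx ->
  evm iota x (gen_num 0 k) = evm iota x (\det gen_Q) * chart_inv x 0 k.
Proof.
move=> hQ; have /rowP/(_ k) := map_gen_num iota x; rewrite [LHS]mxE => ->.
rewrite gen_Q_at /chart_inv.
transitivity ((\det (power_cols t b i1 ellb (vec_mx x)) *:
   mxvec (chart_coords t b i1 ellb x - map_mx iota c0)) 0 k); last by rewrite mxE.
rewrite -linearZ /=; congr (mxvec _ 0 k); apply/matrixP => i j.
rewrite [LHS]mxE; set Q := power_cols _ _ _ _ _ in hQ *; set tg := target _ _ _ _ _ i.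
have E : \adj Q *m tg = \det Q *: (invmx Q *m tg).
  by rewrite /invmx hQ scalemxAl scalerA mulfV ?scale1r // -unitmx_detP.
by rewrite E !mxE mulrBr.
Qed.

Let zero_scheme x : zero_locus iota IC x -> comm_at t b (vec_mx x).
Proof.
by move=> hx; apply/(scheme_points t b iota) => p hp; apply: hx; case: IC_pc => _ h _; apply: h.
Qed.

Lemma basis_locusP x : basis_locus iota t b ell x <->
  comm_at t b (vec_mx x) /\ power_cols t b i1 ellb (vec_mx x) \in unitmx.
Proof.
rewrite /basis_locus scheme_points; split=> -[hc hb]; split=> //.
  exact/(fiber_powers_basisP t_oi b_bd t_i1 ellb hc).
exact/(fiber_powers_basisP t_oi b_bd t_i1 ellb hc).
Qed.

Definition chart_codom x : Prop := basis_locus iota t b ell x /\ zero_locus iota IC x.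

Lemma chart_codomP x : chart_codom x <->
  zero_locus iota IC x /\ ev iota (\det gen_Q) x != 0.
Proof.
rewrite /chart_codom basis_locusP evmE gen_Q_at -unitmx_detP.
split=> [[[_ hQ] hx]|[hx hQ]] //; split=> //; split=> //.
exact: zero_scheme.
Qed.

Lemma chart_codom_open : open_in iota (zero_locus iota IC) chart_codom.
Proof.
exists (fun g => g = \det gen_Q) => x; rewrite chart_codomP; split=> [[hx h]|[hx [_ -> //]]].
by split=> //; exists (\det gen_Q).
Qed.

Lemma chart_mapK d : chart_dom d -> chart_inv (chart_map d) = d.
Proof.
move=> hd; have hM := chart_ptE b hd.
rewrite /chart_inv (chart_coordsK t_oi b_bd t_i1 ellb_last hM) /cpt addrC addKr.
exact: vec_mxK.
Qed.

Lemma chart_map_locus d : chart_dom d -> zero_locus iota IC (chart_map d).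
Proof. by move=> hd p hp; rewrite evmE; exact: (principal_chart IC_pc hp hd). Qed.

Lemma chart_map_codom d : chart_dom d -> chart_codom (chart_map d).
Proof.
move=> hd; have hM := chart_ptE b hd; split; last exact: chart_map_locus.
apply/basis_locusP; split; first exact: (chart_comm t_oi b_bd (ell := ellb) hd hM).
by have [] := mulmx1_unit (chart_power_cols t_oi b_bd t_i1 lib_ell hM).
Qed.

Lemma chart_invK x : chart_codom x -> chart_dom (chart_inv x) /\ chart_map (chart_inv x) = x.
Proof.
move=> [/basis_locusP[hc hQ] hx].
have := chart_coords_corresponds t_oi b_bd t_i1 ellb_last hc hQ.
have e : cpt (chart_inv x) = chart_coords t b i1 ellb x.
  by rewrite /cpt /chart_inv mxvecK addrC subrK.
rewrite -e => /(corresponds_chartP _ _ ellb_last)[hM hx']; split=> //.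
by rewrite mapE /cramer_pt /Nm /lib -hx' mulKmx ?vec_mxK.
Qed.

Lemma chart_inv_regular k : regular_on iota chart_codom (fun x => chart_inv x 0 k).
Proof.
move=> x0 /chart_codomP[_ h0]; exists (gen_num 0 k), (\det gen_Q); split=> // x hx ne.
have /chart_codomP[_ hq] := hx; rewrite !evmE in hq ne *.
have hQ : power_cols t b i1 ellb (vec_mx x) \in unitmx by rewrite unitmx_detP -gen_Q_at.
by rewrite gen_num_at // [_ * chart_inv x 0 k]mulrC mulfK.
Qed.

(** Both directions are given by coordinates of polynomials with respect to the
    two bases, so they are regular and mutually inverse. *)
Theorem chart_isomorphism : is_isomorphism iota chart_dom chart_codom chart_map.
Proof.
split; first by split; [exact: chart_map_codom|exact: chart_map_regular].
exists chart_inv; split; first split.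
- by move=> x /chart_invK[].
- exact: chart_inv_regular.
- exact: chart_mapK.
- by move=> x /chart_invK[].
Qed.

Hypothesis dom0 : chart_dom 0.

Lemma principal_prime : prime_ideal IC.
Proof.
split=> //; last exact: (principal_mul IC_pc).
move=> h1; have := chart_map_locus dom0 h1.
by rewrite evmE rmorph1 => /eqP; rewrite oner_eq0.
Qed.

Lemma principal_rational : is_rational iota IC.
Proof.
split; first exact: principal_prime.
exists D, chart_dom, chart_codom, chart_map; split.
- exact: chart_dom_open.
- by exists 0.
- exact: chart_codom_open.
- by exists (chart_map 0); apply: chart_map_codom.
- exact: chart_isomorphism.
Qed.

(** A function that vanishes on the chart vanishes at all reduced points once it
    is multiplied by [\det gen_Q], and the latter is not zero on the chart. *)
Lemma principal_dense p : (forall d, chart_dom d -> evm iota (chart_map d) p = 0) -> IC p.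
Proof.
move=> h; have [_ _ hpr] := principal_prime.
have /hpr[//|hq] : IC (p * \det gen_Q).
  apply/(principal_vanish IC_pc) => x hx; rewrite rmorphM /=; apply/eqP; rewrite mulf_eq0.
  have [_|nq] := eqVneq (evm iota x (\det gen_Q)) 0; first by rewrite orbT.
  have /chart_invK[hd <-] : chart_codom x; last by rewrite orbF h.
  apply/chart_codomP; rewrite evmE; split=> // q hq.
  by rewrite evmE; move/(principal_vanish IC_pc): hq; apply.
have /chart_codomP[_] := chart_map_codom dom0.
by rewrite (chart_map_locus dom0 hq) eqxx.
Qed.

(** * Dimension *)

Lemma evm_comp N m (x : 'rV[Kbar]_N) (Q : {mpoly K[m]}) (z : m.-tuple {mpoly K[N]}) :
  evm iota x (Q \mPo z) = mmap iota (fun i => evm iota x (tnth z i)) Q.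
Proof.
rewrite /evm /comp_mpoly mmap_morph; apply: eq_mmap => // c.
exact: mmapC.
Qed.

Let line (d u : 'rV[Kbar]_D) := line_mx (cpt d) (cpt (d + u)).
Let line_at d u s : map_mx (horner_eval s) (line d u) = cpt (d + s *: u).
Proof.
by rewrite line_mx_at /cpt; apply/matrixP => i j; rewrite !mxE; ring.
Qed.
Let line_M (d u : 'rV[Kbar]_D) := path_M t ellb (line d u).
Let line_N (d u : 'rV[Kbar]_D) := path_N b ellb (line d u).

Lemma line_dom d u s : (\det (line_M d u)).[s] != 0 <-> chart_dom (d + s *: u).
Proof. by rewrite -det_path_at path_M_at line_at. Qed.

Lemma line_det0 d u : chart_dom d -> \det (line_M d u) != 0.
Proof.
move=> hd; apply/eqP => e.
suff /line_dom : chart_dom (d + 0 *: u) by rewrite e horner0 eqxx.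
by rewrite scale0r addr0.
Qed.

Lemma gen_num_map d k : chart_dom d ->
  evm iota (chart_map d) (gen_num 0 k) = (\det (M d))^-1 * d 0 k.
Proof.
move=> hd; have hM := chart_ptE b hd.
have hQ := chart_power_cols t_oi b_bd t_i1 lib_ell hM.
rewrite gen_num_at ?chart_mapK ?gen_Q_at //.
  congr (_ * _); apply: (mulfI (_ : \det (M d) != 0)); first by rewrite -unitmx_detP.
  by rewrite -det_mulmx hQ det1 mulfV // -unitmx_detP.
by have [] := mulmx1_unit hQ.
Qed.

(** The numerators of the inverse of the chart take the value [s u / delta(s)]
    at the image of [s u], where [delta 0] is not zero: on each line through the
    origin of the target infinitely many points are reached.  Here [delta (s)] is
    the determinant of the chart matrix at [s u]. *)
Lemma gen_num_independent : algebraically_independent_mod IC (fun k => gen_num 0 k).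
Proof.
move=> Q hQ; apply: (mpoly_eq0_of_ev (iota := iota)) => u.
pose g : {poly Kbar} := mmap (fun z => (iota z)%:P) (fun k => 'X * (u 0 k)%:P) Q.
have g_at w : g.[w] = evm iota (w *: u) Q.
  rewrite -[LHS]/(horner_eval w g) /g.
  rewrite -[mmap _]/(mmap ((@polyC Kbar) \o iota)) mmap_morph.
  by apply: eq_mmap => [z|k]; rewrite /= horner_evalE ?mxE !hornerE.
suff g0 : g = 0 by have := g_at 1; rewrite g0 horner0 scale1r.
apply/eqP; apply: contraT => gn0.
pose de := \det (line_M 0 u).
have de0 : de.[0] != 0 by apply/line_dom; rewrite scale0r addr0.
have groot s : de.[s] != 0 -> root g (s / de.[s]).
  move=> hs; have /line_dom := hs; rewrite add0r => hd; apply/rootP.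
  rewrite g_at; have := chart_map_locus hd hQ; rewrite evmE evm_comp => e.
  rewrite -[RHS]e; apply: eq_mmap => // k; rewrite tnth_mktuple gen_num_map // mxE.
  rewrite [in RHS]mxE mulrA; congr (_ * _).
  rewrite mulrC; congr (_^-1 * _); rewrite /de -[LHS]/(horner_eval s _) -det_map_mx.
  by rewrite path_M_at line_at add0r.
have [rs ers] := closed_field_poly_normal g.
(* if g is not zero, then s / de (s) stays among the finitely many roots of g,
   so that one of the factors of h vanishes identically *)
pose h : {poly Kbar} := \prod_(z <- rs) ('X - z *: de).
have h0 : h = 0.
  apply: (@poly_eq0_generic _ _ de); first by apply: contraNneq de0 => ->; rewrite horner0.
  move=> s hs; have := groot s hs; rewrite ers rootZ ?lead_coef_eq0 // root_prod_XsubC => hz.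
  apply/eqP; rewrite /h horner_prod; apply/eqP; rewrite (big_rem _ hz) /=.
  by rewrite hornerD hornerN hornerZ hornerX divfK // subrr mul0r.
have : h == 0 by rewrite h0.
rewrite prodf_seq_eq0 => /hasP[z _ /=]; rewrite subr_eq0 => /eqP e.
have := congr1 (horner_eval 0) e; rewrite !horner_evalE hornerX hornerZ => /esym/eqP.
rewrite mulf_eq0 (negPf de0) orbF => /eqP z0.
by move/eqP: e; rewrite z0 scale0r polyX_eq0.
Qed.

(** * Tangent spaces *)

(** Restriction of a path to first order at its origin. *)
Let etaR : {rmorphism {poly Kbar} -> dual Kbar} :=
  horner_eval (deps Kbar) \o map_poly (@dinj Kbar).

Let etaE (p : {poly Kbar}) : etaR p = (p.[0], p^`().[0]).
Proof.
elim/poly_ind: p => [|p c IH]; first by rewrite raddf0 deriv0 !horner0.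
rewrite rmorphD rmorphM IH /= !horner_evalE map_polyX map_polyC hornerX hornerC.
rewrite derivD derivM derivC derivX !hornerE /=.
by congr (_, _); rewrite /= ?mulr0 ?mul0r ?addr0 ?add0r ?mulr1.
Qed.

Let tauD : {rmorphism K -> dual Kbar} := (@dinj Kbar) \o iota.

Lemma line_num0 d u p : chart_dom d -> IC p -> path_num iota (line_M d u) (line_N d u) p = 0.
Proof.
move=> hd hp; apply: (poly_eq0_generic (line_det0 u hd)) => s hs.
have hM : map_mx (horner_eval s) (line_M d u) \in unitmx by rewrite det_path_at.
rewrite path_num_at //; move: hM; rewrite path_M_at path_N_at => hM.
by rewrite (principal_chart IC_pc hp hM) mulr0.
Qed.

(** First order: the chart over the dual numbers. The functions in [IC] vanish
    along the deformation, and the inverse of the chart recovers the direction. *)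
Lemma tangent_vector (d u : 'rV[Kbar]_D) : chart_dom d -> exists v : 'rV[Kbar]_(mu * nu),
  (forall p, IC p -> \sum_k v 0 k * evm iota (chart_map d) (mderiv k p) = 0) /\
  (forall k, \sum_j v 0 j * (evm iota (chart_map d) (mderiv j (gen_num 0 k))
       - d 0 k * evm iota (chart_map d) (mderiv j (\det gen_Q))) =
     evm iota (chart_map d) (\det gen_Q) * u 0 k).
Proof.
move=> hd; set Ml := line_M d u; set Nl := line_N d u.
have de0 : (\det Ml).[0] != 0 by apply/line_dom; rewrite scale0r addr0.
pose Me := map_mx etaR Ml; pose Ne := map_mx etaR Nl.
have detE : \det Me = etaR (\det Ml) by rewrite det_map_mx.
(* the inverse of the dual number \det Me *)
pose w : dual Kbar := ((\det Ml).[0]^-1, - (\det Ml)^`().[0] / (\det Ml).[0] ^+ 2).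
have wdet : w * \det Me = 1.
  rewrite detE etaE; apply: dual_eqP; first by rewrite /dfst /= mulVf.
  by rewrite dsndM /dfst /dsnd /=; field.
pose y : 'rV[dual Kbar]_(mu * nu) := mxvec (w *: (\adj Me *m Ne)).
have hy : Me *m vec_mx y = Ne.
  by rewrite mxvecK -scalemxAr mulmxA mul_mx_adj mul_scalar_mx scalerA wdet scale1r.
have regl (a : dual Kbar) k : \det Me ^+ k * a = 0 -> a = 0.
  by move=> e; rewrite -[a]mul1r -(expr1n _ k) -wdet exprMn -mulrA e mulr0.
have dfst_eta : (fun p => dfst (etaR p)) =1 horner_eval 0.
  by move=> p; rewrite etaE.
have fstM (r s : nat) (X : 'M[{poly Kbar}]_(r, s)) :
    map_mx (@dfst Kbar) (map_mx etaR X) = map_mx (horner_eval 0) X.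
  by apply/matrixP => i j; rewrite !mxE; apply: dfst_eta.
have fst_y : map_mx (@dfst Kbar) y = chart_map d.
  have : M d *m map_mx (@dfst Kbar) (vec_mx y) = Nm d.
    have := congr1 (map_mx (@dfst Kbar)) hy.
    by rewrite map_mxM !fstM path_M_at path_N_at line_at scale0r addr0.
  move=> e; rewrite mapE /cramer_pt -e mulKmx // -map_mxvec vec_mxK.
  by [].
have fst_yk k : dfst (y 0 k) = chart_map d 0 k by rewrite -fst_y mxE.
have evy p : mmap iota (fun i => dfst (y 0 i)) p = evm iota (chart_map d) p.
  by apply: eq_mmap.
have vanish p : IC p -> mmap tauD (fun i => y 0 i) p = 0.
  move=> hp; apply: (regl _ (msize p)).
  rewrite -(cramer_numE tauD (leqnSn (msize p)) hy).
  rewrite -[RHS](rmorph0 etaR) -(line_num0 u hd hp) /path_num.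
  rewrite (@cramer_num_morph _ _ _ _ _ etaR _ tauD) // => z /=.
  by rewrite horner_evalE map_polyC hornerC.
have cE : map_mx etaR (line d u) - map_mx tauD c0 = vec_mx (\row_k ((d 0 k, u 0 k) : dual Kbar)).
  apply/matrixP => i j; rewrite !mxE etaE.
  apply: dual_eqP; rewrite raddfB /= ?dfst_dinj ?dsnd_dinj /dfst /dsnd /= ?derivE ?hornerE /=;
    ring.
have ellE : (fun i => etaR (ellb i)%:P) =1 (fun i => tauD (ell i)).
  by move=> i; rewrite /= horner_evalE map_polyC hornerC.
have liE : etaR lib%:P = tauD li by rewrite /= horner_evalE map_polyC hornerC libE.
have cols_eq r (q : r.-tuple 'X_{1..n.+1}) :
    map_mx etaR (term_cols (shape_mx (fun i => (ellb i)%:P) lib%:P (line d u)) (e0 _ m0) q) =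
    term_cols (shape_mx (fun i => tauD (ell i)) (tauD li) (map_mx etaR (line d u))) (e0 _ m0) q.
  apply: (etrans (map_term_cols _ _ _ _ _)).
  exact: (etrans (eq_term_cols _ _ _ _ ellE)
    (congr1 (fun z => term_cols (shape_mx _ z _) _ q) liE)).
have hch : chart_M t (fun i => tauD (ell i)) (tauD li) (map_mx etaR (line d u)) *m vec_mx y =
    chart_N b (fun i => tauD (ell i)) (tauD li) (map_mx etaR (line d u)).
  by rewrite /chart_M /chart_N -!cols_eq.
exists (map_mx (@dsnd Kbar) y); split=> [p hp|k].
  have := congr1 (@dsnd Kbar) (vanish p hp).
  rewrite -[mmap tauD]/(mmap (fun z => dinj (iota z))) dual_taylor raddf0 => e.
  rewrite -[RHS]e; apply: eq_bigr => i _.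
  by rewrite mxE evy.
have liR : tauD li * tauD (ell ord_max) = 1 by rewrite -rmorphM mulVf // rmorph1.
have /rowP/(_ k) := gen_num_chart (tau := tauD) liR hch.
rewrite cE vec_mxK mxE [RHS]mxE [X in _ = _ * X]mxE => /(congr1 (@dsnd Kbar)).
rewrite dsndM -[mmap tauD]/(mmap (fun z => dinj (iota z))) !dual_taylor.
have -> : dfst (mmap (fun z => dinj (iota z)) (fun i => y 0 i) (\det gen_Q)) =
    evm iota (chart_map d) (\det gen_Q).
  by rewrite -[mmap _]/(mmap tauD) mmap_morph; apply: evy.
rewrite /dfst /dsnd /= => e.
under eq_bigr do rewrite mulrBr mulrCA.
rewrite sumrB -mulr_sumr; apply/eqP; rewrite subr_eq; apply/eqP.
rewrite [d 0 k * _]mulrC; apply: (etrans _ (etrans e _)).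
  by apply: eq_bigr => i _; rewrite mxE -evy.
by congr (_ + _ * _); apply: eq_bigr => i _; rewrite mxE -evy.
Qed.

(** The derivative of the inverse of the chart is a left inverse of the
    derivative of the chart, so independent directions stay independent. *)
Lemma chart_tangent_space d : chart_dom d -> exists2 V : 'M[Kbar]_(D, mu * nu), row_free V &
  forall i p, IC p -> \sum_k V i k * evm iota (chart_map d) (mderiv k p) = 0.
Proof.
move=> hd; have /fin_all_exists[v hv] i := tangent_vector (delta_mx 0 i) hd.
exists (\matrix_(i, k) v i 0 k) => [|i p hp]; last first.
  have [h _] := hv i; rewrite -[RHS](h p hp); apply: eq_bigr => k _.
  by rewrite mxE.
pose q := evm iota (chart_map d) (\det gen_Q).
have q0 : q != 0.
  by have /chart_codomP[_] := chart_map_codom hd; rewrite evmE.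
pose G := \matrix_(j, k) (q^-1 * (evm iota (chart_map d) (mderiv j (gen_num 0 k))
       - d 0 k * evm iota (chart_map d) (mderiv j (\det gen_Q)))).
apply/row_freeP; exists G; apply/matrixP => i k; rewrite [LHS]mxE.
have [_ /(_ k) h] := hv i.
transitivity (q^-1 * (q * (delta_mx 0 i : 'rV_D) 0 k)).
  rewrite -h mulr_sumr; apply: eq_bigr => j _; rewrite !mxE; ring.
by rewrite mulrA mulVf // mul1r !mxE eqxx eq_sym.
Qed.

(** * Smoothness *)

Section Smooth.
Variables (L : fieldType) (j : {rmorphism K -> L}).
Variable x : 'rV[L]_(mu * nu).
Hypothesis x_IC : zero_locus j IC x.

Definition gradients r (p : 'I_r -> {mpoly K[mu * nu]}) (F : fieldType)
    (tau : {rmorphism K -> F}) (y : 'rV[F]_(mu * nu)) : 'M[F]_(r, mu * nu) :=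
  \matrix_(i, k) evm tau y (mderiv k (p i)).

Definition tangent_bounded : Prop := forall r (T : 'M[L]_(r, mu * nu)), row_free T ->
  (forall v : 'rV_(mu * nu), (v <= T)%MS -> is_tangent j IC x v) -> (r <= D)%N.

(** Independence of gradients is an open condition, so it spreads from x to a
    point of the chart, where the tangent space is known. *)
Lemma gradients_bound r (p : 'I_r -> {mpoly K[mu * nu]}) : (forall i, IC (p i)) ->
  row_free (gradients p j x) -> (D + r <= mu * nu)%N.
Proof.
move=> hp fr.
have full : row_full (gradients p j x)^T by rewrite /row_full mxrank_tr.
pose f := fullrankfun full.
pose minor : {mpoly K[mu * nu]} := \det (\matrix_(i, l) mderiv (f l) (p i)).
have minorE (F : fieldType) (tau : {rmorphism K -> F}) (y : 'rV[F]_(mu * nu)) :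
    evm tau y minor = \det (rowsub f (gradients p tau y)^T).
  rewrite -det_tr /minor -[LHS]/(evm tau y _) -det_map_mx; congr (\det _).
  by apply/matrixP => i l; rewrite !mxE.
have nIC : ~ IC minor.
  move=> /x_IC; rewrite evmE minorE => /eqP.
  by apply/negP; rewrite -unitfE -unitmxE; apply: fullrowsub_unit.
have [d [hd nd]] : exists d, chart_dom d /\ evm iota (chart_map d) minor <> 0.
  apply: NNPP => h; apply: nIC; apply: principal_dense => d hd.
  by apply: NNPP => ne; apply: h; exists d.
have [V fV hV] := chart_tangent_space hd.
have V0 : V *m (gradients p iota (chart_map d))^T = 0.
  apply/matrixP => i l; rewrite [RHS]mxE -(hV i _ (hp l)) mxE; apply: eq_bigr => k _.
  by rewrite !mxE.
apply: leq_trans (mulmx0_rank_max V0); rewrite (eqP fV) leq_add2l.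
move/eqP: nd; rewrite minorE -unitfE -unitmxE -row_free_unit => /eqP rk.
by rewrite -[X in (X <= _)%N]rk mxrankS // rowsub_sub.
Qed.

(** A maximal independent family of gradients cuts out the tangent space. *)
Lemma tangent_space_dim : tangent_bounded -> tangent_dim j IC x D.
Proof.
move=> hle.
pose Q d := exists r (p : 'I_r -> {mpoly K[mu * nu]}),
  [/\ d = (mu * nu - r)%N, forall i, IC (p i) & row_free (gradients p j x)].
have [_ [[r [p [-> hp fr]]] maxr]] : exists d, Q d /\ forall d', Q d' -> (d <= d')%N.
  apply: ex_least; exists (mu * nu - 0)%N, 0%N, (fun=> 0); split=> //; first by case.
  by rewrite /row_free -leqn0 rank_leq_row.
set G := gradients p j x in fr.
have rle : (r <= mu * nu)%N by rewrite -(eqP fr) rank_leq_col.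
have sub g : IC g -> (\row_k evm j x (mderiv k g) <= G)%MS.
  move=> hg; set w := \row_k _; apply: contraT => nw.
  pose p' (i : 'I_(r + 1)) := match split i with inl i => p i | inr _ => g end.
  have eG : gradients p' j x = col_mx G w.
    by apply/matrixP => i k; rewrite !mxE /p'; case: (split i) => i'; rewrite !mxE.
  have lt : (G < col_mx G w)%MS.
    rewrite ltmxE col_mx_sub submx_refl (negPf nw) andbT.
    by have := submx_refl (col_mx G w); rewrite col_mx_sub => /andP[].
  have fr' : row_free (gradients p' j x).
    rewrite /row_free eqn_leq rank_leq_row eG /=.
    by have := rank_ltmx lt; rewrite (eqP fr) => h; apply: leq_trans h; rewrite addn1.
  have rle' : (r + 1 <= mu * nu)%N by rewrite -(eqP fr') rank_leq_col.
  have /maxr : Q (mu * nu - (r + 1))%N.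
    by exists (r + 1)%N, p'; split=> // i; rewrite /p'; case: (split i).
  by rewrite leqNgt ltn_sub2l ?addn1 // -addn1.
have rkE : \rank (kermx G^T) = (mu * nu - r)%N.
  by rewrite mxrank_ker mxrank_tr (eqP fr).
have tanP v : (v <= kermx G^T)%MS <-> is_tangent j IC x v.
  have GE i : (v *m G^T) 0 i = \sum_k v 0 k * ev j (mderiv k (p i)) x.
    by rewrite mxE; apply: eq_bigr => k _; rewrite evmE !mxE.
  split=> [/sub_kermxP h g hg|h]; last first.
    by apply/sub_kermxP/matrixP => z i; rewrite ord1 GE (h _ (hp i)) mxE.
  have /submxP[c hc] := sub g hg.
  transitivity ((v *m (\row_k evm j x (mderiv k g))^T) 0 0).
    by rewrite mxE; apply: eq_bigr => k _; rewrite evmE !mxE.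
  by rewrite hc trmx_mul mulmxA h mul0mx mxE.
have rk : \rank (kermx G^T) = D.
  apply/eqP; rewrite eqn_leq; apply/andP; split.
    apply: (hle _ (row_base (kermx G^T))); first exact: row_base_free.
    by move=> v hv; apply/tanP; rewrite -(eq_row_base (kermx G^T)).
  by rewrite rkE -(leq_add2r r) subnK //; apply: gradients_bound fr.
rewrite -rk; exists (row_base (kermx G^T)); split; first exact: row_base_free.
by move=> v; rewrite eq_row_base; apply: tanP.
Qed.

End Smooth.

(** * Algebraic dependence *)

(** On the chart the functions have a common denominator.  The [s ^ (D + 1)]
    products of powers less than [s] become polynomials in [D] variables of degree
    linear in [s], and of the order of [s ^ D] monomials are available. *)
Lemma principal_dependent (z : 'I_D.+1 -> {mpoly K[mu * nu]}) :
  ~ algebraically_independent_mod IC z.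
Proof.
pose k := (\max_i msize (z i))%N.
have hk i : (msize (z i) <= k.+1)%N by rewrite leqW // (leq_bigmax i).
pose de := \det gen_M.
pose ze i := cramer_num (cC D) k gen_M gen_N (z i).
have ze_at d i : chart_dom d ->
    evm iota d (ze i) = evm iota d de ^+ k * evm iota (chart_map d) (z i).
  move=> hd; rewrite /ze (@cramer_num_morph _ _ _ _ _ _ _ iota); last exact: evm_C.
  rewrite map_gen_M map_gen_N cramer_num_pt // -det_map_mx map_gen_M.
  by [].
pose E := maxn (msize (de ^+ k)) (\max_i msize (ze i)).
(* s * W bounds the number of values of an exponent in products of degree at
   most s in each of the D + 1 factors, whence the choice of s > W ^ D *)
pose W := (D.+1 * E).+1.
pose s := (W ^ D).+1.
pose T := {ffun 'I_D.+1 -> 'I_s}.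
pose g (h : T) := \prod_i ((de ^+ k) ^+ (s - h i) * ze i ^+ h i).
have [al [h0 nz] rel] : exists2 al : T -> K, exists h, al h != 0 & \sum_h al h *: g h = 0.
  apply: (@monomials_dependent _ _ _ g (D.+1 * (s * E))) => [h|].
    rewrite -[X in (_ <= X.+1)%N](_ : (\sum_(i < D.+1) s * E)%N = _); last first.
      by rewrite sum_nat_const card_ord.
    apply: msize_prod_bound => i; rewrite -[in X in (_ <= X)%N](subnK (ltnW (ltn_ord (h i)))) mulnDl.
    apply: msizeM_bound; apply: msizeX_bound; first by rewrite leqW // leq_maxl.
    by rewrite leqW // (leq_trans _ (leq_maxr _ _)) // (leq_bigmax i).
  rewrite card_ffun !card_ord expnS.
  apply: (@leq_ltn_trans ((s * W) ^ D)).
    by rewrite leq_exp2r ?muln_gt0 // mulnCA /W [X in (_ <= X)%N]mulnS -add1n leq_add2r.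
  by rewrite expnMn mulnC ltn_pmul2r ?expn_gt0.
pose mo (h : T) : 'X_{1..D.+1} := [multinom (h i : nat) | i < D.+1].
move=> /(_ (\sum_h al h *: 'X_[mo h])) hind.
have : \sum_h al h *: 'X_[mo h] = 0 :> {mpoly K[D.+1]}.
  apply: hind; apply: principal_dense => d hd; rewrite evm_comp.
  have de0 : evm iota d de != 0 by rewrite -evmE; apply/chart_domP.
  apply: (mulfI (_ : evm iota d de ^+ (k * s * D.+1) != 0)); first by rewrite expf_neq0.
  set y := fun i => evm iota (chart_map d) _.
  have E1 : mmap iota y (\sum_h al h *: 'X_[mo h]) = \sum_h iota (al h) * mmap1 y (mo h).
    rewrite raddf_sum; apply: eq_bigr => h _.
    exact: (etrans (mmapZ _ _ _ _) (congr1 _ (mmapX _ _ _))).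
  have E2 : evm iota d (\sum_h al h *: g h) = \sum_h iota (al h) * evm iota d (g h).
    rewrite raddf_sum; apply: eq_bigr => h _.
    exact: (etrans (mmapZ _ _ _ _) _).
  rewrite mulr0 E1 -[RHS](rmorph0 (evm iota d)) -rel [RHS]E2 mulr_sumr.
  apply: eq_bigr => h _; rewrite mulrCA; congr (_ * _).
  have -> : evm iota d de ^+ (k * s * D.+1) = \prod_(i < D.+1) evm iota d de ^+ (k * s).
    by rewrite prodr_const card_ord -exprM.
  rewrite /g rmorph_prod -big_split /=.
  apply: eq_bigr => i _; rewrite mnmE rmorphM !rmorphXn /= ze_at // /y tnth_mktuple.
  rewrite exprMn mulrA -!exprM -exprD; congr (_ ^+ _ * _).
  by rewrite -mulnDr subnK // ltnW.
move=> /(congr1 (mcoeff (mo h0))); rewrite raddf_sum mcoeff0 /= => /eqP.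
rewrite (bigD1 h0) //= big1 ?addr0 => [|h ne]; rewrite mcoeffZ mcoeffX.
  by rewrite eqxx mulr1 (negPf nz).
case: eqP => [e|]; rewrite ?mulr0 //; case/eqP: ne; apply/ffunP => i; apply: val_inj.
by have /mnmP/(_ i) := e; rewrite !mnmE.
Qed.

Lemma principal_dim : variety_dim IC D.
Proof.
split; last exact: principal_dependent.
by exists (fun k => gen_num 0 k); apply: gen_num_independent.
Qed.

(** The bound on the tangent space is obtained over the field of the point
    itself: over an imperfect field a radical ideal may become nonreduced over the
    algebraic closure. *)
Lemma radical_smooth (L : fieldType) (j : {rmorphism K -> L}) (x : 'rV[L]_(mu * nu)) J :
  is_ideal J -> radical J -> corresponds t b J x -> zero_locus j IC x ->
  smooth_of_dim_at j IC D x.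
Proof.
move=> idJ rJ hJ hx; split=> //; first exact: principal_dim.
apply: tangent_space_dim => // r T fT hT.
have sch : zero_locus j (@scheme_ideal _ _ _ t b K) x.
  by move=> p hp; apply: hx; case: IC_pc => _ h _; apply: h.
have hc := (scheme_points t b j x).1 sch.
have eJ := fiber_ideal_of_corresponds t_oi b_bd idJ hJ.
apply: (tangent_bound t_oi b_bd t_i1 hc _ fT) => [a k|v vT].
  by move=> /eJ/rJ/eJ.
apply: (tangent_flat (iota := j) sch) => p hp; apply: (hT v vT).
by case: IC_pc => _ h _; apply: h.
Qed.

End MainChart.

(** * From the given generators to the chart *)

Section GivenGenerators.
Variables (F : fieldType) (n m0 : nat).
Local Notation mu := m0.+1.

(** The matrix of the shape generators that are given by [lam] and [f]. *)
Definition coefs_mx (lam : 'I_mu -> F) (f : 'I_n -> {poly F}) : 'M[F]_(n.+1, mu) :=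
  \matrix_(i, j) if unlift ord_max i is Some k then (f k)`_j else lam j.

Lemma horner_alg_sum N (l : {mpoly F[N]}) (a : 'I_mu -> F) :
  horner_alg l (\sum_j a j *: 'X^j) = \sum_j a j *: l ^+ j.
Proof.
rewrite rmorph_sum; apply: eq_bigr => j _.
by rewrite /= linearZ /= rmorphXn /= horner_algX -scalerAl mul1r.
Qed.

Lemma shape_gens_fam ell lam (f : 'I_n -> {poly F}) : (forall k, (size (f k) <= mu)%N) ->
  shape_gens ell lam f =1 shape_fam ell (coefs_mx lam f).
Proof.
move=> hf i; rewrite /shape_gens /shape_fam /pseudo_border.
case: (unliftP ord_max i) => [k ->|->].
  congr (_ - _).
  have {1}-> : f k = \sum_(j < mu) (f k)`_j *: 'X^j.
    rewrite -(poly_def mu (fun j => (f k)`_j)); apply/polyP => j; rewrite coef_poly.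
    by case: ltnP => // h; rewrite nth_default // (leq_trans (hf k)).
  by rewrite horner_alg_sum; apply: eq_bigr => j _; rewrite mxE liftK.
rewrite /char_poly_of rmorphB rmorphXn /= horner_algX horner_alg_sum; congr (_ - _).
by apply: eq_bigr => j _; rewrite mxE unlift_none.
Qed.

Lemma perturbed_gens_fam ell lam (f : 'I_n -> {poly F}) d : (forall k, (size (f k) <= mu)%N) ->
  perturbed_gens ell lam f d =1 shape_fam ell (coefs_mx lam f + d).
Proof.
move=> hf i; have E k : \sum_(j < mu) d (lift ord_max k) j *: 'X^j =
    \poly_(j < mu) (if insub j is Some j' then d (lift ord_max k) j' else 0).
  rewrite poly_def; apply: eq_bigr => j _; congr (_ *: _).
  by case: insubP => [j' _ e|]; [congr (d _ _); apply/val_inj|rewrite ltn_ord].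
rewrite /perturbed_gens shape_gens_fam => [|k]; last first.
  by rewrite (leq_trans (size_polyD _ _)) // geq_max hf E size_poly.
suff -> : coefs_mx (perturb_lam lam d) (perturb_f f d) = coefs_mx lam f + d by [].
apply/matrixP => k j; rewrite !mxE; case: (unliftP ord_max k) => [k' ->|->] //.
rewrite coefD E coef_poly ltn_ord; congr (_ + _).
by case: insubP => [j' _ e|]; [congr (d _ _); apply/val_inj|rewrite ltn_ord].
Qed.

End GivenGenerators.

Lemma map_coefs_mx (K L : fieldType) (iota : {rmorphism K -> L}) n m0 (lam : 'I_m0.+1 -> K)
    (f : 'I_n -> {poly K}) :
  coefs_mx (fun j => iota (lam j)) (fun k => map_poly iota (f k)) = map_mx iota (coefs_mx lam f).
Proof. by apply/matrixP => i j; rewrite !mxE; case: unlift => // k; rewrite coef_map. Qed.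

Theorem theorem4p2
  (K : fieldType) (Kbar : closedFieldType) (iota : {rmorphism K -> Kbar})
  (Kbar_algebraic : forall z : Kbar, algebraicOver iota z)
  (n mu nu : nat)
  (t : mu.-tuple 'X_{1..n.+1}) (b : nu.-tuple 'X_{1..n.+1})
  (t_order_ideal : is_order_ideal t) (b_border : is_border t b)
  (I : {mpoly K[n.+1]} -> Prop)
  (I_ideal : is_ideal I) (I_zero_dim : zero_dimensional I)
  (I_radical : radical I) (I_border_basis : has_border_basis t I)
  (ell : 'I_n.+1 -> K) (ell_last : ell ord_max != 0)
  (lam : 'I_mu -> K) (f : 'I_n -> {poly K})
  (f_deg : forall k, (size (f k) <= mu)%N)
  (I_shape : forall g, I g <-> family_ideal (shape_gens ell lam f) g)
  (IC : {mpoly K[mu * nu]} -> Prop)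
  (IC_principal : is_principal_component t b iota IC) :
  let H (d : 'M[K]_(n.+1, mu)) := perturbed_gens ell lam f d in
  let I_ d := family_ideal (H d) in
  let Ibar (d : 'rV[Kbar]_(n.+1 * mu)) :=
    family_ideal (perturbed_gens (fun i => iota (ell i)) (fun j => iota (lam j))
                    (fun k => map_poly iota (f k)) (vec_mx d)) in
  let C_O := zero_locus iota IC in
  let B_OP_C_O (x : 'rV[Kbar]_(mu * nu)) := basis_locus iota t b ell x /\ C_O x in
  (exists U : 'rV[Kbar]_(n.+1 * mu) -> Prop,
    [/\ open_in iota (fun _ => True) U,
        U 0,
        (forall d : 'M[K]_(n.+1, mu), U (map_mx iota (mxvec d)) ->
          [/\ has_border_basis t (I_ d),
              is_pseudo_border_basis mu ell (H d) (I_ d)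
            & forall (M : 'M[K]_mu) (N : 'M[K]_(mu, nu)),
                congr_mod (powers ell) (terms K t) M (I_ d) ->
                congr_mod (powers ell) (terms K b) N (I_ d) ->
                M \in unitmx /\
                congr_mod (terms K t) (terms K b) (invmx M *m N) (I_ d)])
      & exists Gamma : 'rV[Kbar]_(n.+1 * mu) -> 'rV[Kbar]_(mu * nu),
          [/\ (forall d, U d -> corresponds t b (Ibar d) (Gamma d)),
              open_in iota C_O B_OP_C_O
            & is_isomorphism iota U B_OP_C_O Gamma]])
  /\ is_rational iota IC
  /\ (forall (J : {mpoly K[n.+1]} -> Prop) (x : 'rV[K]_(mu * nu)),
        is_ideal J -> radical J -> corresponds t b J x ->
        zero_locus idfun IC x ->
        smooth_of_dim_at idfun IC (n.+1 * mu) x)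
  /\ (forall (J : {mpoly Kbar[n.+1]} -> Prop) (x : 'rV[Kbar]_(mu * nu)),
        is_ideal J -> radical J -> corresponds t b J x ->
        zero_locus iota IC x ->
        smooth_of_dim_at iota IC (n.+1 * mu) x).
Proof.
case: mu => [|m0] in t lam b t_order_ideal b_border I_border_basis f_deg I_shape IC IC_principal *.
  by case: t_order_ideal.
have [i1 t_i1] := one_index_exists t_order_ideal.
move=> H I_ Ibar C_O B_OP_C_O.
pose c0 := coefs_mx lam f.
have ellb_last : iota (ell ord_max) != 0 by rewrite fmorph_eq0.
have HE d : H d =1 shape_fam ell (c0 + d) by apply: perturbed_gens_fam.
have IE d g : family_ideal (shape_fam ell (c0 + d)) g <-> I_ d g.
  by split; apply: family_ideal_eq => i; rewrite HE.
have chart_map_K (d : 'M[K]_(n.+1, m0.+1)) :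
    chart_dom iota t ell c0 (map_mx iota (mxvec d)) <->
    chart_M t ell (ell ord_max)^-1 (c0 + d) \in unitmx.
  rewrite /chart_dom /cpt -map_vec_mx mxvecK -map_mxD -fmorphV -(map_chart_M t iota).
  by rewrite map_unitmx.
have dom0 : chart_dom iota t ell c0 0.
  have -> : 0 = map_mx iota (mxvec (0 : 'M[K]_(n.+1, m0.+1))) by rewrite !linear0 map_mx0.
  apply/chart_map_K; rewrite addr0.
  have /(basis_modP (shape_kerP ell_last c0)) : basis_mod (terms K t) (family_ideal (shape_fam ell c0)).
    apply: (basis_mod_ext (fun=> erefl)) I_border_basis => g; rewrite I_shape.
    by split; apply: family_ideal_eq => i; rewrite shape_gens_fam.
  by rewrite coords_shape_terms.
split; last split; last split.
- exists (chart_dom iota t ell c0); split=> //.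
  + exact: chart_dom_open.
  + move=> d /chart_map_K hM.
    have ker := shape_kerP ell_last (c0 + d).
    have bt : basis_mod (terms K t) (family_ideal (shape_fam ell (c0 + d))).
      by apply/(basis_modP ker); rewrite coords_shape_terms.
    split.
    * exact: (basis_mod_ext (fun=> erefl) (IE d) bt).
    * split=> [//|i|]; first by exists ((c0 + d) i); apply: HE.
      exact: (basis_mod_ext (fun=> erefl) (IE d) (shape_powers_basis ell_last (c0 + d))).
    move=> M N hMd hNd.
    have IE' g : I_ d g <-> family_ideal (shape_fam ell (c0 + d)) g by rewrite IE.
    have eM : M = chart_M t ell (ell ord_max)^-1 (c0 + d).
      have /(congr_modP ker) := congr_mod_ext (fun=> erefl) IE' hMd.
      by rewrite (cyc_powers ell_last) coords_shape_terms mul1mx.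
    have eN : N = chart_N b ell (ell ord_max)^-1 (c0 + d).
      have /(congr_modP ker) := congr_mod_ext (fun=> erefl) IE' hNd.
      by rewrite (cyc_powers ell_last) coords_shape_terms mul1mx.
    split; first by rewrite eM.
    apply: (congr_mod_ext (fun=> erefl) (IE d)); apply/(congr_modP ker).
    by rewrite !coords_shape_terms eM eN mulKVmx.
  + exists (chart_map iota t b ell c0); split.
    * move=> d hd; have [hb hc] := chart_corresponds b ellb_last hd.
      have IbE g : family_ideal (shape_fam (fun i => iota (ell i)) (cpt iota c0 d)) g <-> Ibar d g.
        rewrite /Ibar; split; apply: family_ideal_eq => i;
          rewrite perturbed_gens_fam ?map_coefs_mx // => k; exact: leq_trans (size_poly _ _) (f_deg k).
      split; first exact: (basis_mod_ext (fun=> erefl) IbE hb).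
      exact: (congr_mod_ext (fun=> erefl) IbE hc).
    * exact: (chart_codom_open t_order_ideal b_border t_i1 IC_principal ell).
    * exact: (chart_isomorphism t_order_ideal b_border t_i1 IC_principal ell_last).
- exact: (principal_rational t_order_ideal b_border t_i1 IC_principal ell_last dom0).
- move=> J x; exact: (radical_smooth t_order_ideal b_border t_i1 IC_principal ell_last dom0).
- move=> J x; exact: (radical_smooth t_order_ideal b_border t_i1 IC_principal ell_last dom0).
Qed.
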